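(* Let $f$ be a transcendental entire function. If $f$ has an unbounded Fatou component contained in $BO(f)$, then $BO(f)\cup\{\infty\}$ is a connected subset of the Riemann sphere. Likewise, if $f$ has an unbounded Fatou component contained in $BU(f)$, then $BU(f)\cup\{\infty\}$ is a connected subset of the Riemann sphere.
   Context: For an entire function $f$, $f^n$ denotes its $n$-th iterate. The Julia set $J(f)$ is the set of points in no neighbourhood of which the iterates $(f^n)$ form a normal family; the Fatou set is $F(f)=\mathbb{C}\setminus J(f)$, and its connected components are Fatou components. The escaping set is $I(f) := \{z\in\mathbb{C} : f^n(z)\to\infty\}$. The bounded orbit set is $BO(f) := \{z\in\mathbb{C} : \text{there exists } K>0 \text{ such that } |f^n(z)|<K \text{ for all } n\ge 0\}$. The bungee set is $BU(f) := \mathbb{C}\setminus (I(f)\cup BO(f))$. *)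

(* Defs.v *)
(* The complex plane is modelled as (R[i])^o for an
   arbitrary R : realType (every realType is a model of the reals), i.e. the
   field of complex numbers R[i] viewed as a normed module over itself, so that
   [derivable f z 1] is complex differentiability. *)
From HB Require Import structures.
From mathcomp Require Import all_boot all_order all_algebra.
From mathcomp Require Import all_classical all_reals all_analysis.
From mathcomp Require Import complex.
Import Order.TTheory GRing.Theory Num.Theory.
Import numFieldNormedType.Exports.

Set Implicit Arguments.
Unset Strict Implicit.
Unset Printing Implicit Defensive.

Local Open Scope classical_set_scope.
Local Open Scope ring_scope.
Local Open Scope complex_scope.

Notation Cplx R := ((complex R)^o).

(* The Riemann sphere: the one-point compactification of C, where
   [Some z] is the point z of C and [None] is the point at infinity. *)
Notation RiemannSphere R := (one_point_compactification (Cplx R)).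

Section Dynamics.
Variable R : realType.
Implicit Types (f g : Cplx R -> Cplx R) (A U : set (Cplx R)).

Definition entire f := forall z : Cplx R, derivable f z 1.

Definition polynomial_fun f := exists p : {poly R[i]}, forall z : Cplx R, f z = p.[z].

Definition transcendental_entire f := entire f /\ ~ polynomial_fun f.

Definition fiter f (n : nat) : Cplx R -> Cplx R := iter n f.

Definition cvg_loc_unif (F : nat -> Cplx R -> Cplx R) g A :=
  forall z, A z -> exists2 r : R, 0 < r &
    forall eps : R, 0 < eps -> \forall k \near \oo,
      forall w, A w -> `|w - z| < r%:C -> `|F k w - g w| < eps%:C.

Definition cvg_loc_unif_infty (F : nat -> Cplx R -> Cplx R) A :=
  forall z, A z -> exists2 r : R, 0 < r &
    forall M : R, \forall k \near \oo,
      forall w, A w -> `|w - z| < r%:C -> M%:C < `|F k w|.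

Definition iterates_normal_on f A :=
  forall s : nat -> nat, exists phi : nat -> nat,
    (forall k, (phi k < phi k.+1)%N) /\
    ((exists g, (forall w, A w -> derivable g w 1) /\
                cvg_loc_unif (fun k => fiter f (s (phi k))) g A)
     \/ cvg_loc_unif_infty (fun k => fiter f (s (phi k))) A).

Definition disc (z : Cplx R) (r : R) : set (Cplx R) :=
  [set w | `|w - z| < r%:C].

Definition fatou_set f : set (Cplx R) :=
  [set z | exists2 r : R, 0 < r & iterates_normal_on f (disc z r)].
Definition julia_set f : set (Cplx R) := ~` fatou_set f.

Definition fatou_component f U :=
  exists2 z, fatou_set f z & U = connected_component (fatou_set f) z.

Definition escaping_set f : set (Cplx R) :=
  [set z | forall M : R, \forall n \near \oo, M%:C < `|fiter f n z|].
Definition bounded_orbit_set f : set (Cplx R) :=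
  [set z | exists K : R, forall n, `|fiter f n z| < K%:C].
Definition bungee_set f : set (Cplx R) :=
  ~` (escaping_set f `|` bounded_orbit_set f).

Definition unbounded A := forall M : R, exists2 z, A z & M%:C < `|z|.

Definition with_infty A : set (RiemannSphere R) :=
  (Some @` A) `|` [set None].

End Dynamics.

(* Main.v *)
Require Import Defs.
From HB Require Import structures.
From mathcomp Require Import all_boot all_order all_algebra.
From mathcomp Require Import all_classical all_reals all_analysis.
From mathcomp Require Import complex ring lra.
Import Order.TTheory GRing.Theory Num.Theory.
Import numFieldNormedType.Exports.

Set Implicit Arguments.
Unset Strict Implicit.
Unset Printing Implicit Defensive.

Local Open Scope classical_set_scope.
Local Open Scope ring_scope.
Local Open Scope complex_scope.

Local Notation Re := (@complex.Re _).
Local Notation Im := (@complex.Im _).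

(* Let [E] be the bounded orbit set or the bungee set, and [U] an unbounded Fatou
   component inside [E].  If [E] with infinity is disconnected, some bounded open [G]
   meets [E] while its boundary does not.  As [E] is completely invariant, [f^n(G)]
   cannot meet [U] without containing it (maximum principle), so every iterate omits a
   fixed disc [D(a, r)] on [G]; Harnack's inequality for [log |f^n - a|] then shows that
   [E] is open and closed in [G].  Let [V] be a component of [G] intersected with [E]:
   it is a bounded domain in [E] whose boundary misses [E].  The images [f^n(V)] are
   pairwise disjoint, since otherwise all orbits on the closure of [V] are bounded.
   Hence the images of [V] under [H_n = 1 / (f^n - a)] are disjoint open subsets of a
   disc and their areas are summable.  The harmonic measure, seen from [z0], of the
   boundary points that [H_n] moves away from [H_n z0] is controlled by that area, so
   some boundary point follows the orbit of [z0] closely enough to belong to [E], a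
   contradiction.  Harmonic measure only enters through explicit superharmonic
   functions, and complex analysis only through second order Taylor expansions of
   entire functions, which are derived from Goursat's theorem. *)

(** * The complex modulus *)

(** The fourth power in [pot] is what makes summable areas sufficient. Its Laplacian is proportional
    to [|w - w0|^2], so a mass at [a] needs a weight proportional only to [t = |a - w0|^2 + h^2],
    and at [w0] this weight meets the logarithm in [t ln (A2 / t) <= A2]: the potential at the
    centre is linear in the area. With the square of the distance a factor [ln (1 / area)] could
    remain. The potential is superharmonic only where a hit grid point is near. On compact subsets
    of [V] this holds once the mesh is small, with a threshold depending on the finitely many times
    involved; hence the areas are compared along an ultrafilter of meshes, and compactness of the
    boundary passes from finitely many times to all. The other obstacle is regularity: the maximum
    principle uses second order expansions, while differentiability gives first order ones. A
    primitive gains one order, and its difference quotients carry the principle over to [f] as a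
    bound; dividing by polynomials of degree 1 and 2 then bounds divided differences, which makes
    the derivative differentiable. *)

Section Modulus.
Variable R : realType.
Implicit Types (z w h : R[i]) (x y : R).

(* The norm [`|z|] of the library is an element of [R[i]]; [nrm] is its value in [R]. *)
Definition nrm (z : R[i]) : R := ComplexField.Normc.normc z.

Lemma normE z : `|z| = (nrm z)%:C. Proof. by []. Qed.

Lemma nrm_ge0 z : 0 <= nrm z.
Proof. by case: z => a b; rewrite sqrtr_ge0. Qed.

Lemma nrm0 : nrm 0 = 0. Proof. exact: ComplexField.Normc.normc0. Qed.
Lemma nrm1 : nrm 1 = 1. Proof. exact: ComplexField.Normc.normc1. Qed.

Lemma nrm0_eq0 z : nrm z = 0 -> z = 0.
Proof. exact: ComplexField.Normc.eq0_normc. Qed.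

Lemma nrm_gt0 z : z != 0 -> 0 < nrm z.
Proof.
move=> z0; rewrite lt_neqAle nrm_ge0 andbT eq_sym.
by apply: contra z0 => /eqP/nrm0_eq0 ->.
Qed.

Lemma nrm_gt0_neq z : 0 < nrm z -> z != 0.
Proof. by apply: contraTneq => ->; rewrite nrm0 ltxx. Qed.

Lemma nrmM z w : nrm (z * w) = nrm z * nrm w.
Proof. exact: ComplexField.Normc.normcM. Qed.

Lemma nrmV z : nrm z^-1 = (nrm z)^-1.
Proof. exact: ComplexField.Normc.normcV. Qed.

Lemma nrmX z n : nrm (z ^+ n) = nrm z ^+ n.
Proof. by elim: n => [|n ih]; rewrite ?expr0 ?nrm1// !exprS nrmM ih. Qed.

Lemma lec_real x y : (x%:C <= y%:C :> R[i]) = (x <= y).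
Proof. by rewrite /real_complex_def; simpc. Qed.

Lemma ltc_real x y : (x%:C < y%:C :> R[i]) = (x < y).
Proof. by rewrite /real_complex_def; simpc. Qed.

Lemma nrmD z w : nrm (z + w) <= nrm z + nrm w.
Proof. by rewrite -lec_real rmorphD /= -!normE ler_normD. Qed.

Lemma nrmN z : nrm (- z) = nrm z.
Proof. by case: z => a b; rewrite /nrm /= !sqrrN. Qed.

Lemma nrm_distC z w : nrm (z - w) = nrm (w - z).
Proof. by rewrite -nrmN opprB. Qed.

Lemma nrm_sub z w : nrm (z - w) <= nrm z + nrm w.
Proof. by rewrite (le_trans (nrmD _ _))// nrmN. Qed.

Lemma nrm_tri w z (u : R[i]) : nrm (z - u) <= nrm (z - w) + nrm (w - u).
Proof. have -> : z - u = (z - w) + (w - u) by ring.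
exact: nrmD. Qed.

Lemma nrm_lb z w : nrm z - nrm w <= nrm (z + w).
Proof. rewrite lerBlDr; have {1}-> : z = (z + w) - w by ring.
exact: nrm_sub. Qed.

Lemma nrm_lbB z w : nrm z - nrm w <= nrm (z - w).
Proof. by rewrite -(nrmN w) nrm_lb. Qed.

Lemma nrm_real x : nrm x%:C = `|x|.
Proof. by rewrite /nrm /= expr0n /= addr0 sqrtr_sqr. Qed.

Lemma nrm_i : nrm 'i = 1.
Proof. by rewrite /nrm /= expr0n /= add0r expr1n sqrtr1. Qed.

Definition sqn z := Re z ^+ 2 + Im z ^+ 2.

Lemma sqnE z : sqn z = nrm z ^+ 2.
Proof.
by case: z => a b; rewrite /sqn /nrm /= sqr_sqrtr// addr_ge0 ?sqr_ge0.
Qed.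

Lemma sqn_ge0 z : 0 <= sqn z. Proof. by rewrite addr_ge0 ?sqr_ge0. Qed.

Lemma ReD z w : Re (z + w) = Re z + Re w. Proof. by case: z w => [? ?] []. Qed.
Lemma ImD z w : Im (z + w) = Im z + Im w. Proof. by case: z w => [? ?] []. Qed.
Lemma ReN z : Re (- z) = - Re z. Proof. by case: z. Qed.
Lemma ImN z : Im (- z) = - Im z. Proof. by case: z. Qed.
Lemma ReM z w : Re (z * w) = Re z * Re w - Im z * Im w.
Proof. by case: z w => [? ?] []. Qed.
Lemma ImM z w : Im (z * w) = Re z * Im w + Im z * Re w.
Proof. by case: z w => [? ?] []. Qed.

Lemma eqC z w : Re z = Re w -> Im z = Im w -> z = w.
Proof. by case: z w => [? ?] [? ?] /= -> ->. Qed.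

Lemma Re_nrm z : `|Re z| <= nrm z.
Proof.
rewrite -(ler_pXn2r (n:=2)) ?nnegrE ?nrm_ge0 //= -sqnE real_normK ?num_real//.
by rewrite lerDl sqr_ge0.
Qed.

Lemma Im_nrm z : `|Im z| <= nrm z.
Proof.
rewrite -(ler_pXn2r (n:=2)) ?nnegrE ?nrm_ge0 //= -sqnE real_normK ?num_real//.
by rewrite lerDr sqr_ge0.
Qed.

Lemma nrm_ReIm z : nrm z <= `|Re z| + `|Im z|.
Proof.
rewrite -(ler_pXn2r (n:=2)) ?nnegrE ?nrm_ge0 ?addr_ge0 //= -sqnE /sqn sqrrD.
rewrite !real_normK ?num_real// -addrA [X in _ <= _ + X]addrC addrA lerDl.
by rewrite mulrn_wge0// mulr_ge0.
Qed.

(** Explicit real radii keep every estimate inside the ordered field [R], where [lra] and [nra]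
    apply. *)
Definition cont (f : R[i] -> R[i]) z :=
  forall e : R, 0 < e -> exists2 d : R, 0 < d &
    forall w, nrm (w - z) < d -> nrm (f w - f z) < e.

Definition diff (f : R[i] -> R[i]) z a :=
  forall e : R, 0 < e -> exists2 d : R, 0 < d &
    forall w, nrm (w - z) < d -> nrm (f w - f z - a * (w - z)) <= e * nrm (w - z).

Lemma diff_cont f z a : diff f z a -> cont f z.
Proof.
move=> D e e0; have [d d0 H] := D 1 ltr01.
have ha := nrm_ge0 a.
have p0 : 0 < 2 + nrm a by lra.
exists (Num.min d (e / (2 + nrm a))); first by rewrite lt_min d0 divr_gt0.
move=> w; rewrite lt_min => /andP[wd]; rewrite ltr_pdivlMr// => we.
have := H w wd; rewrite mul1r => {}H.
have : nrm (f w - f z) <= nrm (f w - f z - a * (w - z)) + nrm (a * (w - z)).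
  have {1}-> : f w - f z = (f w - f z - a * (w - z)) + a * (w - z) by ring.
  exact: nrmD.
rewrite nrmM => H2; have hw := nrm_ge0 (w - z); nra.
Qed.

Lemma nbhs_nrmP (z : Cplx R) (A : set (Cplx R)) :
  nbhs z A <-> exists2 r : R, 0 < r & forall w : R[i], nrm (w - z) < r -> A w.
Proof.
rewrite -nbhs_ballE; split=> [[[r s] /= r0 H]|[r r0 H]].
(* A positive complex radius is real: the order on [R[i]] compares only numbers with equal imaginary
   parts. *)
- have /andP[/eqP s0 r0'] : (s == 0) && (0 < r) by move: r0; simpc.
  rewrite s0 in H; exists r => // w wr; apply: H.
  by rewrite /ball /= distrC normE ltc_real.
- exists r%:C => /=; first by rewrite ltc_real.
  by move=> w; rewrite /ball /= distrC normE ltc_real => /H.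
Qed.

Lemma cont_continuous (f : Cplx R -> Cplx R) (z : Cplx R) :
  cont f z <-> {for z, continuous f}.
Proof.
split=> [C A /nbhs_nrmP[r r0 H]|C e e0].
- have [d d0 D] := C r r0; apply/nbhs_nrmP; exists d => // w /D; exact: H.
- have /C/nbhs_nrmP[d d0 D] : nbhs (f z) [set w : Cplx R | nrm (w - f z) < e].
    by apply/nbhs_nrmP; exists e.
  by exists d.
Qed.

Lemma derivable_diff (f : Cplx R -> Cplx R) (z : Cplx R) :
  derivable f z 1 -> exists a, diff f z a.
Proof.
move=> /cvg_ex[a /= H]; exists a => e e0.
have /H : nbhs a [set w : Cplx R | nrm (w - a) < e].
  by apply/nbhs_nrmP; exists e.
rewrite nbhs_filterE /fmap /= /dnbhs /within /= => /nbhs_nrmP[d d0 D].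
exists d => // w wd.
have [->|wz] := eqVneq w z; first by rewrite !subrr mulr0 subrr nrm0 mulr0.
have wz0 : w - z != 0 by rewrite subr_eq0.
have := D (w - z); rewrite subr0 => /(_ wd wz0).
rewrite /= -[(w - z)^-1 *: _]/((w - z)^-1 * _).
rewrite -[(w - z) *: 1]/((w - z) * 1) mulr1 subrK => Q.
have -> : f w - f z - a * (w - z) = ((w - z)^-1 * (f w - f z) - a) * (w - z).
  by rewrite mulrBl mulrAC mulVf// mul1r.
by rewrite nrmM ler_wpM2r ?nrm_ge0// ltW.
Qed.

End Modulus.

(** * Complex differentiability *)

Section DiffCalculus.
Variable R : realType.
Implicit Types (z w a b c : R[i]) (f g : R[i] -> R[i]).

Lemma contD f g z : cont f z -> cont g z -> cont (fun w => f w + g w) z.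
Proof.
move=> F G e e0; have e20 : 0 < e / 2 by rewrite divr_gt0.
have [d d0 D] := F _ e20; have [d' d0' D'] := G _ e20.
exists (Num.min d d'); first by rewrite lt_min d0.
move=> w; rewrite lt_min => /andP[/D wd /D' wd'].
have -> : f w + g w - (f z + g z) = (f w - f z) + (g w - g z) by ring.
by apply: le_lt_trans (nrmD _ _) _; lra.
Qed.

Lemma contM f g z : cont f z -> cont g z -> cont (fun w => f w * g w) z.
Proof.
move=> F G e e0; have nf := nrm_ge0 (f z); have ng := nrm_ge0 (g z).
have p0 : 0 < 2 + nrm (f z) + nrm (g z) by lra.
have e10 : 0 < e / (2 + nrm (f z) + nrm (g z)) by rewrite divr_gt0.
set e1 := e / _ in e10.
have eE : e = e1 * (2 + nrm (f z) + nrm (g z)) by rewrite divfK ?gt_eqF.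
have [d d0 D] := F _ e10; have [d' d0' D'] := G _ e10.
have [d2 d20 D2] := G _ ltr01.
exists (Num.min d (Num.min d' d2)); first by rewrite !lt_min d0 d0'.
move=> w; rewrite !lt_min => /and3P[/D wd /D' wd' /D2 wd2].
have -> : f w * g w - f z * g z = (f w - f z) * g w + f z * (g w - g z) by ring.
apply: le_lt_trans (nrmD _ _) _; rewrite !nrmM.
have gw : nrm (g w) <= nrm (g w - g z) + nrm (g z).
  by have := nrmD (g w - g z) (g z); rewrite subrK.
have H1 : nrm (f w - f z) * nrm (g w) <= e1 * (1 + nrm (g z)).
  by apply: ler_pM; rewrite ?nrm_ge0//; lra.
have H2 : nrm (f z) * nrm (g w - g z) <= nrm (f z) * e1.
  by apply: ler_wpM2l => //; lra.
by rewrite eE; nra.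
Qed.

Lemma cont_inv z : z != 0 -> cont (fun w => w^-1) z.
Proof.
move=> z0 e e0; have nz := nrm_gt0 z0.
exists (Num.min (nrm z / 2) (e * nrm z ^+ 2 / 2)).
  by rewrite lt_min !divr_gt0 ?mulr_gt0 ?exprn_gt0.
move=> w; rewrite lt_min => /andP[h1 h2].
have hw : nrm z / 2 < nrm w.
  have : nrm z <= nrm w + nrm (w - z).
    have {1}-> : z = w - (w - z) by ring.
    exact: nrm_sub.
  by lra.
have w0 : w != 0 by apply: nrm_gt0_neq; lra.
have -> : w^-1 - z^-1 = - (w - z) / (w * z) by field; rewrite z0.
rewrite nrmM nrmN nrmV nrmM ltr_pdivrMr ?mulr_gt0 ?nrm_gt0//.
apply: lt_le_trans h2 _; rewrite expr2 -[e * _ / _]mulrA ler_pM2l//.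
have -> : nrm z * nrm z / 2 = (nrm z / 2) * nrm z by ring.
by rewrite ler_pM2r// ltW.
Qed.

Lemma cont_comp f g z : cont g z -> cont f (g z) -> cont (fun w => f (g w)) z.
Proof.
move=> G F e e0; have [d d0 D] := F e e0; have [d' d0' D'] := G d d0.
by exists d' => // w /D'/D.
Qed.

Lemma contV f z : f z != 0 -> cont f z -> cont (fun w => (f w)^-1) z.
Proof. by move=> f0 F; apply: (cont_comp F); exact: cont_inv. Qed.

Lemma cont_cst a z : cont (fun=> a) z.
Proof. by move=> e e0; exists 1 => // w _; rewrite subrr nrm0. Qed.

Lemma cont_id z : cont id z.
Proof. by move=> e e0; exists e. Qed.

Lemma contN f z : cont f z -> cont (fun w => - f w) z.
Proof. by move=> F e e0; have [d d0 D] := F e e0; exists d => // w /D; rewrite -opprD nrmN. Qed.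

Lemma contB f g z : cont f z -> cont g z -> cont (fun w => f w - g w) z.
Proof. by move=> F G; apply: contD => //; exact: contN. Qed.

(** Caratheodory's criterion: with a slope [phi] continuous at [z], the product and chain rules
    become identities between slopes. *)
Lemma diff_caratheodory f z a : diff f z a <->
  exists phi, [/\ forall w, f w - f z = phi w * (w - z), cont phi z & phi z = a].
Proof.
split=> [D|[phi [E C <-]] e e0]; last first.
  have [d d0 H] := C e e0; exists d => // w /H wd.
  by rewrite E -mulrBl nrmM ler_wpM2r ?nrm_ge0// ltW.
exists (fun w => if w == z then a else (f w - f z) / (w - z)); split.
- move=> w; case: eqVneq => [->|wz]; first by rewrite !subrr mulr0.
  by rewrite divfK// subr_eq0.
- move=> e e0; have e20 : 0 < e / 2 by rewrite divr_gt0.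
  have [d d0 H] := D _ e20; exists d => // w wd; rewrite eqxx.
  have [_|wz] := eqVneq w z; first by rewrite subrr nrm0.
  have wz0 : w - z != 0 by rewrite subr_eq0.
  have -> : (f w - f z) / (w - z) - a = (f w - f z - a * (w - z)) / (w - z) by field.
  rewrite nrmM nrmV ltr_pdivrMr ?nrm_gt0//.
  apply: le_lt_trans (H w wd) _; rewrite ltr_pM2r ?nrm_gt0//; lra.
- by rewrite eqxx.
Qed.

Lemma diff_cst a z : diff (fun=> a) z 0.
Proof. by move=> e e0; exists 1 => // w _; rewrite subrr mul0r subrr nrm0 mulr_ge0 ?nrm_ge0// ltW. Qed.

Lemma diff_id z : diff id z 1.
Proof. by move=> e e0; exists 1 => // w _; rewrite mul1r subrr nrm0 mulr_ge0 ?nrm_ge0// ltW. Qed.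

Lemma diffD f g z a b : diff f z a -> diff g z b -> diff (fun w => f w + g w) z (a + b).
Proof.
move=> /diff_caratheodory[p [E C <-]] /diff_caratheodory[q [E' C' <-]].
apply/diff_caratheodory; exists (fun w => p w + q w); split => //; last exact: contD.
by move=> w; rewrite mulrDl -E -E'; ring.
Qed.

Lemma diffM f g z a b : diff f z a -> diff g z b ->
  diff (fun w => f w * g w) z (a * g z + f z * b).
Proof.
move=> Df; have Cf := diff_cont Df.
move: Df => /diff_caratheodory[p [E C <-]] /diff_caratheodory[q [E' C' <-]].
apply/diff_caratheodory; exists (fun w => p w * g z + f w * q w); split => //.
  move=> w; have -> : (p w * g z + f w * q w) * (w - z) =
    (p w * (w - z)) * g z + f w * (q w * (w - z)) by ring.
  by rewrite -E -E'; ring.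
by apply: contD; apply: contM => //; exact: cont_cst.
Qed.

Lemma diffN f z a : diff f z a -> diff (fun w => - f w) z (- a).
Proof.
move=> /diff_caratheodory[p [E C <-]]; apply/diff_caratheodory.
exists (fun w => - p w); split => //; last exact: contN.
by move=> w; rewrite mulNr -E; ring.
Qed.

Lemma diffB f g z a b : diff f z a -> diff g z b -> diff (fun w => f w - g w) z (a - b).
Proof. by move=> F G; apply: diffD => //; exact: diffN. Qed.

Lemma diffV f z a : f z != 0 -> diff f z a ->
  diff (fun w => (f w)^-1) z (- a / f z ^+ 2).
Proof.
move=> f0 D e e0; have Cf := diff_cont D.
move: D => /diff_caratheodory[p [E C pa]].
have Cp : cont (fun w => - p w * ((f w)^-1 * (f z)^-1)) z.
  apply: contM; first exact: contN.
  by apply: contM; [exact: contV|exact: cont_cst].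
have [d d0 H] := Cp e e0.
have [d' d'0 H'] := Cf _ (nrm_gt0 f0).
exists (Num.min d d'); first by rewrite lt_min d0.
move=> w; rewrite lt_min => /andP[/H wd /H' wd'].
have fw0 : f w != 0.
  apply: contraTneq wd' => ->; by rewrite sub0r nrmN ltxx.
have -> : (f w)^-1 - (f z)^-1 - - a / f z ^+ 2 * (w - z) =
   (- p w * ((f w)^-1 / f z) - - p z * ((f z)^-1 / f z)) * (w - z).
  have := E w; rewrite pa => Ew.
  have -> : (f w)^-1 - (f z)^-1 = - (f w - f z) * ((f w)^-1 / f z) by field; rewrite f0.
  by rewrite Ew; field; rewrite f0.
by rewrite nrmM ler_wpM2r ?nrm_ge0// ltW.
Qed.

Lemma diff_comp f g z a b : diff g z b -> diff f (g z) a ->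
  diff (fun w => f (g w)) z (a * b).
Proof.
move=> Dg; have Cg := diff_cont Dg.
move: Dg => /diff_caratheodory[q [E' C' <-]] /diff_caratheodory[p [E C <-]].
apply/diff_caratheodory; exists (fun w => p (g w) * q w); split => //.
  by move=> w; rewrite E E' mulrA.
by apply: contM => //; exact: (@cont_comp p g).
Qed.

Lemma diffX f z a n : diff f z a -> exists b, diff (fun w => f w ^+ n) z b.
Proof.
move=> D; elim: n => [|n [b ih]].
  by exists 0; under [X in diff X]eq_fun do rewrite expr0; exact: diff_cst.
eexists; under [X in diff X]eq_fun do rewrite exprS; exact: diffM D ih.
Qed.

Lemma diff_ext f g z a : (exists2 d : R, 0 < d & forall w, nrm (w - z) < d -> f w = g w) ->
  diff f z a -> diff g z a.
Proof.
move=> [d d0 E] D e e0; have [d' d'0 D'] := D e e0.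
exists (Num.min d d'); first by rewrite lt_min d0.
move=> w; rewrite lt_min => /andP[wd wd'].
by rewrite -(E w wd) -(E z) ?subrr ?nrm0//; exact: D'.
Qed.

Definition rdiff (u : R -> R) (t l : R) :=
  forall e : R, 0 < e -> exists2 d : R, 0 < d &
    forall s, `|s - t| < d -> `|u s - u t - l * (s - t)| <= e * `|s - t|.

Lemma rdiffP u t l : rdiff u t l <-> is_derive t 1 u l.
Proof.
split=> [D|[D <-]].
- have H : h^-1 *: (u (h *: (1:R) + t) - u t) @[h --> (0:R)^'] --> l.
    apply/cvgrPdist_le => e e0; have [d d0 H] := D e e0.
    rewrite /dnbhs /within /=; exists d => //= h.
    rewrite /ball /= sub0r normrN => hd h0.
    have := H (h + t); rewrite addrK => /(_ hd).
    rewrite -[h *: 1]/(h * 1) mulr1 -[h^-1 *: _]/(h^-1 * _) => {}H.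
    have h0' : 0 < `|h| by rewrite normr_gt0.
    rewrite -(ler_pM2r h0') -normrM -(normrN (_ * _)).
    suff -> : - ((l - h^-1 * (u (h + t) - u t)) * h) = u (h + t) - u t - l * h by [].
    by field.
  split; first by apply/cvg_ex; exists l.
  exact/cvg_lim.
- move=> e e0; have /cvgrPdist_le/(_ e e0) := D.
  rewrite /dnbhs /within /= => -[d /= d0 H].
  exists d => // s sd; have [->|st] := eqVneq s t.
    by rewrite !subrr mulr0 subrr normr0 mulr0.
  have st0 : s - t != 0 by rewrite subr_eq0.
  have := H (s - t); rewrite /ball /= sub0r normrN => /(_ sd st0).
  rewrite -[(s - t) *: 1]/((s - t) * 1) mulr1 subrK -[_^-1 *: _]/(_^-1 * _).
  move=> {}H; have h0' : 0 < `|s - t| by rewrite normr_gt0.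
  have E : 'D_1 u t = lim ((h^-1 *: (u (h *: (1:R) + t) - u t)) @[h --> (0:R)^']) by [].
  rewrite E; set L := lim _ in H *.
  have -> : u s - u t - L * (s - t) = - ((L - (s - t)^-1 * (u s - u t)) * (s - t)).
    by field.
  by rewrite normrN normrM ler_pM2r.
Qed.

Lemma rdiff_cont u t l : rdiff u t l -> {for t, continuous u}.
Proof.
move=> /rdiffP D; apply: differentiable_continuous.
by apply/derivable1_diffP; exact: ex_derive.
Qed.

Lemma rdiff_MVT u du (s t : R) : s <= t ->
  (forall x, s <= x <= t -> rdiff u x (du x)) ->
  exists2 x, s <= x <= t & u t - u s = du x * (t - s).
Proof.
move=> st D.
have [x|x|c cst E] := @MVT_segment R u du s t st.
- by rewrite in_itv /= => /andP[/ltW sx /ltW xt]; apply/rdiffP/D/andP.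
- by apply: continuous_in_subspaceT => y; rewrite inE /= in_itv /= => /D/rdiff_cont.
- by exists c => //; rewrite in_itv in cst.
Qed.

(** Restricting to a segment and taking a real part brings complex functions within reach of the
    real mean value theorem. *)
Lemma diff_line f x v (c : R[i]) (t : R) a : diff f (x + t%:C * v) a ->
  rdiff (fun s => Re (c * f (x + s%:C * v))) t (Re (c * (a * v))).
Proof.
move=> D e e0.
have p0 : 0 < 1 + nrm c * nrm v by rewrite ltr_pwDl ?mulr_ge0 ?nrm_ge0.
have q0 : 0 < 1 + nrm v by rewrite ltr_pwDl ?nrm_ge0.
have e0' : 0 < e / (1 + nrm c * nrm v) by rewrite divr_gt0.
have [d d0 H] := D _ e0'.
exists (d / (1 + nrm v)); first by rewrite divr_gt0.
move=> s; rewrite ltr_pdivlMr// => sd.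
have E1 : x + s%:C * v - (x + t%:C * v) = (s - t)%:C * v by rewrite rmorphB /=; ring.
have := H (x + s%:C * v); rewrite E1 nrmM nrm_real => {}H.
have nv := nrm_ge0 v; have ns := normr_ge0 (s - t).
have {}H : nrm (f (x + s%:C * v) - f (x + t%:C * v) - a * ((s - t)%:C * v)) <=
  e / (1 + nrm c * nrm v) * (`|s - t| * nrm v) by apply: H; nra.
have -> : Re (c * f (x + s%:C * v)) - Re (c * f (x + t%:C * v)) - Re (c * (a * v)) * (s - t) =
  Re (c * (f (x + s%:C * v) - f (x + t%:C * v) - a * ((s - t)%:C * v))).
  rewrite !(ReD, ReN, ReM, ImM, ImD, ImN) /=; ring.
apply: le_trans (Re_nrm _) _; rewrite nrmM.
apply: le_trans (ler_wpM2l (nrm_ge0 _) H) _.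
have -> : nrm c * (e / (1 + nrm c * nrm v) * (`|s - t| * nrm v)) =
  (e * `|s - t|) * (nrm c * nrm v / (1 + nrm c * nrm v)) by ring.
rewrite ler_piMr ?mulr_ge0//; first exact: ltW.
by rewrite ler_pdivrMr// mul1r; lra.
Qed.

End DiffCalculus.

(** * Second order expansions *)

Section SecondOrder.
Variable R : realType.
Implicit Types (z w a b c : R[i]) (f g F : R[i] -> R[i]) (u v r : R[i] -> R).

Lemma Re_conjc z : Re (conjc z) = Re z. Proof. by case: z. Qed.
Lemma Im_conjc z : Im (conjc z) = - Im z. Proof. by case: z. Qed.

Lemma nrm_conjc z : nrm (conjc z) = nrm z.
Proof. by case: z => x y; rewrite /nrm /= sqrrN. Qed.

Lemma Re_conjM z : Re (conjc z * z) = nrm z ^+ 2.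
Proof. by rewrite -sqnE /sqn ReM Re_conjc Im_conjc; ring. Qed.

(** Multiplying by the conjugate of [f y - f x] makes the squared modulus of this increment the
    increment of a real function on [[0, 1]]. *)
Lemma mean_value f g x y (M : R) :
  (forall t : R, 0 <= t <= 1 -> diff f (x + t%:C * (y - x)) (g (x + t%:C * (y - x)))) ->
  (forall t : R, 0 <= t <= 1 -> nrm (g (x + t%:C * (y - x))) <= M) ->
  nrm (f y - f x) <= M * nrm (y - x).
Proof.
move=> D B; set c := conjc (f y - f x).
have D' (t : R) (t01 : 0 <= t <= 1) := diff_line c (D t t01).
have [t t01] := rdiff_MVT ler01 D'.
rewrite rmorph0 rmorph1 mul0r addr0 mul1r subr0 mulr1.
have -> : x + (y - x) = y by ring.
have -> : Re (c * f y) - Re (c * f x) = nrm (f y - f x) ^+ 2.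
  by rewrite -Re_conjM mulrBr ReD ReN.
move=> E; have : nrm (f y - f x) ^+ 2 <= nrm (f y - f x) * (M * nrm (y - x)).
  rewrite E; apply: le_trans (ler_norm _) _; apply: le_trans (Re_nrm _) _.
  rewrite nrmM nrm_conjc nrmM ler_wpM2l ?nrm_ge0// ler_wpM2r ?nrm_ge0//; exact: B.
rewrite expr2; have := nrm_ge0 (f y - f x).
rewrite le_eqVlt => /predU1P[<- _|fp]; last by rewrite ler_pM2l.
by rewrite mulr_ge0 ?nrm_ge0// (le_trans _ (B 0 _)) ?nrm_ge0// lexx ler01.
Qed.

Definition taylor2 F z a b :=
  forall e : R, 0 < e -> exists2 d : R, 0 < d & forall w, nrm (w - z) < d ->
    nrm (F w - F z - a * (w - z) - b * (w - z) ^+ 2) <= e * nrm (w - z) ^+ 2.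

(** The remainder after the quadratic polynomial has derivative [g x - g z - b (x - z)], at most
    [e |x - z|] near [z]; the mean value inequality integrates this bound. *)
Lemma diff_taylor2 f g z b (d0 : R) : 0 < d0 ->
  (forall w, nrm (w - z) < d0 -> diff f w (g w)) -> diff g z b ->
  taylor2 f z (g z) (b / 2%:R).
Proof.
move=> d00 Df Dg e e0; have [d d1 H] := Dg e e0.
exists (Num.min d d0); first by rewrite lt_min d1.
move=> w; rewrite lt_min => /andP[wd wd0].
pose r := fun x => f x - (g z * (x - z) + b / 2%:R * (x - z) ^+ 2).
have inD (t : R) : 0 <= t <= 1 -> nrm (z + t%:C * (w - z) - z) <= nrm (w - z).
  move=> /andP[t0 t1]; rewrite addrC addKr nrmM nrm_real ger0_norm//.
  by rewrite ler_piMl ?nrm_ge0.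
have Dr x : nrm (x - z) < d0 -> diff r x (g x - (g z + b * (x - z))).
  move=> xd; apply: diffB; first exact: Df.
  have D1 : diff (fun x => x - z) x (1 - 0).
    by apply: diffB; [exact: diff_id|exact: diff_cst].
  have := diffD (diffM (diff_cst (g z) x) D1)
               (diffM (diff_cst (b / 2%:R) x) (diffM D1 D1)).
  rewrite !subr0 !mul0r !add0r !mulr1 mul1r.
  have -> : g z + b / 2 * (x - z + (x - z)) = g z + b * (x - z) by field.
  by [].
have := @mean_value r (fun x => g x - (g z + b * (x - z))) z w (e * nrm (w - z)).
rewrite /r subrr mulr0 expr0n /= mulr0 addr0 subr0.
have -> : f w - (g z * (w - z) + b / 2 * (w - z) ^+ 2) - f z =
  f w - f z - g z * (w - z) - b / 2 * (w - z) ^+ 2 by ring.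
move=> MV; rewrite [nrm _ ^+ 2]expr2 mulrA; apply: MV.
- by move=> t t01; apply: Dr; apply: le_lt_trans (inD t t01) wd0.
- move=> t t01; have := H (z + t%:C * (w - z)).
  have -> : g (z + t%:C * (w - z)) - (g z + b * (z + t%:C * (w - z) - z)) =
    g (z + t%:C * (w - z)) - g z - b * (z + t%:C * (w - z) - z) by ring.
  move=> {}H; apply: le_trans (H _) _; first exact: le_lt_trans (inD t t01) wd.
  by rewrite ler_pM2l//; exact: inD.
Qed.

Definition small2 r z :=
  forall e : R, 0 < e -> exists2 d : R, 0 < d &
    forall w, nrm (w - z) < d -> `|r w| <= e * nrm (w - z) ^+ 2.

Lemma small2D r v z : small2 r z -> small2 v z -> small2 (fun w => r w + v w) z.
Proof.
move=> F G e e0; have e20 : 0 < e / 2 by rewrite divr_gt0.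
have [d d0 D] := F _ e20; have [d' d0' D'] := G _ e20.
exists (Num.min d d'); first by rewrite lt_min d0.
move=> w; rewrite lt_min => /andP[/D wd /D' wd'].
by apply: le_trans (ler_normD _ _) _; lra.
Qed.

Lemma small2_le r v z (K : R) : small2 v z ->
  (exists2 d : R, 0 < d & forall w, nrm (w - z) < d -> `|r w| <= K * `|v w|) ->
  small2 r z.
Proof.
move=> V [d0 d00 H] e e0; have K0 : 0 < `|K| + 1 by rewrite ltr_wpDl.
have e0' : 0 < e / (`|K| + 1) by rewrite divr_gt0.
have [d d1 D] := V _ e0'.
exists (Num.min d0 d); first by rewrite lt_min d00.
move=> w; rewrite lt_min => /andP[/H wd /D wd'].
apply: le_trans wd _; apply: (@le_trans _ _ ((`|K| + 1) * `|v w|)).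
  rewrite ler_wpM2r//; have := ler_norm K; lra.
apply: le_trans (ler_wpM2l (ltW K0) wd') _.
by rewrite mulrA [X in X * _]mulrC divfK ?gt_eqF.
Qed.

Lemma small2Z r z (K : R) : small2 r z -> small2 (fun w => K * r w) z.
Proof. by move=> V; apply: (small2_le (K := `|K|) V); exists 1 => // w _; rewrite normrM. Qed.

Lemma small2_cube z : small2 (fun w => nrm (w - z) ^+ 3) z.
Proof.
move=> e e0; exists e => // w we; have h0 := nrm_ge0 (w - z).
rewrite ger0_norm ?exprn_ge0// exprS ler_wpM2r ?exprn_ge0//; exact: ltW.
Qed.

Lemma small2_nrm (F : R[i] -> R[i]) z : small2 (fun w => nrm (F w)) z ->
  forall a, small2 (fun w => Re (a * F w)) z.
Proof.
move=> H a; apply: (small2_le (K := nrm a) H); exists 1 => // w _.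
by rewrite (ger0_norm (nrm_ge0 (F w))) -nrmM Re_nrm.
Qed.

Lemma small2_ext r v z : (forall w, r w = v w) -> small2 r z -> small2 v z.
Proof. by move=> /funext ->. Qed.

(* [sec u z al l]: [u] has a second order expansion at [z] whose linear part is
   [Re (al h)] and whose Laplacian is [4 l]. *)
Definition sec u z (al : R[i]) (l : R) := exists b : R[i],
  small2 (fun w => u w - u z - Re (al * (w - z)) - Re (b * (w - z) ^+ 2)
                   - l * sqn (w - z)) z.

Lemma sec_cst (k : R) z : sec (fun=> k) z 0 0.
Proof.
exists 0 => e e0; exists 1 => // w _; rewrite !mul0r /= !subrr normr0.
by rewrite mulr_ge0 ?exprn_ge0 ?nrm_ge0 ?ltW.
Qed.

Lemma secD u v z al l be m : sec u z al l -> sec v z be m ->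
  sec (fun w => u w + v w) z (al + be) (l + m).
Proof.
move=> [b U] [c V]; exists (b + c).
apply: small2_ext (small2D U V) => w /=; rewrite !mulrDl !ReD; ring.
Qed.

Lemma secZ u z al l (k : R) : sec u z al l -> sec (fun w => k * u w) z (k%:C * al) (k * l).
Proof.
move=> [b U]; exists (k%:C * b).
apply: small2_ext (small2Z k U) => w /=.
rewrite -!mulrA !(ReM k%:C) /= !mul0r !subr0; ring.
Qed.

Lemma sec_sqn c z : sec (fun w => sqn (w - c)) z (2%:R * conjc (z - c)) 1.
Proof.
exists 0; apply: (@small2_ext (fun=> 0)); last first.
  move=> e e0; exists 1 => // w _.
  by rewrite normr0 mulr_ge0 ?exprn_ge0 ?nrm_ge0 ?ltW.
move=> w /=; rewrite mul0r /= /sqn.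
have -> : 2%:R = (2%:R : R)%:C by rewrite rmorph_nat.
rewrite !(ReM, ImM, Re_conjc, Im_conjc, ReD, ReN, ImD, ImN) /=; ring.
Qed.

Lemma sec_lip u z al l : sec u z al l -> exists2 K : R, 0 <= K &
  exists2 d : R, 0 < d & forall w, nrm (w - z) < d ->
    `|u w - u z| <= K * nrm (w - z) /\
    `|u w - u z - Re (al * (w - z))| <= K * nrm (w - z) ^+ 2.
Proof.
move=> [b U]; have [d d0 D] := U 1 ltr01.
have na := nrm_ge0 al; have nb := nrm_ge0 b; have nl := normr_ge0 l.
exists (1 + nrm al + nrm b + `|l|); first by lra.
exists (Num.min d 1); first by rewrite lt_min d0 ltr01.
move=> w; rewrite lt_min => /andP[/D + w1]; rewrite mul1r.
set h := w - z in w1 *; have h0 := nrm_ge0 h; rewrite sqnE => H.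
have H1 : `|Re (al * h)| <= nrm al * nrm h by rewrite -nrmM Re_nrm.
have H2 : `|Re (b * h ^+ 2)| <= nrm b * nrm h ^+ 2 by rewrite -nrmX -nrmM Re_nrm.
have H3 : `|l * nrm h ^+ 2| <= `|l| * nrm h ^+ 2.
  by rewrite normrM (ger0_norm (exprn_ge0 _ h0)).
have S : `|u w - u z - Re (al * h)| <= (1 + nrm b + `|l|) * nrm h ^+ 2.
  have -> : u w - u z - Re (al * h) = (u w - u z - Re (al * h) - Re (b * h ^+ 2)
      - l * nrm h ^+ 2) + Re (b * h ^+ 2) + l * nrm h ^+ 2 by ring.
  apply: le_trans (ler_normD _ _) _.
  apply: le_trans (lerD (ler_normD _ _) (lexx _)) _; lra.
have h2 : 0 <= nrm h ^+ 2 by exact: exprn_ge0.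
have h21 : nrm h ^+ 2 <= nrm h by rewrite expr2 ler_piMr// ltW.
split; last by apply: le_trans S _; rewrite ler_wpM2r//; lra.
have -> : u w - u z = (u w - u z - Re (al * h)) + Re (al * h) by ring.
apply: le_trans (ler_normD _ _) _.
have : (1 + nrm b + `|l|) * nrm h ^+ 2 <= (1 + nrm b + `|l|) * nrm h.
  by rewrite ler_wpM2l//; lra.
lra.
Qed.

Definition rtaylor2 (psi : R -> R) (x p q : R) :=
  forall e : R, 0 < e -> exists2 d : R, 0 < d & forall y, `|y - x| < d ->
    `|psi y - psi x - p * (y - x) - q * (y - x) ^+ 2| <= e * (y - x) ^+ 2.

(** The square of [Re (al h)] is [|al|^2 |h|^2 / 2] plus the harmonic term [Re (al^2 h^2) / 2]; this
    is the source of [q |al|^2 / 2]. *)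
Lemma sec_comp (psi : R -> R) u z al l p q : rtaylor2 psi (u z) p q -> sec u z al l ->
  sec (fun w => psi (u w)) z (p%:C * al) (p * l + q * nrm al ^+ 2 / 2).
Proof.
move=> P S; have [K K0 [d d0 L]] := sec_lip S; have [b U] := S.
exists (p%:C * b + (q / 2)%:C * al ^+ 2).
have nE w : Re (al * (w - z)) ^+ 2 =
   nrm al ^+ 2 / 2 * sqn (w - z) + 2^-1 * Re (al ^+ 2 * (w - z) ^+ 2).
  rewrite -sqnE -exprMn /sqn expr2 !(ReM, ImM).
  by set h := w - z; field.
have S1 : small2 (fun w => psi (u w) - psi (u z) - p * (u w - u z)
     - q * (u w - u z) ^+ 2) z.
  move=> e e0; have K10 : 0 < K + 1 by lra.
  have e0' : 0 < e / (K + 1) ^+ 2 by rewrite divr_gt0 ?exprn_gt0.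
  have [d1 d10 H] := P _ e0'.
  exists (Num.min d (d1 / (K + 1))); first by rewrite lt_min d0 divr_gt0.
  move=> w; rewrite lt_min ltr_pdivlMr// => /andP[/L[wd _] wd'].
  have h0 := nrm_ge0 (w - z).
  have wd1 : `|u w - u z| <= nrm (w - z) * (K + 1) by lra.
  have := H (u w) (le_lt_trans wd1 wd'); move=> {}H; apply: le_trans H _.
  rewrite -mulrA ler_pM2l// ler_pdivrMl ?exprn_gt0//.
  rewrite -(real_normK (num_real (u w - u z))) -exprMn [X in _ <= X ^+ 2]mulrC.
  by rewrite ler_pXn2r ?nnegrE// mulr_ge0// ltW.
have S2 : small2 (fun w => (u w - u z) ^+ 2 - Re (al * (w - z)) ^+ 2) z.
  apply: (small2_le (K := K * (K + nrm al)) (small2_cube z)); exists d => // w /L[A B].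
  have h0 := nrm_ge0 (w - z).
  rewrite (ger0_norm (exprn_ge0 _ h0)) subr_sqr normrM.
  have C : `|u w - u z + Re (al * (w - z))| <= (K + nrm al) * nrm (w - z).
    apply: le_trans (ler_normD _ _) _; have := Re_nrm (al * (w - z)).
    by rewrite nrmM; lra.
  have -> : K * (K + nrm al) * nrm (w - z) ^+ 3 =
     (K * nrm (w - z) ^+ 2) * ((K + nrm al) * nrm (w - z)) by ring.
  exact: ler_pM.
apply: small2_ext (small2D S1 (small2D (small2Z p U) (small2Z q S2))) => w /=.
rewrite nE; set h := w - z.
by rewrite mulrDl ReD -!mulrA !(ReM _%:C) /= !mul0r !subr0; field.
Qed.

Lemma taylor2_lip F z a b : taylor2 F z a b -> exists2 K : R, 0 <= K &
  exists2 d : R, 0 < d & forall w, nrm (w - z) < d ->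
    nrm (F w - F z) <= K * nrm (w - z) /\
    nrm (F w - F z - a * (w - z)) <= K * nrm (w - z) ^+ 2.
Proof.
move=> U; have [d d0 D] := U 1 ltr01.
have na := nrm_ge0 a; have nb := nrm_ge0 b.
exists (1 + nrm a + nrm b); first by lra.
exists (Num.min d 1); first by rewrite lt_min d0 ltr01.
move=> w; rewrite lt_min => /andP[/D + w1]; rewrite mul1r.
set h := w - z in w1 *; have h0 := nrm_ge0 h => H.
have S : nrm (F w - F z - a * h) <= (1 + nrm b) * nrm h ^+ 2.
  have -> : F w - F z - a * h = (F w - F z - a * h - b * h ^+ 2) + b * h ^+ 2 by ring.
  apply: le_trans (nrmD _ _) _; rewrite nrmM nrmX; lra.
have h2 : 0 <= nrm h ^+ 2 by exact: exprn_ge0.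
have h21 : nrm h ^+ 2 <= nrm h by rewrite expr2 ler_piMr// ltW.
split; last by apply: le_trans S _; rewrite ler_wpM2r//; lra.
have -> : F w - F z = (F w - F z - a * h) + a * h by ring.
apply: le_trans (nrmD _ _) _; rewrite nrmM.
have : (1 + nrm b) * nrm h ^+ 2 <= (1 + nrm b) * nrm h by rewrite ler_wpM2l//; lra.
lra.
Qed.

(** Holomorphic substitution multiplies the Laplacian by [|a|^2]: the second order term of [F]
    enters only through the real part of a multiple of [(w - z) ^+ 2], which is harmonic. *)
Lemma sec_holo F u z a b al l : taylor2 F z a b -> sec u (F z) al l ->
  sec (fun w => u (F w)) z (al * a) (l * nrm a ^+ 2).
Proof.
move=> T [be U]; have [K K0 [d d0 L]] := taylor2_lip T.
exists (al * b + be * a ^+ 2).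
have S1 : small2 (fun w => u (F w) - u (F z) - Re (al * (F w - F z))
     - Re (be * (F w - F z) ^+ 2) - l * sqn (F w - F z)) z.
  move=> e e0; have K10 : 0 < K + 1 by lra.
  have e0' : 0 < e / (K + 1) ^+ 2 by rewrite divr_gt0 ?exprn_gt0.
  have [d1 d10 H] := U _ e0'.
  exists (Num.min d (d1 / (K + 1))); first by rewrite lt_min d0 divr_gt0.
  move=> w; rewrite lt_min ltr_pdivlMr// => /andP[/L[wd _] wd'].
  have h0 := nrm_ge0 (w - z).
  have wd1 : nrm (F w - F z) <= nrm (w - z) * (K + 1) by lra.
  have := H (F w) (le_lt_trans wd1 wd'); move=> {}H; apply: le_trans H _.
  rewrite -mulrA ler_pM2l// ler_pdivrMl ?exprn_gt0//.
  rewrite -exprMn [X in _ <= X ^+ 2]mulrC.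
  by rewrite ler_pXn2r ?nnegrE ?nrm_ge0// mulr_ge0// ltW.
have S2 : small2 (fun w => nrm (F w - F z - a * (w - z) - b * (w - z) ^+ 2)) z.
  move=> e e0; have [d1 d10 H] := T e e0; exists d1 => // w /H.
  by rewrite (ger0_norm (nrm_ge0 _)).
have S3 : small2 (fun w => nrm ((F w - F z) ^+ 2 - (a * (w - z)) ^+ 2)) z.
  apply: (small2_le (K := K * (K + nrm a)) (small2_cube z)); exists d => // w /L[A B].
  have h0 := nrm_ge0 (w - z).
  rewrite (ger0_norm (exprn_ge0 _ h0)) subr_sqr nrmM ger0_norm ?mulr_ge0 ?nrm_ge0//.
  have C : nrm (F w - F z + a * (w - z)) <= (K + nrm a) * nrm (w - z).
    by apply: le_trans (nrmD _ _) _; rewrite nrmM; lra.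
  have -> : K * (K + nrm a) * nrm (w - z) ^+ 3 =
     (K * nrm (w - z) ^+ 2) * ((K + nrm a) * nrm (w - z)) by ring.
  by apply: ler_pM; rewrite ?nrm_ge0.
have S4 : small2 (fun w => sqn (F w - F z) - sqn (a * (w - z))) z.
  apply: (small2_le (K := K * (K + nrm a)) (small2_cube z)); exists d => // w /L[A B].
  have h0 := nrm_ge0 (w - z).
  rewrite (ger0_norm (exprn_ge0 _ h0)) !sqnE subr_sqr normrM.
  have C : `|nrm (F w - F z) + nrm (a * (w - z))| <= (K + nrm a) * nrm (w - z).
    by rewrite ger0_norm ?addr_ge0 ?nrm_ge0// nrmM; lra.
  have B' : `|nrm (F w - F z) - nrm (a * (w - z))| <= K * nrm (w - z) ^+ 2.
    apply: le_trans B; rewrite ler_norml; apply/andP; split; last exact: nrm_lbB.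
    by rewrite lerNl opprB (nrm_distC (F w - F z)) nrm_lbB.
  have -> : K * (K + nrm a) * nrm (w - z) ^+ 3 =
     (K * nrm (w - z) ^+ 2) * ((K + nrm a) * nrm (w - z)) by ring.
  exact: ler_pM.
have S := small2D S1 (small2D (small2_nrm S2 al)
    (small2D (small2_nrm S3 be) (small2Z l S4))).
apply: small2_ext S => w /=.
rewrite [sqn (a * _)]sqnE nrmM exprMn [sqn (w - z)]sqnE.
set h := w - z; set k := F w - F z.
rewrite exprMn !mulrBr !mulrDl !(ReD, ReN) !mulrA; ring.
Qed.

(** Adding the four inequalities at [t], [- t], [i t] and [- i t] cancels the linear terms in pairs
    and the [b] terms because [i^2 = -1]; only [l] is left. *)
Lemma sec_local_min u z al l (d0 : R) : 0 < d0 -> sec u z al l ->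
  (forall w, nrm (w - z) < d0 -> u z <= u w) -> 0 <= l.
Proof.
move=> d00 [b U] M; rewrite leNgt; apply/negP => l0.
have e0 : 0 < - l / 2 by rewrite divr_gt0// oppr_gt0.
have [d d1 D] := U _ e0.
have [t [t0 td td0]] : exists t : R, [/\ 0 < t, t < d & t < d0].
  exists (Num.min d d0 / 2); rewrite divr_gt0 ?lt_min ?d1//=.
  have : 0 < Num.min d d0 by rewrite lt_min d1.
  have : Num.min d d0 <= d by rewrite ge_min lexx.
  have : Num.min d d0 <= d0 by rewrite ge_min lexx orbT.
  by move=> ? ? ?; split=> //; lra.
have E h : nrm h = t -> 0 <= Re (al * h) + Re (b * h ^+ 2) + l / 2 * t ^+ 2.
  move=> ht; have := D (z + h); have := M (z + h); rewrite addrC addKr addrC ht.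
  move=> /(_ td0) + /(_ td); rewrite sqnE ht ler_norml => H /andP[_]; lra.
have n1 : nrm t%:C = t by rewrite nrm_real gtr0_norm.
have n2 : nrm (t%:C * 'i) = t by rewrite nrmM nrm_i n1 mulr1.
have := E _ n1; have := E (- t%:C); rewrite nrmN => /(_ n1).
have := E _ n2; have := E (- (t%:C * 'i)); rewrite nrmN => /(_ n2).
have i2 : ('i : R[i]) ^+ 2 = -1 by rewrite sqr_i.
rewrite !sqrrN exprMn i2 !mulrN mulr1 !ReN.
have : l * t ^+ 2 < 0 by rewrite nmulr_rlt0// exprn_gt0.
by lra.
Qed.

End SecondOrder.

(** * Topology of the plane *)

Section Topology.
Variable R : realType.
Implicit Types (z w a b c : R[i]) (A K V : set (Cplx R)) (u v : R[i] -> R).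

Definition opn A := forall z, A z -> exists2 d : R, 0 < d &
  forall w : R[i], nrm (w - z) < d -> A w.
Definition adh A (z : R[i]) := forall e : R, 0 < e -> exists2 w, A w & nrm (w - z) < e.
Definition bdd A := exists M : R, forall z, A z -> nrm z <= M.
Definition cpt A := (forall z, adh A z -> A z) /\ bdd A.

Lemma adhP A z : adh A z <-> closure A z.
Proof.
split=> [H B /nbhs_nrmP[r r0 Br]|H e e0].
  by have [w Aw wz] := H r r0; exists w; split => //; exact: Br.
have /H[w [Aw we]] : nbhs (z : Cplx R) [set w : Cplx R | nrm (w - z) < e].
  by apply/nbhs_nrmP; exists e.
by exists w.
Qed.

Lemma adh_sub A z : A z -> adh A z.
Proof. by move=> Az e e0; exists z => //; rewrite subrr nrm0. Qed.

Lemma adh_idem A z : adh (adh A) z -> adh A z.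
Proof.
move=> H e e0; have e20 : 0 < e / 2 by rewrite divr_gt0.
have [w Aw wz] := H _ e20; have [y Ay yw] := Aw _ e20; exists y => //.
by apply: le_lt_trans (nrm_tri w _ _) _; lra.
Qed.

Lemma adh_bdd A (M : R) : (forall z, A z -> nrm z <= M) -> forall z, adh A z -> nrm z <= M.
Proof.
move=> H z Az; rewrite leNgt; apply/negP => zM.
have [w Aw wz] := Az (nrm z - M) ltac:(lra).
have := H w Aw; have := nrm_lbB z w; rewrite nrm_distC; lra.
Qed.

Lemma adh_cpt A : bdd A -> cpt (adh A).
Proof.
move=> [M H]; split; first exact: adh_idem.
by exists M; exact: adh_bdd.
Qed.

Lemma cpt_compact A : cpt A -> compact A.
Proof.
move=> [cA [M AM]].
pose box : set (R * R) := `[- M, M]%classic `*` `[- M, M]%classic.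
have cbox : compact box by apply: compact_setX; exact: segment_compact.
pose g : R * R -> Cplx R := fun p => p.1 +i* p.2.
have cg : continuous g.
  move=> [x y] B /nbhs_nrmP[r r0 Br].
  have r20 : 0 < r / 2 by rewrite divr_gt0.
  exists (ball x (r / 2), ball y (r / 2)) => /=.
    by split; exact: nbhsx_ballx.
  move=> [x' y'] /= [bx by']; apply: Br; apply: le_lt_trans (nrm_ReIm _) _.
  rewrite /g /=; move: bx by'; rewrite /ball /= distrC [`|y - _|]distrC; lra.
apply: (@subclosed_compact _ A (g @` box)).
- by move=> z /adhP/cA.
- by apply: continuous_compact => //; exact: continuous_subspaceT.
- move=> z Az; exists (Re z, Im z); last by case: z {Az}.
  have := AM z Az; have := Re_nrm z; have := Im_nrm z.
  rewrite /box /= !in_itv /= !ler_norml => /andP[? ?] /andP[? ?] ?.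
  by split; apply/andP; split; lra.
Qed.

(** Takes the place of finite subcovers: with [P n] a condition on a radius [1 / (n + 1)] or on the
    first [n] times, local choices become uniform. *)
Lemma cpt_unif A (P : nat -> R[i] -> Prop) : cpt A ->
  (forall z, A z -> exists n, exists2 d : R, 0 < d &
     forall w, A w -> nrm (w - z) < d -> P n w) ->
  (forall m n w, (m <= n)%N -> P m w -> P n w) ->
  exists n, forall w, A w -> P n w.
Proof.
move=> /cpt_compact/compact_near_coveringP cA H mono.
have [|n _ Hn] := cA nat \oo (fun n w => A w -> P n w) _.
  move=> z /H[n [d d0 D]].
  exists ([set w : Cplx R | nrm (w - z) < d], [set m | (n <= m)%N]) => /=.
    by split; [apply/nbhs_nrmP; exists d|exists n].
  by move=> [w m] /= [wd nm] Aw; apply: mono nm _; exact: D.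
by exists n => w Aw; exact: (Hn n (leqnn n) w Aw Aw).
Qed.

Definition rcont A u z := forall e : R, 0 < e -> exists2 d : R, 0 < d &
  forall w, A w -> nrm (w - z) < d -> `|u w - u z| < e.

Lemma cpt_min A u : cpt A -> (exists z, A z) -> (forall z, A z -> rcont A u z) ->
  exists2 z, A z & forall w, A w -> u z <= u w.
Proof.
move=> cA A0 uC; have [|c] := @compact_EVT_min (Cplx R) R u A A0 (cpt_compact cA).
  apply/subspace_continuousP => z Az; apply/cvgrPdist_lt => e e0.
  have [d d0 D] := uC z Az e e0.
  apply/nbhs_nrmP; exists d => // w wd Aw; rewrite distrC; exact: D.
by rewrite inE => Ac H; exists c => // w Aw; apply: H; rewrite inE.
Qed.

Definition disk z (r : R) : set (Cplx R) := [set w : Cplx R | nrm (w - z) < r].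

Lemma disk_connected z r : connected (disk z r).
Proof.
pose seg (w : R[i]) : set (Cplx R) :=
  (fun t : R => (z + t%:C * (w - z)) : Cplx R) @` `[0, 1]%classic.
have segc w : connected (seg w).
  apply: connected_continuous_connected.
    by apply/connected_intervalP; exact: interval_is_interval.
  apply: continuous_subspaceT => t B /nbhs_nrmP[d d0 D].
  have p0 : 0 < 1 + nrm (w - z) by rewrite ltr_pwDl ?nrm_ge0.
  exists (d / (1 + nrm (w - z))); first by rewrite /= divr_gt0.
  move=> s; rewrite /ball /= ltr_pdivlMr// => sd; apply: D.
  have -> : z + s%:C * (w - z) - (z + t%:C * (w - z)) = - ((t - s)%:C * (w - z)).
    by rewrite rmorphB /=; ring.
  rewrite nrmN nrmM nrm_real; have := nrm_ge0 (w - z); have := normr_ge0 (t - s); nra.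
have -> : disk z r = \bigcup_(w in disk z r) seg w.
  apply/seteqP; split=> [w wr|x [w wr [t]]].
    exists w => //; exists 1; first by rewrite /= in_itv /= ler01 lexx.
    by rewrite rmorph1; ring.
  rewrite /= in_itv /= => /andP[t0 t1] <-.
  rewrite /disk /= addrC addKr nrmM nrm_real ger0_norm//.
  by apply: le_lt_trans wr; rewrite ler_piMl ?nrm_ge0.
apply: bigcup_connected => //.
exists z => w wr; exists 0; first by rewrite /= in_itv /= ler01 lexx.
by rewrite rmorph0; ring.
Qed.

Lemma connected_const A (P : R[i] -> Prop) : connected A ->
  (forall z, A z -> exists2 d : R, 0 < d &
     forall w, A w -> nrm (w - z) < d -> (P w <-> P z)) ->
  forall z w, A z -> A w -> P z -> P w.
Proof.
move=> cA L z w Az Aw Pz; apply: contrapT => nPw.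

have sep (Q : R[i] -> Prop) :
   (forall z, A z -> exists2 d : R, 0 < d &
     forall w, A w -> nrm (w - z) < d -> (Q w <-> Q z)) ->
   closure (A `&` [set x : Cplx R | Q x]) `&` (A `&` [set x : Cplx R | ~ Q x]) = set0.
  move=> LQ; apply/seteqP; split=> // x [/adhP Bx [Ax nQx]].
  have [d d0 D] := LQ x Ax; have [y [Ay Qy] yx] := Bx d d0.
  by apply: nQx; apply/(D y).
suff /connectedPn : exists E : bool -> set (Cplx R),
   [/\ forall b : bool, E b !=set0, A = E false `|` E true
     & separated (E false) (E true)] by apply.
exists (fun b : bool => A `&` [set x : Cplx R | if b then ~ P x else P x]); split.
- by case; [exists w|exists z].
- apply/seteqP; split=> [x Ax|x [[]|[]]//].
  by have [Px|nPx] := pselect (P x); [left|right].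
- split; first exact: sep.
  rewrite setIC.
  have -> : A `&` [set x : Cplx R | P x] = A `&` [set x : Cplx R | ~ ~ P x].
    by apply/seteqP; split=> x [Ax Hx]; split => //; apply: contrapT.
  apply: (sep (fun x => ~ P x)) => x Ax; have [d d0 D] := L x Ax.
  by exists d => // y Ay yd; split => H1 H2; apply: H1; apply/(D y).
Qed.

Lemma component_opn A z : opn A -> opn (connected_component A z).
Proof.
move=> oA w Cw; have Aw := connected_component_sub Cw.
have [d d0 D] := oA w Aw; exists d => // x xd.
apply: (connected_component_trans Cw).
apply: (@connected_component_max _ A (disk w d)) => //.
- by rewrite /disk /= subrr nrm0.
- exact: disk_connected.
Qed.

Lemma component_adh A z w : opn A -> adh (connected_component A z) w -> A w ->
  connected_component A z w.
Proof.
move=> oA Cw Aw; have [d d0 D] := oA w Aw; have [x Cx xw] := Cw d d0.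
apply: (connected_component_trans Cx).
apply: (@connected_component_max _ A (disk w d)) => //.
- exact: disk_connected.
- by rewrite /disk /= subrr nrm0.
Qed.

End Topology.

(** * Maximum principles *)

Section MaxPrinciple.
Variable R : realType.
Implicit Types (z w a b c : R[i]) (A K V : set (Cplx R)) (u v : R[i] -> R)
  (F : R[i] -> R[i]).

Lemma rcontP A u z : rcont A u z <->
  (u x @[x --> within A (nbhs (z : Cplx R))] --> u z).
Proof.
split=> [uC|uC e e0].
  apply/cvgrPdist_lt => e e0; have [d d0 D] := uC e e0.
  apply/nbhs_nrmP; exists d => // w wd Aw; rewrite distrC; exact: D.
have /cvgrPdist_lt/(_ e e0) := uC; rewrite near_withinE => /nbhs_nrmP[d d0 D].
by exists d => // w Aw wd; rewrite distrC; exact: D.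
Qed.

Lemma rcontD A u v z : rcont A u z -> rcont A v z -> rcont A (fun w => u w + v w) z.
Proof. by move=> /rcontP U /rcontP V; apply/rcontP; exact: cvgD. Qed.

Lemma rcontM A u v z : rcont A u z -> rcont A v z -> rcont A (fun w => u w * v w) z.
Proof. by move=> /rcontP U /rcontP V; apply/rcontP; exact: cvgM. Qed.

Lemma rcontV A u z : u z != 0 -> rcont A u z -> rcont A (fun w => (u w)^-1) z.
Proof. by move=> u0 /rcontP U; apply/rcontP; exact: cvgV. Qed.

Lemma rcont_cst A (k : R) z : rcont A (fun=> k) z.
Proof. by apply/rcontP; exact: cvg_cst. Qed.

Lemma rcontX A u z n : rcont A u z -> rcont A (fun w => u w ^+ n) z.
Proof.
move=> U; elim: n => [|n ih].
  by under [X in rcont _ X]eq_fun do rewrite expr0; exact: rcont_cst.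
by under [X in rcont _ X]eq_fun do rewrite exprS; exact: rcontM.
Qed.

Lemma rcont_ln A u z : 0 < u z -> rcont A u z -> rcont A (fun w => ln (u w)) z.
Proof.
move=> u0 /rcontP U; apply/rcontP.
by apply: continuous_cvg U; exact: continuous_ln.
Qed.

Lemma rcont_nrm A F z : cont F z -> rcont A (fun w => nrm (F w)) z.
Proof.
move=> C e e0; have [d d0 D] := C e e0; exists d => // w _ /D wd.
apply: le_lt_trans wd; rewrite ler_norml; apply/andP; split; last exact: nrm_lbB.
by rewrite lerNl opprB nrm_distC nrm_lbB.
Qed.

Lemma rcont_sqn A F z : cont F z -> rcont A (fun w => sqn (F w)) z.
Proof.
move=> C; under [X in rcont _ X]eq_fun do rewrite sqnE expr2.
by apply: rcontM; exact: rcont_nrm.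
Qed.

Lemma rcont_sum A (I : Type) (s : seq I) (P : pred I) (u : I -> R[i] -> R) z :
  (forall i, P i -> rcont A (u i) z) -> rcont A (fun w => \sum_(i <- s | P i) u i w) z.
Proof.
move=> H; elim: s => [|i s ih].
  by under [X in rcont _ X]eq_fun do rewrite big_nil; exact: rcont_cst.
under [X in rcont _ X]eq_fun do rewrite big_cons.
by case: ifPn => // Pi; apply: rcontD => //; exact: H.
Qed.

Lemma rdiffD (u v : R -> R) t l m : rdiff u t l -> rdiff v t m ->
  rdiff (fun s => u s + v s) t (l + m).
Proof. by move=> /rdiffP U /rdiffP V; apply/rdiffP; exact: is_deriveD. Qed.

Lemma rtaylor2_ln (x : R) : 0 < x -> rtaylor2 (@ln R) x x^-1 (- (2 * x ^+ 2)^-1).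
Proof.
move=> x0; pose r := fun y : R => ln y + (- (y - x) / x + (y - x) ^+ 2 / (2 * x ^+ 2)).
have Dr y : 0 < y -> rdiff r y ((y - x) ^+ 2 / (x ^+ 2 * y)).
  move=> y0; have -> : (y - x) ^+ 2 / (x ^+ 2 * y) = y^-1 + (- x^-1 + (y - x) / x ^+ 2).
    by field; rewrite !gt_eqF.
  apply: rdiffD; first exact/rdiffP/is_derive1_ln.
  move=> e e0; have p0 : 0 < e * (2 * x ^+ 2) by rewrite !mulr_gt0.
  exists (e * (2 * x ^+ 2)) => // s sd.
  have -> : - (s - x) / x + (s - x) ^+ 2 / (2 * x ^+ 2) -
   (- (y - x) / x + (y - x) ^+ 2 / (2 * x ^+ 2)) - (- x^-1 + (y - x) / x ^+ 2) * (s - y) =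
    (s - y) ^+ 2 / (2 * x ^+ 2) by field; rewrite gt_eqF.
  have q0 : 0 < 2 * x ^+ 2 by rewrite !mulr_gt0.
  rewrite normrM normfV (gtr0_norm q0) ler_pdivrMr// normrX expr2 mulrAC.
  by rewrite ler_wpM2r// ltW.
(* Between [x] and [y] every [s] is at least [x / 2], so the derivative [(s - x)^2 / (x^2 s)] of the
   remainder is at most [2 |y - x|^2 / x^3]. *)
have bnd y : `|y - x| <= x / 2 -> `|r y - r x| <= 2 / x ^+ 3 * `|y - x| ^+ 3.
  move=> yx; have key s : `|s - x| <= `|y - x| ->
     `|(s - x) ^+ 2 / (x ^+ 2 * s)| <= 2 / x ^+ 3 * `|y - x| ^+ 2.
    move=> sy; have s2 : x / 2 <= s.
      by move: (le_trans sy yx); rewrite ler_norml => /andP[]; lra.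
    have s0 : 0 < s by lra.
    rewrite normrM normfV (gtr0_norm (_ : 0 < x ^+ 2 * s)) ?mulr_gt0//.
    rewrite ler_pdivrMr ?mulr_gt0// normrX.
    have -> : 2 / x ^+ 3 * `|y - x| ^+ 2 * (x ^+ 2 * s) = `|y - x| ^+ 2 * (2 * s / x).
      by field; rewrite gt_eqF.
    apply: (@le_trans _ _ (`|y - x| ^+ 2)); first by rewrite ler_pXn2r ?nnegrE.
    rewrite ler_peMr ?exprn_ge0// ler_pdivlMr//; lra.
  have b0 : 0 <= 2 / x ^+ 3 * `|y - x| ^+ 2 by rewrite mulr_ge0 ?divr_ge0 ?exprn_ge0// ltW.
  have y0 : 0 < y by move: yx; rewrite ler_norml => /andP[]; lra.
  have [xy|yx'] := leP x y.
    have [s /andP[? _]|s /andP[s1 s2] ->] :=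
      @rdiff_MVT _ r (fun s => (s - x) ^+ 2 / (x ^+ 2 * s)) x y xy.
      by apply: Dr; lra.
    rewrite normrM [`|y - x| ^+ 3]exprSr mulrA ler_wpM2r//; apply: key.
    by rewrite !ger0_norm; lra.
  have [s /andP[? _]|s /andP[s1 s2] E] :=
    @rdiff_MVT _ r (fun s => (s - x) ^+ 2 / (x ^+ 2 * s)) y x (ltW yx').
    by apply: Dr; lra.
  rewrite distrC E normrM (distrC x) [`|y - x| ^+ 3]exprSr mulrA ler_wpM2r//; apply: key.
  by rewrite !ler0_norm; lra.
move=> e e0; have c0 : 0 < e * x ^+ 3 / 2 by rewrite divr_gt0 ?mulr_gt0 ?exprn_gt0.
exists (Num.min (x / 2) (e * x ^+ 3 / 2)); first by rewrite lt_min c0 andbT divr_gt0.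
move=> y; rewrite lt_min => /andP[/ltW yx ye].
have := bnd y yx; rewrite /r.
have -> : ln y + (- (y - x) / x + (y - x) ^+ 2 / (2 * x ^+ 2)) -
   (ln x + (- (x - x) / x + (x - x) ^+ 2 / (2 * x ^+ 2))) =
  ln y - ln x - x^-1 * (y - x) - - (2 * x ^+ 2)^-1 * (y - x) ^+ 2.
  by rewrite subrr; field; rewrite gt_eqF.
move=> H; apply: le_trans H _; rewrite -(real_normK (num_real (y - x))).
rewrite [`|_| ^+ 3]exprSr mulrA mulrAC ler_wpM2r ?exprn_ge0//.
have -> : e = 2 / x ^+ 3 * (e * x ^+ 3 / 2) by field; rewrite gt_eqF.
by rewrite ler_pM2l ?divr_gt0 ?exprn_gt0// ltW.
Qed.

Lemma rtaylor2_sq (x : R) : rtaylor2 (fun y => y ^+ 2) x (2 * x) 1.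
Proof.
move=> e e0; exists 1 => // y _.
have -> : y ^+ 2 - x ^+ 2 - 2 * x * (y - x) - 1 * (y - x) ^+ 2 = 0 by ring.
by rewrite normr0 mulr_ge0 ?sqr_ge0// ltW.
Qed.

Lemma sec_ln u z al l : 0 < u z -> sec u z al l ->
  sec (fun w => ln (u w)) z ((u z)^-1%:C * al) ((u z)^-1 * l - nrm al ^+ 2 / (4 * u z ^+ 2)).
Proof.
move=> u0 S; have := sec_comp (rtaylor2_ln u0) S.
have -> : (u z)^-1 * l + - (2 * u z ^+ 2)^-1 * nrm al ^+ 2 / 2 =
  (u z)^-1 * l - nrm al ^+ 2 / (4 * u z ^+ 2) by field; rewrite gt_eqF.
by [].
Qed.

Lemma nrm2conj z : nrm (2%:R * conjc z) ^+ 2 = 4 * sqn z.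
Proof.
have E : (2%:R : R[i]) = (2%:R : R)%:C by rewrite rmorph_nat.
rewrite nrmM E nrm_real nrm_conjc exprMn -sqnE (ger0_norm (_ : 0 <= 2))//.
by rewrite -natrX.
Qed.

(** For [k > 0] this is a logarithmic potential smoothed at scale [sqrt k], with positive Laplacian;
    for [k = 0] it is harmonic away from [c]. *)
Lemma sec_ln_sqnD c (k : R) z : 0 < sqn (z - c) + k ->
  exists al, sec (fun w => ln (sqn (w - c) + k)) z al (k / (sqn (z - c) + k) ^+ 2).
Proof.
move=> h; have := sec_ln h (secD (sec_sqn c z) (sec_cst k z)).
rewrite addr0 nrm2conj.
have -> : (sqn (z - c) + k)^-1 * (1 + 0) -
      4 * sqn (z - c) / (4 * (sqn (z - c) + k) ^+ 2) = k / (sqn (z - c) + k) ^+ 2.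
  by field; rewrite gt_eqF.
by move=> S; eexists; exact: S.
Qed.

Lemma sqn_gt0 z : z != 0 -> 0 < sqn z.
Proof. by move=> z0; rewrite sqnE exprn_gt0// nrm_gt0. Qed.

Lemma sec_ln_sqn c z : z != c -> exists al, sec (fun w => ln (sqn (w - c))) z al 0.
Proof.
move=> zc; have [|al] := @sec_ln_sqnD c 0 z.
  by rewrite addr0 sqn_gt0// subr_eq0.
rewrite mul0r => S; exists al; move: S.
by under [X in sec X]eq_fun do rewrite addr0.
Qed.

Lemma sec_ext u v z al l : (exists2 d : R, 0 < d & forall w, nrm (w - z) < d -> u w = v w) ->
  sec u z al l -> sec v z al l.
Proof.
move=> [d d0 E] [b S]; exists b => e e0; have [d' d0' D] := S e e0.
exists (Num.min d d'); first by rewrite lt_min d0.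
move=> w; rewrite lt_min => /andP[wd wd'].
by rewrite -(E w wd) -(E z) ?subrr ?nrm0//; exact: D.
Qed.

(** Subtracting [eta |w|^2] makes the Laplacian strictly negative, which no interior minimum allows;
    [eta] is so small that a value below [B] still forces the minimum below what the points with
    [B <= u] permit. *)
Lemma min_principle K u (B : R) : cpt K -> (forall z, K z -> rcont K u z) ->
  (forall z, K z -> B <= u z \/
     (exists2 d : R, 0 < d & forall w, nrm (w - z) < d -> K w) /\
     (exists al l, l <= 0 /\ sec u z al l)) ->
  forall z, K z -> B <= u z.
Proof.
move=> cK uC H x Kx; rewrite leNgt; apply/negP => xB.
have [M KM] := cK.2; have M1 : 0 < 1 + M ^+ 2 by rewrite ltr_pwDl ?sqr_ge0.
pose eta := (B - u x) / (1 + M ^+ 2).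
have eta0 : 0 < eta by rewrite divr_gt0//; lra.
have etaM : eta * M ^+ 2 < B - u x.
  by rewrite /eta mulrAC ltr_pdivrMr// ltr_pM2l; lra.
pose v w := u w + (- eta) * sqn (w - 0).
have vC z : K z -> rcont K v z.
  move=> Kz; apply: rcontD; first exact: uC.
  apply: rcontM; first exact: rcont_cst.
  by apply: rcont_sqn; apply: contB; [exact: cont_id|exact: cont_cst].
have [y Ky ymin] := cpt_min cK (ex_intro _ x Kx) vC.
have sqM w : K w -> sqn (w - 0) <= M ^+ 2.
  move=> Kw; rewrite subr0 sqnE ler_pXn2r ?nnegrE ?nrm_ge0 ?KM//.
  exact: le_trans (nrm_ge0 _) (KM w Kw).
have := ymin x Kx; rewrite /v => yx.
have [By|[[d d0 D] [al [l [l0 S]]]]] := H y Ky.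
  have : 0 <= eta * sqn (x - 0) by rewrite mulr_ge0 ?sqn_ge0 ?ltW.
  have : eta * sqn (y - 0) <= eta * M ^+ 2 by rewrite ler_pM2l// sqM.
  lra.
have S' : sec v y _ _ := secD S (secZ (- eta) (sec_sqn 0 y)).
have := sec_local_min d0 S' (fun w wd => ymin w (D w wd)).
lra.
Qed.

(** Multiplicative counterpart of [min_principle], for functions such as squared moduli that may
    vanish. The perturbation is the factor [1 + eta |w|^2], whose logarithm is strictly subharmonic,
    and logarithms are taken only near a maximum point where [u] is positive. *)
Lemma max_principle K u (B : R) : cpt K -> 0 <= B -> (forall z, K z -> rcont K u z) ->
  (forall z, K z -> u z <= B \/
     [/\ exists2 d : R, 0 < d & forall w, nrm (w - z) < d -> K w, 0 < u z &
     exists al, sec (fun w => ln (u w)) z al 0]) ->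
  forall z, K z -> u z <= B.
Proof.
move=> cK B0 uC H x Kx; rewrite leNgt; apply/negP => xB.
have [M KM] := cK.2; have M1 : 0 < 1 + M ^+ 2 by rewrite ltr_pwDl ?sqr_ge0.
have BM : 0 < (1 + B) * (1 + M ^+ 2) by rewrite mulr_gt0// ltr_pwDl.
(* The factor [1 + B] gives [B eta M^2 < u x - B] and keeps the denominator positive when [B] or [M]
   is [0]. *)
pose eta := (u x - B) / ((1 + B) * (1 + M ^+ 2)).
have eta0 : 0 < eta by rewrite divr_gt0//; lra.
have etaM : B * (1 + eta * M ^+ 2) < u x.
  have : B * (eta * M ^+ 2) < u x - B.
    rewrite /eta mulrCA mulrAC ltr_pdivrMr//.
    by rewrite ltr_pM2l; [have := sqr_ge0 M; nra|lra].
  by rewrite mulrDr mulr1; lra.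
pose t w := eta * sqn (w - 0) + 1.
pose v w := u w * t w.
have t1 w : 1 <= t w by rewrite lerDr mulr_ge0 ?sqn_ge0 ?ltW.
have vC z : K z -> rcont K (fun w => - v w) z.
  move=> Kz; under [X in rcont _ X]eq_fun do rewrite -mulN1r.
  apply: rcontM; first exact: rcont_cst.
  apply: rcontM; first exact: uC.
  apply: rcontD; last exact: rcont_cst.
  apply: rcontM; first exact: rcont_cst.
  by apply: rcont_sqn; apply: contB; [exact: cont_id|exact: cont_cst].
have [y Ky ymin] := cpt_min cK (ex_intro _ x Kx) vC.
have sqM w : K w -> sqn (w - 0) <= M ^+ 2.
  move=> Kw; rewrite subr0 sqnE ler_pXn2r ?nnegrE ?nrm_ge0 ?KM//.
  exact: le_trans (nrm_ge0 _) (KM w Kw).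
have := ymin x Kx; rewrite lerN2 => yx.
have vx : u x <= v x by rewrite ler_peMr// (le_trans B0)// ltW.
have [yB|[[d d0 D] uy0 [al S]]] := H y Ky.
  have tM : t y <= 1 + eta * M ^+ 2 by rewrite /t addrC lerD2l ler_pM2l// sqM.
  have : v y <= B * (1 + eta * M ^+ 2).
    apply: (@le_trans _ _ (B * t y)); last exact: ler_wpM2l.
    by rewrite /v ler_wpM2r// (le_trans ler01).
  lra.
have [d' d0' D'] := uC y Ky _ uy0.
have up w : nrm (w - y) < Num.min d d' -> 0 < u w.
  rewrite lt_min => /andP[/D Kw /(D' w Kw)]; rewrite ltr_norml => /andP[]; lra.
have ty0 w : 0 < t w by exact: lt_le_trans (t1 w).
have St : sec t y _ _ := secD (secZ eta (sec_sqn 0 y)) (sec_cst 1 y).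
have S' := secZ (-1) (secD S (sec_ln (ty0 y) St)).
have d1 : 0 < Num.min d d' by rewrite lt_min d0.
have /(sec_local_min d1 S') : forall w, nrm (w - y) < Num.min d d' ->
    -1 * (ln (u y) + ln (t y)) <= -1 * (ln (u w) + ln (t w)).
  move=> w wd; have Kw : K w by apply: D; move: wd; rewrite lt_min => /andP[].
  rewrite !mulN1r lerN2 -!lnM ?posrE ?up ?ty0 ?subrr ?nrm0//.
  rewrite ler_ln ?posrE ?mulr_gt0 ?up ?ty0 ?subrr ?nrm0//.
  by have := ymin w Kw; rewrite lerN2.
rewrite !addr0 mulr1 add0r nrmM exprMn nrm2conj nrm_real (gtr0_norm eta0).
have -> : -1 * ((t y)^-1 * eta - eta ^+ 2 * (4 * sqn (y - 0)) / (4 * t y ^+ 2)) =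
   - (eta / t y ^+ 2).
  by have := gt_eqF (ty0 y); rewrite /t => ty; field; rewrite ty.
by rewrite oppr_ge0 leNgt divr_gt0 ?exprn_gt0.
Qed.

Definition bd V (z : R[i]) := adh V z /\ ~ V z.

Lemma bd_cpt V : opn V -> bdd V -> cpt (bd V).
Proof.
move=> oV bV; have [cA [M AM]] := adh_cpt bV; split; last first.
  by exists M => z [/AM].
move=> z Bz; split.
  by apply: adh_idem => e /Bz[w [Aw _] we]; exists w.
move=> /oV[d d0 D]; have [w [_ nVw]] := Bz d d0.
by move=> /D.
Qed.

Lemma inv_small (m : R) : 0 < m -> exists n : nat, n.+1%:R^-1 <= m.
Proof.
move=> m0; exists (Num.truncn m^-1).
rewrite -[leRHS]invrK lef_pV2 ?posrE ?invr_gt0//.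
exact/ltW/truncnS_gt.
Qed.

Lemma cpt_dist K F c : cpt K -> (forall z, K z -> cont F z) ->
  (forall z, K z -> F z != c) ->
  exists2 d : R, 0 < d & forall z, K z -> d <= nrm (F z - c).
Proof.
move=> cK FC Fc.
have [z Kz|m n w mn|n H] := cpt_unif (P := fun n w => n.+1%:R^-1 <= nrm (F w - c)) cK.
- have m0 : 0 < nrm (F z - c) / 2 by rewrite divr_gt0// nrm_gt0// subr_eq0 Fc.
  have [n nm] := inv_small m0; exists n.
  have [d d0 D] := FC z Kz _ m0; exists d => // w _ /D wd.
  apply: le_trans nm _; have := nrm_tri (F w) (F z) c.
  by rewrite (nrm_distC (F z) (F w)); lra.
- by apply: le_trans; rewrite lef_pV2 ?posrE// ler_nat ltnS.
- by exists n.+1%:R^-1.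
Qed.

(** The maximum principle for [|F - b|^-2], whose logarithm is harmonic because [b] is omitted. *)
Lemma min_modulus V F b (d : R) : opn V -> bdd V -> 0 < d ->
  (forall z, adh V z -> cont F z) ->
  (forall z, V z -> exists a a', taylor2 F z a a') ->
  (forall z, adh V z -> F z != b) ->
  (forall z, bd V z -> d <= nrm (F z - b)) ->
  forall z, V z -> d <= nrm (F z - b).
Proof.
move=> oV bV d0 FC FT Fb Fd z Vz.
have sp w : adh V w -> 0 < sqn (F w - b) by move=> /Fb; rewrite -subr_eq0; exact: sqn_gt0.
suff : (sqn (F z - b))^-1 <= (d ^+ 2)^-1.
  rewrite lef_pV2 ?posrE ?exprn_gt0 ?sp//; last exact: adh_sub.
  by rewrite sqnE ler_pXn2r ?nnegrE ?nrm_ge0// ltW.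
apply: (@max_principle (adh V) (fun w => (sqn (F w - b))^-1)).
- exact: adh_cpt.
- by rewrite invr_ge0 exprn_ge0// ltW.
- move=> w Aw; apply: rcontV; first by rewrite gt_eqF ?sp.
  by apply: rcont_sqn; apply: contB; [exact: FC|exact: cont_cst].
- move=> w Aw; have [Vw|nVw] := pselect (V w); last first.
    left; rewrite lef_pV2 ?posrE ?exprn_gt0 ?sp//.
    by rewrite sqnE ler_pXn2r ?nnegrE ?nrm_ge0 ?(ltW d0)//; exact: Fd.
  right; split; last 2 first.
  + by rewrite invr_gt0 sp.
  + have [al S] := sec_ln_sqn (Fb w Aw).
    have [a [a' T]] := FT w Vw.
    have := secZ (-1) (sec_holo T S); rewrite mul0r mulr0 => S'.
    eexists; apply: sec_ext S'; have [e e0 E] := oV w Vw; exists e => // y /E Vy.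
    by rewrite lnV ?mulN1r// posrE sp//; exact: adh_sub.
  + by have [e e0 E] := oV w Vw; exists e => // y /E; exact: adh_sub.
- exact: adh_sub.
Qed.

(* Where [F] omits [b], the minimum modulus principle keeps [b] away from the whole
   image, so membership in [F @` V] is locally constant off [F @` bd V]. *)
Lemma connected_image V F (C : set (Cplx R)) : opn V -> bdd V ->
  (forall z, adh V z -> cont F z) ->
  (forall z, V z -> exists a a', taylor2 F z a a') ->
  connected C -> (forall z, bd V z -> ~ C (F z)) ->
  (exists2 z, V z & C (F z)) -> forall c, C c -> exists2 z, V z & F z = c.
Proof.
move=> oV bV FC FT cC Cbd [z0 Vz0 Cz0].
move=> c1 Cc1.
apply: (connected_const (P := fun c => exists2 z, V z & F z = c) cC _ Cz0 Cc1).
  move=> c Cc.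
  have [||d d0 D] := @cpt_dist _ F c (bd_cpt oV bV).
  - by move=> z [/FC].
  - by move=> z Bz; apply/eqP => E; apply: (Cbd z Bz); rewrite E.
  have d40 : 0 < d / 4 by rewrite divr_gt0.
  have key b b' : nrm (b - c) <= d / 4 -> nrm (b' - c) <= d / 4 ->
     ~ (exists2 z, V z & F z = b) -> ~ (exists2 z, V z & F z = b').
    move=> bc bc' nb [z Vz zb'].
    have bdb y : bd V y -> d * 3 / 4 <= nrm (F y - b).
      by move=> /D; have := nrm_tri b (F y) c; lra.
    have : d * 3 / 4 <= nrm (F z - b).
      apply: (min_modulus oV bV _ FC FT _ bdb Vz); first by lra.
      move=> y Ay; apply/eqP => yb; apply: nb; exists y => //.
      apply: contrapT => nVy; have := bdb y (conj Ay nVy).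
      by rewrite yb subrr nrm0; lra.
    by rewrite zb'; have := nrm_tri c b' b; rewrite (nrm_distC c); lra.
  exists (d / 4) => // b Cb bc; split => H; apply: contrapT => nH.
  - by move: H; apply: (key c) nH; rewrite ?subrr ?nrm0; lra.
  - by move: H; apply: (key b) nH; rewrite ?subrr ?nrm0; lra.
by exists z0.
Qed.

End MaxPrinciple.

(** * The Goursat theorem *)

Section Goursat.
Variable R : realType.
Implicit Types (z w a b c : R[i]) (f g : R[i] -> R[i]) (P Q : R -> R[i]).

Definition rcdiff P (x : R) (v : R[i]) :=
  forall e : R, 0 < e -> exists2 d : R, 0 < d &
    forall s, `|s - x| < d -> nrm (P s - P x - v * (s - x)%:C) <= e * `|s - x|.

Lemma rcdiff_Re P x v c : rcdiff P x v -> rdiff (fun s => Re (c * P s)) x (Re (c * v)).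
Proof.
move=> D e e0; have p0 : 0 < 1 + nrm c by rewrite ltr_pwDl ?nrm_ge0.
have e0' : 0 < e / (1 + nrm c) by rewrite divr_gt0.
have [d d0 H] := D _ e0'; exists d => // s /H {}H.
have -> : Re (c * P s) - Re (c * P x) - Re (c * v) * (s - x) =
  Re (c * (P s - P x - v * (s - x)%:C)).
  by rewrite !(ReD, ReN, ReM, ImM, ImD, ImN) /=; ring.
apply: le_trans (Re_nrm _) _; rewrite nrmM.
apply: le_trans (ler_wpM2l (nrm_ge0 _) H) _.
rewrite mulrA ler_wpM2r// mulrCA ler_piMr ?(ltW e0)//.
by rewrite ler_pdivrMr// mul1r; lra.
Qed.

Lemma rcdiff_mkC (p q : R -> R) (x l m : R) : rdiff p x l -> rdiff q x m ->
  rcdiff (fun s => p s +i* q s) x (l +i* m).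
Proof.
move=> Dp Dq e e0; have e20 : 0 < e / 2 by rewrite divr_gt0.
have [d d0 H] := Dp _ e20; have [d' d0' H'] := Dq _ e20.
exists (Num.min d d'); first by rewrite lt_min d0.
move=> s; rewrite lt_min => /andP[/H {}H /H' {}H'].
have -> : p s +i* q s - (p x +i* q x) - (l +i* m) * (s - x)%:C =
    (p s - p x - l * (s - x)) +i* (q s - q x - m * (s - x)).
  by apply: eqC; rewrite !(ReD, ReN, ReM, ImM, ImD, ImN) /=; ring.
by apply: le_trans (nrm_ReIm _) _ => /=; lra.
Qed.

Lemma rcdiffB P Q x v w : rcdiff P x v -> rcdiff Q x w ->
  rcdiff (fun s => P s - Q s) x (v - w).
Proof.
move=> Dp Dq e e0; have e20 : 0 < e / 2 by rewrite divr_gt0.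
have [d d0 H] := Dp _ e20; have [d' d0' H'] := Dq _ e20.
exists (Num.min d d'); first by rewrite lt_min d0.
move=> s; rewrite lt_min => /andP[/H {}H /H' {}H'].
have -> : P s - Q s - (P x - Q x) - (v - w) * (s - x)%:C =
  (P s - P x - v * (s - x)%:C) - (Q s - Q x - w * (s - x)%:C) by ring.
by apply: le_trans (nrm_sub _ _) _; lra.
Qed.

Lemma rcdiff_quad (al be : R[i]) (x : R) :
  rcdiff (fun s => al * s%:C + be * (s%:C ^+ 2 / 2%:R)) x (al + be * x%:C).
Proof.
move=> e e0; have p0 : 0 < 1 + nrm be by rewrite ltr_pwDl ?nrm_ge0.
exists (e / (1 + nrm be)); first by rewrite divr_gt0.
move=> s; rewrite ltr_pdivlMr// => se.
have -> : al * s%:C + be * (s%:C ^+ 2 / 2) - (al * x%:C + be * (x%:C ^+ 2 / 2)) -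
    (al + be * x%:C) * (s - x)%:C = be * (s - x)%:C * ((s - x) / 2)%:C.
  have -> : ((s - x) / 2)%:C = (s - x)%:C / 2 :> R[i] by rewrite rmorphM /= fmorphV rmorph_nat.
  by rewrite rmorphB /=; field.
rewrite !nrmM !nrm_real normrM.
have -> : nrm be * `|s - x| * (`|s - x| * `|2^-1|) = nrm be * `|s - x| * `|2^-1| * `|s - x|.
  by ring.
rewrite ler_wpM2r//.
rewrite [`|2^-1|]ger0_norm ?invr_ge0//; have := normr_ge0 (s - x); have := nrm_ge0 be; nra.
Qed.

Lemma curve_le P (v : R -> R[i]) (s t M : R) : s <= t ->
  (forall x, s <= x <= t -> rcdiff P x (v x)) ->
  (forall x, s <= x <= t -> nrm (v x) <= M) ->
  nrm (P t - P s) <= M * (t - s).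
Proof.
move=> st D B; set c := conjc (P t - P s).
have [x xst E] := rdiff_MVT st (fun x xst => rcdiff_Re c (D x xst)).
have nE : Re (c * P t) - Re (c * P s) = nrm (P t - P s) ^+ 2.
  by rewrite -Re_conjM mulrBr ReD ReN.
have : nrm (P t - P s) ^+ 2 <= nrm (P t - P s) * (M * (t - s)).
  rewrite -nE E mulrA ler_wpM2r ?subr_ge0//; apply: le_trans (ler_norm _) _.
  apply: le_trans (Re_nrm _) _; rewrite nrmM nrm_conjc.
  by rewrite ler_wpM2l ?nrm_ge0// B.
rewrite expr2; have := nrm_ge0 (P t - P s).
rewrite le_eqVlt => /predU1P[<- _|fp]; last by rewrite ler_pM2l.
by rewrite mulr_ge0 ?subr_ge0// (le_trans _ (B x _)) ?nrm_ge0.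
Qed.

Lemma curve_cmp P Q (v w : R -> R[i]) (s t M : R) :
  (forall x, Num.min s t <= x <= Num.max s t ->
     [/\ rcdiff P x (v x), rcdiff Q x (w x) & nrm (v x - w x) <= M]) ->
  nrm (P t - P s - (Q t - Q s)) <= M * `|t - s|.
Proof.
move=> H.
have key s' t' : s' <= t' -> Num.min s t = s' -> Num.max s t = t' ->
  nrm (P t' - Q t' - (P s' - Q s')) <= M * (t' - s').
  move=> st ms mt; apply: (@curve_le (fun x => P x - Q x) (fun x => v x - w x)) => //.
    by move=> x xst; have [] := H x; rewrite ?ms ?mt// => ? ? _; exact: rcdiffB.
  by move=> x xst; have [] := H x; rewrite ?ms ?mt.
have [st|/ltW ts] := leP s t.
  have -> : P t - P s - (Q t - Q s) = P t - Q t - (P s - Q s) by ring.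
  by rewrite ger0_norm ?subr_ge0//; apply: key => //; [apply: min_l|apply: max_r].
have -> : P t - P s - (Q t - Q s) = - (P s - Q s - (P t - Q t)) by ring.
rewrite nrmN distrC ger0_norm ?subr_ge0//.
by apply: key => //; [apply: min_r|apply: max_l].
Qed.

Lemma real_primitive (K : R) (phi : R -> R) : 0 < K -> continuous phi ->
  exists p : R -> R, forall x, - K < x < K -> rdiff p x (phi x).
Proof.
move=> K0 cphi.
exists (fun x => (\int[lebesgue_measure]_(t in `[- K, x]) phi t)%R) => x /andP[Kx xK].
have ci : lebesgue_measure.-integrable `[- K, K]%classic (EFin \o phi).
  apply: continuous_compact_integrable; first exact: segment_compact.
  exact: continuous_subspaceT.
have [] := continuous_FTC1_closed xK ci Kx (cphi x).
by move=> D E; apply/rdiffP; rewrite -E derive1E; exact: derivableP.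
Qed.

Lemma curve_primitive (K : R) (phi : R -> R[i]) : 0 < K ->
  (forall x e, 0 < e -> exists2 d : R, 0 < d & forall y, `|y - x| < d -> nrm (phi y - phi x) < e) ->
  exists P, forall x, - K < x < K -> rcdiff P x (phi x).
Proof.
move=> K0 C.
have cRe : continuous (fun x => Re (phi x)).
  move=> x; apply/cvgrPdist_lt => e /(C x)[d d0 D]; exists d => // y /= yd.
  rewrite distrC -ReN -ReD; apply: le_lt_trans (Re_nrm _) (D _ _).
  by rewrite distrC.
have cIm : continuous (fun x => Im (phi x)).
  move=> x; apply/cvgrPdist_lt => e /(C x)[d d0 D]; exists d => // y /= yd.
  rewrite distrC -ImN -ImD; apply: le_lt_trans (Im_nrm _) (D _ _).
  by rewrite distrC.
have [p Dp] := real_primitive K0 cRe; have [q Dq] := real_primitive K0 cIm.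
exists (fun s => p s +i* q s) => x xK.
have -> : phi x = Re (phi x) +i* Im (phi x) by case: (phi x).
by apply: rcdiff_mkC; [exact: Dp|exact: Dq].
Qed.

End Goursat.

(** * Goursat's theorem on a square, by bisection *)

Section GoursatBox.
Variable R : realType.
Variables (K : R) (f : R[i] -> R[i]).
Hypotheses (K0 : 0 < K) (fC : forall z, cont f z).
Hypothesis fD : forall z, `|Re z| < K -> `|Im z| < K -> exists a, diff f z a.
(** The primitives on different lines are chosen independently; only their increments are used, so
    no integration constants have to match. *)
Variables PH PV : R -> R -> R[i].
Hypothesis PHd : forall y x, - K < x < K -> rcdiff (PH y) x (f (x +i* y)).
Hypothesis PVd : forall x y, - K < y < K -> rcdiff (PV x) y (f (x +i* y)).

(* Integral of [f] over the boundary of a rectangle, in terms of primitives of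
   its restrictions to horizontal and vertical lines. *)
Let T (x1 x2 y1 y2 : R) : R[i] :=
  (PH y1 x2 - PH y1 x1) + 'i * (PV x2 y2 - PV x2 y1)
  - (PH y2 x2 - PH y2 x1) - 'i * (PV x1 y2 - PV x1 y1).

(** Affine functions have explicit primitives [Eh] and [Ev] whose boundary sum vanishes, so only the
    deviation [eta] counts, along the perimeter. *)
Let T_affine (x1 x2 y1 y2 eta : R) (al be : R[i]) :
  - K < x1 -> x1 <= x2 -> x2 < K -> - K < y1 -> y1 <= y2 -> y2 < K ->
  (forall x y, x1 <= x <= x2 -> y1 <= y <= y2 ->
     nrm (f (x +i* y) - (al + be * (x +i* y))) <= eta) ->
  nrm (T x1 x2 y1 y2) <= 2 * eta * ((x2 - x1) + (y2 - y1)).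
Proof.
move=> Kx1 x12 x2K Ky1 y12 y2K H.
have Ec (x y : R) : x +i* y = x%:C + 'i * y%:C :> R[i].
  by apply: eqC; rewrite !(ReD, ReM, ImM, ImD) /=; ring.
pose Eh (y x : R) := (al + be * ('i * y%:C)) * x%:C + be * (x%:C ^+ 2 / 2%:R).
pose Ev (x y : R) := (al + be * x%:C) * y%:C + (be * 'i) * (y%:C ^+ 2 / 2%:R).
have hor y : y1 <= y <= y2 ->
    nrm (PH y x2 - PH y x1 - (Eh y x2 - Eh y x1)) <= eta * (x2 - x1).
  move=> yy; have := @curve_cmp _ (PH y) (Eh y) (fun x => f (x +i* y))
    (fun x => (al + be * ('i * y%:C)) + be * x%:C) x1 x2 eta.
  rewrite ger0_norm ?subr_ge0//; apply => x.
  rewrite min_l// max_r// => xx; split.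
  - by apply: PHd; move: xx => /andP[]; lra.
  - exact: rcdiff_quad.
  - have -> : al + be * ('i * y%:C) + be * x%:C = al + be * (x +i* y) by rewrite Ec; ring.
    exact: H.
have ver x : x1 <= x <= x2 ->
    nrm (PV x y2 - PV x y1 - (Ev x y2 - Ev x y1)) <= eta * (y2 - y1).
  move=> xx; have := @curve_cmp _ (PV x) (Ev x) (fun y => f (x +i* y))
    (fun y => (al + be * x%:C) + be * 'i * y%:C) y1 y2 eta.
  rewrite ger0_norm ?subr_ge0//; apply => y.
  rewrite min_l// max_r// => yy; split.
  - by apply: PVd; move: yy => /andP[]; lra.
  - exact: rcdiff_quad.
  - have -> : al + be * x%:C + be * 'i * y%:C = al + be * (x +i* y) by rewrite Ec; ring.
    exact: H.
have i2 : ('i : R[i]) * 'i = -1 by rewrite -expr2 sqr_i.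
have -> : T x1 x2 y1 y2 =
   (PH y1 x2 - PH y1 x1 - (Eh y1 x2 - Eh y1 x1))
   + 'i * (PV x2 y2 - PV x2 y1 - (Ev x2 y2 - Ev x2 y1))
   - (PH y2 x2 - PH y2 x1 - (Eh y2 x2 - Eh y2 x1))
   - 'i * (PV x1 y2 - PV x1 y1 - (Ev x1 y2 - Ev x1 y1)).
  by rewrite /T /Eh /Ev; ring.
have h1 : nrm (PH y1 x2 - PH y1 x1 - (Eh y1 x2 - Eh y1 x1)) <= eta * (x2 - x1).
  by apply: hor; rewrite lexx.
have h2 : nrm (PH y2 x2 - PH y2 x1 - (Eh y2 x2 - Eh y2 x1)) <= eta * (x2 - x1).
  by apply: hor; rewrite lexx y12.
have v1 : nrm (PV x1 y2 - PV x1 y1 - (Ev x1 y2 - Ev x1 y1)) <= eta * (y2 - y1).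
  by apply: ver; rewrite lexx.
have v2 : nrm (PV x2 y2 - PV x2 y1 - (Ev x2 y2 - Ev x2 y1)) <= eta * (y2 - y1).
  by apply: ver; rewrite lexx x12.
apply: le_trans (nrm_sub _ _) _.
apply: le_trans (lerD (nrm_sub _ _) (lexx _)) _.
apply: le_trans (lerD (lerD (nrmD _ _) (lexx _)) (lexx _)) _.
rewrite !nrmM nrm_i !mul1r.
lra.
Qed.

Let T_splitx x1 x2 x3 y1 y2 : T x1 x3 y1 y2 = T x1 x2 y1 y2 + T x2 x3 y1 y2.
Proof. by rewrite /T; ring. Qed.

Let T_splity x1 x2 y1 y2 y3 : T x1 x2 y1 y3 = T x1 x2 y1 y2 + T x1 x2 y2 y3.
Proof. by rewrite /T; ring. Qed.

Let half (a : R) (n : nat) := a / 2 ^+ n.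

Let halfS a n : half a n = half a n.+1 + half a n.+1.
Proof.
have ? : (2 : R) ^+ n != 0 by rewrite expf_neq0.
by rewrite /half exprS; field.
Qed.

(** The four quarters add up to the whole and the bound scales by [1 / 4], so a failure descends to
    nested rectangles. Near their common point [f] is affine up to an error proportional to the
    size, and [T_affine] contradicts the failure. *)
Let goursat_le x y (a b : R) : - K < x -> 0 <= a -> x + a < K ->
  - K < y -> 0 <= b -> y + b < K ->
  forall e : R, 0 < e -> nrm (T x (x + a) y (y + b)) <= e * (a + b) ^+ 2.
Proof.
move=> Kx a0 xK Ky b0 yK e e0; rewrite leNgt; apply/negP => big.
pose bad (n : nat) (p : R * R) :=
  e * (half (a + b) n) ^+ 2 < nrm (T p.1 (p.1 + half a n) p.2 (p.2 + half b n)).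
pose child (n : nat) (p q : R * R) :=
  [/\ p.1 <= q.1, q.1 + half a n.+1 <= p.1 + half a n,
      p.2 <= q.2 & q.2 + half b n.+1 <= p.2 + half b n].
have hp (c : R) n : 0 <= c -> 0 <= half c n by move=> c0; rewrite divr_ge0 ?exprn_ge0.
have step n p : bad n p -> exists q, bad n.+1 q /\ child n p q.
  move=> bp; apply: contrapT => nq.
  have good q : child n p q -> nrm (T q.1 (q.1 + half a n.+1) q.2 (q.2 + half b n.+1))
      <= e * (half (a + b) n.+1) ^+ 2.
    by move=> cq; rewrite leNgt; apply/negP => bq; apply: nq; exists q.
  have ha := hp a n.+1 a0; have hb := hp b n.+1 b0.
  have g1 := good p; have g2 := good (p.1 + half a n.+1, p.2).
  have g3 := good (p.1, p.2 + half b n.+1).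
  have g4 := good (p.1 + half a n.+1, p.2 + half b n.+1).
  move: g1 g2 g3 g4 bp; rewrite /child /bad /=.
  rewrite (halfS a n) (halfS b n) (halfS (a + b) n).
  set u := half a n.+1 in ha *; set v := half b n.+1 in hb *.
  set w := half (a + b) n.+1 => g1 g2 g3 g4.
  have {}g1 := g1 ltac:(split; lra); have {}g2 := g2 ltac:(split; lra).
  have {}g3 := g3 ltac:(split; lra); have {}g4 := g4 ltac:(split; lra).
  have -> : T p.1 (p.1 + (u + u)) p.2 (p.2 + (v + v)) =
    (T p.1 (p.1 + u) p.2 (p.2 + v) + T (p.1 + u) (p.1 + u + u) p.2 (p.2 + v))
  + (T p.1 (p.1 + u) (p.2 + v) (p.2 + v + v) +
       T (p.1 + u) (p.1 + u + u) (p.2 + v) (p.2 + v + v)).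
    by rewrite -!T_splitx -T_splity !addrA.
  rewrite ltNge => /negP; apply.
  apply: le_trans (nrmD _ _) _.
  apply: le_trans (lerD (nrmD _ _) (nrmD _ _)) _.
  have -> : e * (w + w) ^+ 2 = e * w ^+ 2 *+ 4 by ring.
  by lra.
have [g gP] : { g : nat * (R * R) -> R * R &
    forall q, bad q.1 q.2 -> bad q.1.+1 (g q) /\ child q.1 q.2 (g q) }.
  apply: (@choice _ _ (fun q r => bad q.1 q.2 -> bad q.1.+1 r /\ child q.1 q.2 r)) => -[n p] /=.
  have [/step[q ?]|np] := pselect (bad n p).
    by exists q.
  by exists p => /np.
pose s := fix s n := if n is m.+1 then g (m, s m) else (x, y).
have sb n : bad n (s n).
  elim: n => [|n ih]; first by rewrite /bad /= /half !expr0 !divr1.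
  by have [] := gP (n, s n) ih.
have sc n : child n (s n) (s n.+1) by have [] := gP (n, s n) (sb n).
have lim (c : nat -> R) (l : R) : 0 <= l ->
    (forall n, c n <= c n.+1 /\ c n.+1 + half l n.+1 <= c n + half l n) ->
    exists X, forall n, c n <= X <= c n + half l n.
  move=> l0 cl.
  have inc n k : c n <= c (n + k)%N /\ c (n + k)%N + half l (n + k) <= c n + half l n.
    elim: k => [|k [ih1 ih2]]; first by rewrite addn0.
    by rewrite addnS; have [h1 h2] := cl (n + k)%N; split; lra.
  have ub n m : c m <= c n + half l n.
    have [mn|/ltnW nm] := leqP m n.
      have [h _] := inc m (n - m)%N; rewrite subnKC// in h.
      by have := hp l n l0; lra.
    have [_ h] := inc n (m - n)%N; rewrite subnKC// in h.
    by have := hp l m l0; lra.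
  exists (sup (range c)) => n; apply/andP; split.
    have hub : has_ubound (range c) by exists (c 0%N + half l 0) => _ [m _ <-]; exact: ub.
    by apply: (ub_le_sup hub); exists n.
  have rne : range c !=set0 by exists (c 0%N); exists 0%N.
  by apply: (ge_sup rne) => _ [m _ <-]; exact: ub.
have [|X HX] := lim (fun n => (s n).1) a a0; first by move=> n; have [] := sc n.
have [|Y HY] := lim (fun n => (s n).2) b b0; first by move=> n; have [] := sc n.
have := HX 0; have := HY 0; rewrite /= /half !expr0 !divr1 => Y0 X0.
have [||c Dc] := fD (z := X +i* Y).
- by rewrite ltr_norml /=; lra.
- by rewrite ltr_norml /=; lra.
have e20 : 0 < e / 2 by rewrite divr_gt0.
have [d d0 D] := Dc _ e20.
have [n hn] : exists n, half (a + b) n < d.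
  have ab0 : 0 <= a + b by lra.
  have [m Hm] : exists m, m.+1%:R^-1 <= d / (a + b + 1).
    by apply: inv_small; rewrite divr_gt0//; lra.
  exists m; apply: (@le_lt_trans _ _ ((a + b) * m.+1%:R^-1)).
    rewrite ler_wpM2l// lef_pV2 ?posrE ?exprn_gt0//.
    by rewrite -natrX ler_nat ltn_expl.
  apply: (@le_lt_trans _ _ ((a + b) * (d / (a + b + 1)))); first by rewrite ler_wpM2l.
  by rewrite mulrCA gtr_pMr// ltr_pdivrMr ?mul1r; lra.
have inb m : [/\ x <= (s m).1, (s m).1 + half a m <= x + a, y <= (s m).2 &
    (s m).2 + half b m <= y + b].
  elim: m => [|m [h1 h2 h3 h4]]; first by rewrite /half expr0 !divr1.
  by have [] := sc m; split; lra.
have [i1 i2 i3 i4] := inb n.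
have ha := hp a n a0; have hb := hp b n b0.
have hab : half (a + b) n = half a n + half b n by rewrite /half mulrDl.
(* The deviation is [e / 2] times the half perimeter, and the [2] in [T_affine] restores exactly
   [e (half (a + b) n)^2]. *)
have := @T_affine (s n).1 ((s n).1 + half a n) (s n).2 ((s n).2 + half b n)
  (e / 2 * half (a + b) n) (f (X +i* Y) - c * (X +i* Y)) c.
have -> : 2 * (e / 2 * half (a + b) n) * ((s n).1 + half a n - (s n).1 +
   ((s n).2 + half b n - (s n).2)) = e * (half (a + b) n) ^+ 2 by rewrite hab; field.
move=> H; have := sb n; rewrite /bad ltNge => /negP; apply; apply: H; try lra.
move=> x' y' /andP[x1 x2] /andP[y1 y2].
have := HX n; have := HY n => /andP[Y1 Y2] /andP[X1 X2].
have nd : nrm (x' +i* y' - (X +i* Y)) <= half (a + b) n.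
  apply: le_trans (nrm_ReIm _) _; rewrite hab.
  have -> : Re (x' +i* y' - (X +i* Y)) = x' - X by rewrite ReD ReN.
  have -> : Im (x' +i* y' - (X +i* Y)) = y' - Y by rewrite ImD ImN.
  by apply: lerD; rewrite ler_norml; lra.
have -> : f (x' +i* y') - (f (X +i* Y) - c * (X +i* Y) + c * (x' +i* y')) =
   f (x' +i* y') - f (X +i* Y) - c * (x' +i* y' - (X +i* Y)) by ring.
apply: le_trans (D _ (le_lt_trans nd hn)) _.
by rewrite ler_pM2l.
Qed.

Let goursat x1 x2 y1 y2 : `|x1| < K -> `|x2| < K -> `|y1| < K -> `|y2| < K ->
  T x1 x2 y1 y2 = 0.
Proof.
have base u v a b : - K < u -> 0 <= a -> u + a < K -> - K < v -> 0 <= b -> v + b < K ->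
   T u (u + a) v (v + b) = 0.
  move=> h1 h2 h3 h4 h5 h6; apply/nrm0_eq0/eqP; rewrite eq_le nrm_ge0 andbT.
  apply/ler_addgt0Pr => e e0; rewrite add0r.
  have p0 : 0 < 1 + (a + b) ^+ 2 by rewrite ltr_pwDl ?sqr_ge0.
  have := goursat_le h1 h2 h3 h4 h5 h6 (divr_gt0 e0 p0); move=> H; apply: le_trans H _.
  by rewrite mulrAC ler_pdivrMr// ler_pM2l//; have := sqr_ge0 (a + b); lra.
rewrite !ltr_norml => /andP[? ?] /andP[? ?] /andP[? ?] /andP[? ?].
have B u v a b : - K < u -> u <= a -> a < K -> - K < v -> v <= b -> b < K ->
   T u a v b = 0.
  move=> h1 h2 h3 h4 h5 h6; have := base u v (a - u) (b - v).
  by rewrite !(addrC _ (_ - _)) !subrK !subr_ge0; apply.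
(* Reversing either interval changes the sign of the boundary sum. *)
have [x12|/ltW x21] := leP x1 x2; have [y12|/ltW y21] := leP y1 y2.
- exact: B.
- have := B x1 y2 x2 y1; rewrite /T => E; rewrite -[RHS]oppr0 -E//; ring.
- have := B x2 y1 x1 y2; rewrite /T => E; rewrite -[RHS]oppr0 -E//; ring.
- have := B x2 y2 x1 y1; rewrite /T => E; rewrite -E//; ring.
Qed.

Lemma box_primitive_aux : exists Phi, forall z, `|Re z| < K -> `|Im z| < K -> diff Phi z (f z).
Proof.
exists (fun z => PH 0 (Re z) - PH 0 0 + 'i * (PV (Re z) (Im z) - PV (Re z) 0)).
move=> z zx zy e e0; have e20 : 0 < e / 2 by rewrite divr_gt0.
have [d d0 D] := fC z e20.
pose d1 := Num.min d (Num.min (K - `|Re z|) (K - `|Im z|)).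
exists d1; first by rewrite !lt_min d0 !subr_gt0 zx zy.
move=> w; rewrite !lt_min => /and3P[wd wx wy].
set h := w - z.
have hx : `|Re w - Re z| <= nrm h by rewrite -ReN -ReD Re_nrm.
have hy : `|Im w - Im z| <= nrm h by rewrite -ImN -ImD Im_nrm.
have wxK : `|Re w| < K.
  by have := ler_normD (Re w - Re z) (Re z); rewrite subrK -/h in wx *; lra.
have wyK : `|Im w| < K.
  by have := ler_normD (Im w - Im z) (Im z); rewrite subrK -/h in wy *; lra.
(* Vanishing on this rectangle moves the horizontal increment from height [0] to height [Im z],
   where [f] is close to [f z]. *)
have G := @goursat (Re z) (Re w) 0 (Im z) zx wxK.
rewrite normr0 in G; have {}G := G K0 zy.
have -> : PH 0 (Re w) - PH 0 0 + 'i * (PV (Re w) (Im w) - PV (Re w) 0) -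
   (PH 0 (Re z) - PH 0 0 + 'i * (PV (Re z) (Im z) - PV (Re z) 0)) - f z * h =
  (PH (Im z) (Re w) - PH (Im z) (Re z) - (f z * (Re w)%:C - f z * (Re z)%:C))
  + 'i * (PV (Re w) (Im w) - PV (Re w) (Im z) - (f z * (Im w)%:C - f z * (Im z)%:C))
  + T (Re z) (Re w) 0 (Im z).
  have -> : h = (Re w)%:C - (Re z)%:C + 'i * ((Im w)%:C - (Im z)%:C).
    by rewrite /h; apply: eqC; rewrite !(ReD, ReN, ReM, ImM, ImD, ImN) /= ?(ReN, ImN) /=; ring.
  by rewrite /T; ring.
rewrite G addr0.
have lin (s : R) : rcdiff (fun t : R => f z * t%:C) s (f z).
  have := rcdiff_quad (f z) 0 s; rewrite mul0r addr0.
  by under [X in rcdiff X]eq_fun do rewrite mul0r addr0.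
have near x y : `|x - Re z| <= `|Re w - Re z| -> `|y - Im z| <= `|Im w - Im z| ->
   nrm (f (x +i* y) - f z) <= e / 2.
  move=> xx yy; apply/ltW/D; apply: le_lt_trans wd.
  rewrite -(ler_pXn2r (n:=2)) ?nnegrE ?nrm_ge0//= -!sqnE /sqn !(ReD, ReN, ImD, ImN) /=.
  rewrite -!(real_normK (num_real (_ - _))).
  by apply: lerD; rewrite ler_pXn2r ?nnegrE.
apply: le_trans (nrmD _ _) _; rewrite nrmM nrm_i mul1r.
have btw (s t u : R) : Num.min s t <= u <= Num.max s t -> `|u - s| <= `|t - s|.
  have [st|/ltW ts] := leP s t; last first.
    by move=> /andP[? ?]; rewrite !ler0_norm; lra.
  by move=> /andP[? ?]; rewrite !ger0_norm; lra.
have btwK (s t u : R) : `|s| < K -> `|t| < K -> Num.min s t <= u <= Num.max s t ->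
    - K < u < K.
  rewrite !ltr_norml; have [st|/ltW ts] := leP s t => *; lra.
have A := @curve_cmp _ (PH (Im z)) (fun t => f z * t%:C) (fun x => f (x +i* Im z))
  (fun=> f z) (Re z) (Re w) (e / 2).
have B := @curve_cmp _ (PV (Re w)) (fun t => f z * t%:C) (fun y => f (Re w +i* y))
  (fun=> f z) (Im z) (Im w) (e / 2).
apply: (@le_trans _ _ (e / 2 * `|Re w - Re z| + e / 2 * `|Im w - Im z|)).
  apply: lerD.
  - apply: A => x xx; split; [apply: PHd|exact: lin|apply: near].
    + exact: btwK xx.
    + exact: btw.
    + by rewrite subrr normr0.
  - apply: B => y yy; split; [apply: PVd|exact: lin|apply: near].
    + exact: btwK yy.
    + by [].
    + exact: btw.
by rewrite -mulrDr; nra.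
Qed.

End GoursatBox.

(** * Primitives on a square *)

Section Primitive.
Variable R : realType.

Lemma cont_hor (f : R[i] -> R[i]) (y x e : R) : (forall z, cont f z) -> 0 < e ->
  exists2 d : R, 0 < d & forall s, `|s - x| < d -> nrm (f (s +i* y) - f (x +i* y)) < e.
Proof.
move=> fC e0; have [d d0 D] := fC (x +i* y) e e0; exists d => // s sd; apply: D.
apply: le_lt_trans (nrm_ReIm _) _.
by rewrite !(ReD, ReN, ImD, ImN) /= subrr normr0 addr0.
Qed.

Lemma cont_ver (f : R[i] -> R[i]) (x y e : R) : (forall z, cont f z) -> 0 < e ->
  exists2 d : R, 0 < d & forall s, `|s - y| < d -> nrm (f (x +i* s) - f (x +i* y)) < e.
Proof.
move=> fC e0; have [d d0 D] := fC (x +i* y) e e0; exists d => // s sd; apply: D.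
apply: le_lt_trans (nrm_ReIm _) _.
by rewrite !(ReD, ReN, ImD, ImN) /= subrr normr0 add0r.
Qed.

Lemma box_primitive (K : R) (f : R[i] -> R[i]) : 0 < K -> (forall z, cont f z) ->
  (forall z, `|Re z| < K -> `|Im z| < K -> exists a, diff f z a) ->
  exists Phi, forall z, `|Re z| < K -> `|Im z| < K -> diff Phi z (f z).
Proof.
move=> K0 fC fD.
have [PH PHd] : { PH : R -> R -> R[i] &
    forall y, forall x, - K < x < K -> rcdiff (PH y) x (f (x +i* y)) }.
  by apply: (@choice _ _ (fun y P => forall x, - K < x < K -> rcdiff P x (f (x +i* y)))) => y;
     apply: (curve_primitive (phi := fun x => f (x +i* y)) K0) => x e;
     exact: cont_hor.
have [PV PVd] : { PV : R -> R -> R[i] &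
    forall x, forall y, - K < y < K -> rcdiff (PV x) y (f (x +i* y)) }.
  by apply: (@choice _ _ (fun x P => forall y, - K < y < K -> rcdiff P y (f (x +i* y)))) => x;
     apply: (curve_primitive (phi := fun y => f (x +i* y)) K0) => y e;
     exact: cont_ver.
exact: (box_primitive_aux K0 fC fD PHd PVd).
Qed.

End Primitive.

(** * Entire functions *)

Section Entire.
Variable R : realType.
Implicit Types (z w a b c p : R[i]) (f g d : R[i] -> R[i]).

Definition ent f := forall z, exists a, diff f z a.

Lemma ent_cont f : ent f -> forall z, cont f z.
Proof. by move=> F z; have [a D] := F z; exact: diff_cont D. Qed.

Lemma ent_cst c : ent (fun=> c).
Proof. by move=> z; exists 0; exact: diff_cst. Qed.

Lemma ent_id : ent id.
Proof. by move=> z; exists 1; exact: diff_id. Qed.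

Lemma entB f g : ent f -> ent g -> ent (fun w => f w - g w).
Proof. by move=> F G z; have [a A] := F z; have [b B] := G z; exists (a - b); exact: diffB. Qed.

Lemma entM f g : ent f -> ent g -> ent (fun w => f w * g w).
Proof. by move=> F G z; have [a A] := F z; have [b B] := G z; eexists; exact: diffM A B. Qed.

Lemma ent_comp f g : ent f -> ent g -> ent (fun w => f (g w)).
Proof.
by move=> F G z; have [b B] := G z; have [a A] := F (g z); eexists; exact: diff_comp B A.
Qed.

Lemma ent_subc c : ent (fun w => w - c).
Proof. by apply: entB; [exact: ent_id|exact: ent_cst]. Qed.

Lemma ent_addc c : ent (fun w => w + c).
Proof.
move=> z; exists (1 + 0); apply: (@diffD R id (fun=> c)); [exact: diff_id|exact: diff_cst].
Qed.

Lemma cpt_disk c (r : R) : cpt [set w : Cplx R | nrm (w - c) <= r].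
Proof.
split; last first.
  exists (r + nrm c) => w /= wr; have := nrm_lbB w c; lra.
move=> z Az /=; rewrite leNgt; apply/negP => h.
have [w /= wr wz] := Az (nrm (z - c) - r) ltac:(lra).
have := nrm_tri w z c; rewrite (nrm_distC z w); lra.
Qed.

(* [f] is a limit of difference quotients of its primitive, which are twice
   differentiable and hence obey the second order maximum principle. *)
Lemma annulus_bound f c (rho B : R) : ent f -> 0 < rho ->
  (forall w, rho <= nrm (w - c) <= 2 * rho -> nrm (f w) <= B) ->
  forall w, nrm (w - c) <= 2 * rho -> nrm (f w) <= B.
Proof.
move=> F rho0 H w0 w0r; have [/H|w0rho] := boolP (rho <= nrm (w0 - c) <= 2 * rho); first exact.
have {w0r}w0rho : nrm (w0 - c) < rho by move: w0rho; rewrite w0r andbT -ltNge.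
rewrite leNgt; apply/negP => big.
have B0 : 0 <= B.
  have := H (c + rho%:C); rewrite addrC addKr nrm_real gtr0_norm//.
  by move=> /(_ ltac:(lra)); apply: le_trans; exact: nrm_ge0.
have nc := nrm_ge0 c.
have K0 : 0 < nrm c + 3 * rho by lra.
have [Phi PhiD] := box_primitive K0 (ent_cont F) (fun z _ _ => F z).
have inbox w : nrm (w - c) < 3 * rho -> diff Phi w (f w).
  move=> wr; have nw : nrm w < nrm c + 3 * rho by have := nrm_lbB w c; lra.
  by apply: PhiD; [have := Re_nrm w|have := Im_nrm w]; lra.
(* Half the excess is the tolerance: a difference quotient this close to [f w0] still exceeds [B] in
   modulus. *)
have e0 : 0 < (nrm (f w0) - B) / 2 by rewrite divr_gt0// subr_gt0.
have [dl dl0 D] := inbox w0 ltac:(lra) _ e0.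
pose h := Num.min dl rho / 2.
have m0 : 0 < Num.min dl rho by rewrite lt_min dl0.
have md : Num.min dl rho <= dl by rewrite ge_min lexx.
have mr : Num.min dl rho <= rho by rewrite ge_min lexx orbT.
have h0 : 0 < h by rewrite divr_gt0.
have hd : h < dl by rewrite /h; lra.
have hr : h <= rho / 2 by rewrite /h; lra.
have hC0 : h%:C != 0 :> R[i] by apply: nrm_gt0_neq; rewrite nrm_real gtr0_norm.
have nh : nrm h%:C = h by rewrite nrm_real gtr0_norm.
pose u w := (Phi (w + h%:C) - Phi w) / h%:C.
have nearby w : nrm (w - c) < 5 / 2 * rho -> nrm (w + h%:C - c) < 3 * rho.
  move=> wr; have -> : w + h%:C - c = (w - c) + h%:C by ring.
  by apply: le_lt_trans (nrmD _ _) _; rewrite nh; lra.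
have uD w : nrm (w - c) < 5 / 2 * rho -> diff u w ((f (w + h%:C) - f w) / h%:C).
  move=> wr.
  have D1 : diff (fun w => Phi (w + h%:C)) w (f (w + h%:C) * (1 + 0)).
    apply: (@diff_comp R Phi (fun w => w + h%:C)).
      by apply: (@diffD R id (fun=> h%:C)); [exact: diff_id|exact: diff_cst].
    by apply: inbox; exact: nearby.
  rewrite addr0 mulr1 in D1.
  have := diffM (diffB D1 (inbox w ltac:(lra))) (diff_cst h%:C^-1 w).
  by rewrite mulr0 addr0.
have gD w : exists b, diff (fun w => (f (w + h%:C) - f w) / h%:C) w b.
  apply: entM; last exact: ent_cst.
  by apply: entB => //; apply: ent_comp => //; exact: ent_addc.
have uB : nrm (u w0) <= B.
  suff : sqn (u w0) <= B ^+ 2 by rewrite sqnE ler_pXn2r ?nnegrE ?nrm_ge0.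
  (* From the middle circle of the annulus a segment of length [h <= rho / 2] does not leave the
     annulus, so there the mean value inequality bounds [u] by [B]. *)
  apply: (@max_principle R [set w : Cplx R | nrm (w - c) <= 3 / 2 * rho] (fun w => sqn (u w))).
  - exact: cpt_disk.
  - exact: sqr_ge0.
  - move=> w /= wr; apply: rcont_sqn; apply: (@diff_cont _ _ _ ((f (w + h%:C) - f w) / h%:C)).
    by apply: uD; lra.
  - move=> w /= wr; have [|big'] := leP (sqn (u w)) (B ^+ 2); first by left.
    right.
    have u0 : 0 < sqn (u w) by apply: le_lt_trans big'; exact: sqr_ge0.
    have wr' : nrm (w - c) < 3 / 2 * rho.
      rewrite lt_neqAle wr andbT; apply/eqP => E.
      move: big'; rewrite ltNge sqnE ler_pXn2r ?nnegrE ?nrm_ge0// => /negP; apply.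
      rewrite /u nrmM nrmV nh ler_pdivrMr//.
      have := @mean_value R Phi f w (w + h%:C) B.
      have -> : w + h%:C - w = h%:C by ring.
      rewrite nh; apply => t /andP[t0 t1].
        apply: inbox; have -> : w + t%:C * h%:C - c = (w - c) + t%:C * h%:C by ring.
        apply: le_lt_trans (nrmD _ _) _; rewrite nrmM nh nrm_real ger0_norm// E.
        by have : t * h <= 1 * h by [rewrite ler_pM2r]; lra.
      apply: H; have -> : w + t%:C * h%:C - c = (w - c) + t%:C * h%:C by ring.
      have := nrmD (w - c) (t%:C * h%:C); have := nrm_lb (w - c) (t%:C * h%:C).
      rewrite nrmM nh nrm_real ger0_norm// E.
      have : t * h <= 1 * h by rewrite ler_pM2r.
      by lra.
    split => //.
    + exists (3 / 2 * rho - nrm (w - c)); first by rewrite subr_gt0.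
      by move=> y /= yw; have := nrm_tri w y c; lra.
    + have uw0 : u w != 0 by apply: contraTneq u0 => ->; rewrite sqnE nrm0 expr0n /= ltxx.
      have [al S] := sec_ln_sqn uw0.
      have [b Db] := gD w.
      have T := @diff_taylor2 R u (fun w => (f (w + h%:C) - f w) / h%:C) w b (rho / 2).
      have {}T : taylor2 u w ((f (w + h%:C) - f w) / h%:C) (b / 2%:R).
        apply: T => //; first by rewrite divr_gt0.
        by move=> y yw; apply: uD; have := nrm_tri w y c; lra.
      have := sec_holo T S; rewrite mul0r => S'; eexists.
      by apply: sec_ext S'; exists 1 => // y _; rewrite subr0.
  - by rewrite /=; lra.
have := D (w0 + h%:C); rewrite addrC addKr nh => /(_ hd).
have -> : Phi (w0 + h%:C) - Phi w0 - f w0 * h%:C = (u w0 - f w0) * h%:C.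
  by rewrite /u mulrBl divfK.
rewrite nrmM nh ler_pM2r//.
by have := nrm_lbB (f w0) (u w0); rewrite nrm_distC; lra.
Qed.

Lemma bernoulli (t : R) k : 0 <= t -> 1 + k%:R * t <= (1 + t) ^+ k.
Proof.
move=> t0; elim: k => [|k ih]; first by rewrite mul0r addr0 expr0.
rewrite exprS -natr1; have k0 : 0 <= k%:R :> R by [].
have : 0 <= k%:R * t * t by rewrite !mulr_ge0.
have : (1 + t) * (1 + k%:R * t) <= (1 + t) * (1 + t) ^+ k by rewrite ler_wpM2l// addr_ge0.
lra.
Qed.

(** The constants [A] and [B] lose their weight as [k] grows; a bound with a wasteful factor thereby
    becomes sharp. *)
Lemma pow_le (A B q Q : R) : 0 < A -> 0 <= Q -> 0 <= q ->
  (forall k, A * q ^+ k <= B * Q ^+ k) -> q <= Q.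
Proof.
move=> A0 Q0 q0 H; rewrite leNgt; apply/negP => Qq.
have := Q0; rewrite le_eqVlt => /predU1P[E|Qp].
  have := H 1%N; rewrite !expr1 -E mulr0 leNgt mulr_gt0//; lra.
pose t := q / Q - 1.
have t0 : 0 < t by rewrite subr_gt0 ltr_pdivlMr// mul1r.
have Hk k : A * (1 + k%:R * t) <= B.
  have := H k; have -> : q = Q * (1 + t) by rewrite /t addrC subrK mulrC divfK// gt_eqF.
  rewrite exprMn [Q ^+ k * _]mulrC mulrA ler_pM2r ?exprn_gt0//; apply: le_trans.
  by rewrite ler_pM2l//; exact/bernoulli/ltW.
have At : 0 < A * t by rewrite mulr_gt0.
have := Hk (Num.truncn (B / (A * t))).+1.
have : B / (A * t) < (Num.truncn (B / (A * t))).+1%:R by exact: truncnS_gt.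
rewrite ltr_pdivrMr// => h1 h2; nra.
Qed.

Lemma diff_lip f z a : diff f z a -> exists2 e : R, 0 < e &
  forall w, nrm (w - z) < e -> nrm (f w - f z) <= (1 + nrm a) * nrm (w - z).
Proof.
move=> D; have [e e0 H] := D 1 ltr01; exists e => // w /H; rewrite mul1r => {}H.
have -> : f w - f z = (f w - f z - a * (w - z)) + a * (w - z) by ring.
by apply: le_trans (nrmD _ _) _; rewrite nrmM; lra.
Qed.

(* Where [d] vanishes, [f^2 (f/d)^k] is differentiable because [f/d] is bounded;
   letting [k] tend to infinity removes the factor [f^2]. *)
Lemma div_bound f d c (rho B Q : R) : ent f -> ent d -> 0 < rho -> 0 <= Q ->
  (forall z, d z = 0 -> f z = 0 /\ exists2 a, a != 0 & diff d z a) ->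
  (forall w, rho <= nrm (w - c) <= 2 * rho -> nrm (f w) <= B) ->
  (forall w, rho <= nrm (w - c) <= 2 * rho -> nrm (f w) <= Q * nrm (d w)) ->
  forall w, nrm (w - c) <= 2 * rho -> nrm (f w) <= Q * nrm (d w).
Proof.
move=> F D rho0 Q0 dz HB HQ.
(* At a zero of [d] this quotient has the default value [0]; [H k] vanishes there to second order,
   so its derivative is [0] in any case. *)
pose q w := f w / d w.
pose H k w := f w ^+ 2 * q w ^+ k.
have entH k : ent (H k).
  move=> z; have [a Da] := F z; have [d0|dn0] := eqVneq (d z) 0; last first.
    have [b Db] := D z; have Dq := diffM Da (diffV dn0 Db).
    have [a1 D1] := diffX 2 Da; have [a2 D2] := diffX k Dq.
    by eexists; exact: diffM D1 D2.
  have [fz [b b0 Db]] := dz z d0; exists 0 => e e0.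
  have nb := nrm_gt0 b0; have nb2 : 0 < nrm b / 2 by rewrite divr_gt0.
  have [e1 e10 E1] := Db _ nb2; have [e2 e20 E2] := diff_lip Da.
  have na := nrm_ge0 a.
  pose L := 1 + nrm a; pose C := 2 * L / nrm b.
  have L0 : 0 < L by rewrite /L; lra.
  have C0 : 0 < C by rewrite divr_gt0// mulr_gt0.
  have P0 : 0 < L ^+ 2 * C ^+ k by rewrite mulr_gt0 ?exprn_gt0.
  exists (Num.min e1 (Num.min e2 (e / (L ^+ 2 * C ^+ k)))).
    by rewrite !lt_min e10 e20 divr_gt0.
  move=> w; rewrite !lt_min => /and3P[/E1 + /E2]; rewrite d0 fz !subr0 => {}E1 {}E2.
  rewrite ltr_pdivlMr// => we.
  have n0 := nrm_ge0 (w - z).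
  have dw : nrm b / 2 * nrm (w - z) <= nrm (d w).
    have := nrm_lb (b * (w - z)) (d w - b * (w - z)).
    have -> : b * (w - z) + (d w - b * (w - z)) = d w by ring.
    by rewrite nrmM; lra.
  have qC : nrm (q w) <= C.
    have [dw0|dw0] := eqVneq (d w) 0; first by rewrite /q dw0 invr0 mulr0 nrm0 ltW.
    rewrite /q nrmM nrmV ler_pdivrMr ?nrm_gt0//; apply: le_trans E2 _.
    have -> : (1 + nrm a) * nrm (w - z) = C * (nrm b / 2 * nrm (w - z)).
      by rewrite /C /L; field; rewrite gt_eqF.
    by rewrite ler_pM2l.
  rewrite /H fz expr0n /= mul0r mul0r !subr0 nrmM !nrmX.
  apply: (@le_trans _ _ ((L * nrm (w - z)) ^+ 2 * C ^+ k)).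
    apply: ler_pM; rewrite ?exprn_ge0 ?nrm_ge0// lerXn2r ?nnegrE ?nrm_ge0 ?(ltW C0)//.
    by rewrite mulr_ge0 ?(ltW L0).
  have -> : (L * nrm (w - z)) ^+ 2 * C ^+ k = (nrm (w - z) * (L ^+ 2 * C ^+ k)) * nrm (w - z).
    by ring.
  by rewrite ler_wpM2r// ltW.
move=> w wr; have [fw0|fw0] := eqVneq (f w) 0.
  by rewrite fw0 nrm0 mulr_ge0 ?nrm_ge0.
have dw0 : d w != 0 by apply: contra fw0 => /eqP/dz[-> _].
suff : nrm (q w) <= Q by rewrite /q nrmM nrmV ler_pdivrMr ?nrm_gt0.
have fw2 : 0 < nrm (f w) ^+ 2 by rewrite exprn_gt0// nrm_gt0.
apply: (pow_le (A := nrm (f w) ^+ 2) (B := B ^+ 2)) => // [|k]; first exact: nrm_ge0.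
have := @annulus_bound (H k) c rho (B ^+ 2 * Q ^+ k) (entH k) rho0 _ w wr.
rewrite /H nrmM !nrmX; apply => y yr; rewrite nrmM !nrmX.
have By := HB y yr; have B0 : 0 <= B := le_trans (nrm_ge0 _) By.
apply: ler_pM; rewrite ?exprn_ge0 ?nrm_ge0// lerXn2r ?nnegrE ?nrm_ge0//.
have [dy0|dy0] := eqVneq (d y) 0; first by rewrite /q dy0 invr0 mulr0 nrm0.
by rewrite /q nrmM nrmV ler_pdivrMr ?nrm_gt0//; exact: HQ.
Qed.

(** On the annulus [|f w - f p| <= 2 B] and [|w - p| >= rho / 2], whence [4 B / rho]; [div_bound]
    carries the quotient bound inside. *)
Lemma divided_diff1 f c (rho B : R) p : ent f -> 0 < rho ->
  (forall w, rho <= nrm (w - c) <= 2 * rho -> nrm (f w) <= B) ->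
  nrm (p - c) <= rho / 2 ->
  forall w, nrm (w - c) <= 2 * rho -> nrm (f w - f p) <= 4 * B / rho * nrm (w - p).
Proof.
move=> F rho0 H pc.
have HM := annulus_bound F rho0 H.
have fp : nrm (f p) <= B by apply: HM; lra.
have B0 : 0 <= B := le_trans (nrm_ge0 _) fp.
have H2 w : rho <= nrm (w - c) <= 2 * rho -> nrm (f w - f p) <= 2 * B.
  by move=> /H; have := nrm_sub (f w) (f p); lra.
apply: (@div_bound (fun w => f w - f p) (fun w => w - p) c rho (2 * B)) => //.
- by apply: entB => //; exact: ent_cst.
- exact: ent_subc.
- by rewrite divr_ge0 ?mulr_ge0// ltW.
- move=> z /eqP; rewrite subr_eq0 => /eqP ->; rewrite subrr; split => //.
  exists (1 - 0); first by rewrite subr0 oner_eq0.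
  by apply: diffB; [exact: diff_id|exact: diff_cst].
- move=> w wr; apply: le_trans (H2 w wr) _.
  have -> : 2 * B = 4 * B / rho * (rho / 2) by field; rewrite gt_eqF.
  apply: ler_wpM2l; first by rewrite divr_ge0 ?mulr_ge0// ltW.
  move: wr => /andP[wr _]; have := nrm_tri p w c; lra.
Qed.

(** The linear interpolant at [p] and [p'] is subtracted. On the annulus the numerator is at most
    [2 B + 10 B] and [|w - p| |w - p'|] at least [rho^2 / 4], whence [48]; [p != p'] makes the zeros
    of the divisor simple. *)
Lemma divided_diff2 f c (rho B : R) p p' : ent f -> 0 < rho ->
  (forall w, rho <= nrm (w - c) <= 2 * rho -> nrm (f w) <= B) ->
  nrm (p - c) <= rho / 2 -> nrm (p' - c) <= rho / 2 -> p != p' ->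
  forall w, nrm (w - c) <= 2 * rho ->
  nrm (f w - f p - (f p' - f p) / (p' - p) * (w - p)) <=
    48 * B / rho ^+ 2 * (nrm (w - p) * nrm (w - p')).
Proof.
move=> F rho0 H pc pc' pp w wr.
have pp0 : p' - p != 0 by rewrite subr_eq0 eq_sym.
have HM := annulus_bound F rho0 H.
have fp : nrm (f p) <= B by apply: HM; lra.
have B0 : 0 <= B := le_trans (nrm_ge0 _) fp.
set s := (f p' - f p) / (p' - p).
have sB : nrm s <= 4 * B / rho.
  rewrite /s nrmM nrmV ler_pdivrMr ?nrm_gt0//.
  by apply: (divided_diff1 F rho0 H pc); lra.
have H2 y : rho <= nrm (y - c) <= 2 * rho -> nrm (f y - f p - s * (y - p)) <= 12 * B.
  move=> yr; apply: le_trans (nrm_sub _ _) _; rewrite nrmM.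
  have := H y yr; have := nrm_sub (f y) (f p).
  have yp : nrm (y - p) <= 5 / 2 * rho.
    by move: yr => /andP[_ yr]; have := nrm_tri c y p; rewrite (nrm_distC c p); lra.
  have : nrm s * nrm (y - p) <= 4 * B / rho * (5 / 2 * rho).
    by apply: ler_pM; rewrite ?nrm_ge0.
  have -> : 4 * B / rho * (5 / 2 * rho) = 10 * B by field; rewrite gt_eqF.
  lra.
rewrite -nrmM.
apply: (@div_bound (fun w => f w - f p - s * (w - p)) (fun w => (w - p) * (w - p')) c rho
  (12 * B)) => //.
- apply: entB; first by apply: entB => //; exact: ent_cst.
  by apply: entM; [exact: ent_cst|exact: ent_subc].
- by apply: entM; exact: ent_subc.
- by rewrite divr_ge0 ?mulr_ge0 ?exprn_ge0// ltW.
- move=> z /eqP; rewrite mulf_eq0 !subr_eq0 => zpp.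
  have Dd : diff (fun w => (w - p) * (w - p')) z ((1 - 0) * (z - p') + (z - p) * (1 - 0)).
    by apply: diffM; apply: diffB; first [exact: diff_id|exact: diff_cst].
  move: zpp => /orP[] /eqP zp; rewrite zp in Dd *; split.
  + by rewrite !subrr mulr0 subrr.
  + exists (p - p'); first by rewrite subr_eq0.
    by move: Dd; have -> : (1 - 0) * (p - p') + (p - p) * (1 - 0) = p - p' by ring.
  + by rewrite /s divfK// subrr.
  + exists (p' - p) => //.
    by move: Dd; have -> : (1 - 0) * (p' - p') + (p' - p) * (1 - 0) = p' - p by ring.
- move=> y yr; apply: le_trans (H2 y yr) _; rewrite nrmM.
  have -> : 12 * B = 48 * B / rho ^+ 2 * (rho / 2 * (rho / 2)) by field; rewrite gt_eqF.
  apply: ler_wpM2l; first by rewrite divr_ge0 ?mulr_ge0 ?exprn_ge0// ltW.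
  move: yr => /andP[yr _]; have := nrm_tri p y c; have := nrm_tri p' y c => ? ?.
  by apply: ler_pM; lra.
Qed.

(** A Lipschitz function extends over the puncture. Each coordinate of the limit is the supremum of
    the lower bounds [k (phi w) - L |w - c|]; two coordinates give the factor [2]. *)
Lemma lipschitz_limit (phi : R[i] -> R[i]) c (r L : R) : 0 < r ->
  (forall w w', w != c -> w' != c -> nrm (w - c) <= r -> nrm (w' - c) <= r ->
     nrm (phi w - phi w') <= L * nrm (w - w')) -> 0 <= L ->
  exists a, forall w, w != c -> nrm (w - c) <= r -> nrm (phi w - a) <= 2 * L * nrm (w - c).
Proof.
move=> r0 H L0.
pose D := [set w : Cplx R | w != c /\ nrm (w - c) <= r].
have D0 : D (c + r%:C).
  have E : c + r%:C - c = r%:C by ring.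
  rewrite /D /= -subr_eq0 E nrm_real gtr0_norm//; split => //.
  by apply: nrm_gt0_neq; rewrite nrm_real gtr0_norm.
have lim (k : R[i] -> R) : (forall z w, `|k z - k w| <= nrm (z - w)) ->
   exists l, forall w, D w -> `|k (phi w) - l| <= L * nrm (w - c).
  move=> kl.
  pose S := [set k (phi w) - L * nrm (w - c) | w in D].
  have ub w : D w -> ubound S (k (phi w) + L * nrm (w - c)).
    move=> [wc wr] _ [w' [wc' wr'] <-].
    have := H w' w wc' wc wr' wr; have := kl (phi w') (phi w).
    have : L * nrm (w' - w) <= L * (nrm (w' - c) + nrm (w - c)).
      by apply: ler_wpM2l => //; rewrite (nrm_distC w c); exact: nrm_tri.
    by have := ler_norm (k (phi w') - k (phi w)); lra.
  exists (sup S) => w Dw; rewrite ler_norml.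
  have h1 : k (phi w) - L * nrm (w - c) <= sup S.
    by apply: ub_le_sup; [eexists; exact: ub D0|exists w].
  have h2 : sup S <= k (phi w) + L * nrm (w - c).
    by apply: ge_sup; [eexists; exists (c + r%:C)|exact: ub].
  by apply/andP; split; lra.
have [l Hl] := lim (@complex.Re R) (fun z w => ltac:(rewrite -ReN -ReD; exact: Re_nrm)).
have [m Hm] := lim (@complex.Im R) (fun z w => ltac:(rewrite -ImN -ImD; exact: Im_nrm)).
exists (l +i* m) => w wc wr; apply: le_trans (nrm_ReIm _) _.
have := Hl w (conj wc wr); have := Hm w (conj wc wr).
by rewrite ReD ImD ReN ImN /=; lra.
Qed.

Lemma ent_bounded f c (r : R) : ent f -> exists B : R, forall w, nrm (w - c) <= r -> nrm (f w) <= B.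
Proof.
move=> F; have [r0|r0] := ltP r 0.
  by exists 0 => w wr; have := nrm_ge0 (w - c); lra.
have [||z _ Hz] := @cpt_min R _ (fun w => - nrm (f w)) (cpt_disk c r).
- by exists c; rewrite /= subrr nrm0.
- move=> z _; under [X in rcont _ X]eq_fun do rewrite -mulN1r.
  apply: rcontM; first exact: rcont_cst.
  by apply: rcont_nrm; exact: ent_cont.
- by exists (nrm (f z)) => w /Hz; rewrite lerN2.
Qed.

(** The difference quotients [Dh h] of [f] are entire and bounded by [B] uniformly in [h], so
    [divided_diff2] bounds their second divided differences by [48 B]. Letting [h] tend to [0] makes
    the slope [(g w - g c) / (w - c)] Lipschitz, hence convergent at [c]. *)
Lemma ent_derivative f g : ent f -> (forall z, diff f z (g z)) -> ent g.
Proof.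
(* Radius [8] is twice [4]: with [rho = 4] the constant [4 B / rho] of [divided_diff1] is [B]
   itself. *)
move=> F G c; have [B HB] := ent_bounded c 8 F.
have B0 : 0 <= B by apply: le_trans (HB c _); rewrite ?nrm_ge0// subrr nrm0.
have Hann w : 4 <= nrm (w - c) <= 2 * 4 -> nrm (f w) <= B.
  by move=> /andP[_ ?]; apply: HB; lra.
have lipf p w : nrm (p - c) <= 2 -> nrm (w - c) <= 8 -> nrm (f w - f p) <= B * nrm (w - p).
  move=> pc wc; have := divided_diff1 F _ Hann (p := p); rewrite mulrAC divff// mul1r.
  by apply; lra.
pose Dh (h : R) w := (f (w + h%:C) - f w) / h%:C.
have key p w : p != c -> w != c -> nrm (p - c) <= 1 / 2 -> nrm (w - c) <= 1 / 2 ->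
   nrm (g w - g c - (g p - g c) / (p - c) * (w - c)) <= 48 * B * (nrm (w - c) * nrm (w - p)).
  move=> pc0 wc0 pc wc; apply/ler_addgt0Pr => e e0.
  have pcn : p - c != 0 by rewrite subr_eq0.
  have np := nrm_gt0 pcn; have nw := nrm_ge0 (w - c).
  (* [M] is the total weight with which the errors of [Dh h] at [w], [c] and [p] enter the divided
     difference. *)
  pose M := 2 + 2 * (nrm (w - c) / nrm (p - c)).
  have M0 : 0 < M.
    by have : 0 <= nrm (w - c) / nrm (p - c) by [rewrite divr_ge0// nrm_ge0]; rewrite /M; lra.
  have e10 : 0 < e / M by rewrite divr_gt0.
  have apx z : exists2 dl : R, 0 < dl & forall h : R, 0 < h -> h < dl ->
      nrm (Dh h z - g z) <= e / M.
    have [dl dl0 D] := G z _ e10; exists dl => // h h0 hd.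
    have nh : nrm h%:C = h by rewrite nrm_real gtr0_norm.
    have hC0 : h%:C != 0 :> R[i] by apply: nrm_gt0_neq; rewrite nh.
    have := D (z + h%:C); rewrite addrC addKr nh => /(_ hd).
    have -> : f (z + h%:C) - f z - g z * h%:C = (Dh h z - g z) * h%:C.
      by rewrite /Dh mulrBl divfK.
    by rewrite nrmM nh ler_pM2r.
  have [d1 d10 A1] := apx w; have [d2 d20 A2] := apx c; have [d3 d30 A3] := apx p.
  pose h := Num.min (Num.min d1 d2) (Num.min d3 1) / 2.
  have m0 : 0 < Num.min (Num.min d1 d2) (Num.min d3 1) by rewrite !lt_min d10 d20 d30 ltr01.
  have [md1 md2] : Num.min (Num.min d1 d2) (Num.min d3 1) <= d1 /\
    Num.min (Num.min d1 d2) (Num.min d3 1) <= d2 by rewrite !ge_min !lexx /= !orbT.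
  have [md3 md4] : Num.min (Num.min d1 d2) (Num.min d3 1) <= d3 /\
    Num.min (Num.min d1 d2) (Num.min d3 1) <= 1 by rewrite !ge_min !lexx /= !orbT.
  have h0 : 0 < h by rewrite divr_gt0.
  have nh : nrm h%:C = h by rewrite nrm_real gtr0_norm.
  have {}A1 := A1 h h0 ltac:(rewrite /h; lra).
  have {}A2 := A2 h h0 ltac:(rewrite /h; lra).
  have {}A3 := A3 h h0 ltac:(rewrite /h; lra).
  have entDh : ent (Dh h).
    apply: entM; last exact: ent_cst.
    by apply: entB => //; apply: ent_comp => //; exact: ent_addc.
  have DhB y : 1 <= nrm (y - c) <= 2 * 1 -> nrm (Dh h y) <= B.
    move=> /andP[_ yc]; rewrite /Dh nrmM nrmV nh ler_pdivrMr//.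
    have := lipf y (y + h%:C); have -> : y + h%:C - y = h%:C by ring.
    rewrite nh; apply; first by lra.
    have -> : y + h%:C - c = (y - c) + h%:C by ring.
    by apply: le_trans (nrmD _ _) _; rewrite nh /h; lra.
  have := divided_diff2 entDh ltr01 DhB (p := c) (p' := p).
  rewrite subrr nrm0 eq_sym => /(_ _ pc pc0 w _).
  rewrite expr1n divr1 => dd.
  have {}dd := dd ltac:(lra) ltac:(lra).
  set X := g w - _ - _; set Y := Dh h w - Dh h c - (Dh h p - Dh h c) / (p - c) * (w - c) in dd.
  have XY : nrm (X - Y) <= e / M * M.
    have -> : X - Y = (g w - Dh h w) - (g c - Dh h c)
       - ((g p - Dh h p) - (g c - Dh h c)) * ((w - c) / (p - c)).
      by rewrite /X /Y; field.
    apply: le_trans (nrm_sub _ _) _.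
    apply: le_trans (lerD (nrm_sub _ _) (lexx _)) _.
    rewrite nrmM [nrm (_ / _)]nrmM nrmV.
    have := nrm_sub (g p - Dh h p) (g c - Dh h c).
    rewrite ![nrm (g _ - Dh _ _)]nrm_distC => t1.
    have q0 : 0 <= nrm (w - c) / nrm (p - c) by rewrite divr_ge0 ?nrm_ge0.
    have : nrm (g p - Dh h p - (g c - Dh h c)) * (nrm (w - c) / nrm (p - c)) <=
      2 * (e / M) * (nrm (w - c) / nrm (p - c)) by apply: ler_wpM2r => //; lra.
    have -> : e / M * M = e / M * 2 + 2 * (e / M) * (nrm (w - c) / nrm (p - c)).
      by rewrite {2}/M; ring.
    lra.
  rewrite divfK ?gt_eqF// in XY.
  have := nrmD (X - Y) Y; rewrite subrK; lra.
have r0 : (0 : R) < 1 / 2 by lra.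
have [w w' wc wc' wr wr'||a Ha] :=
  @lipschitz_limit (fun w => (g w - g c) / (w - c)) c (1 / 2) (48 * B) r0.
- have nw := nrm_gt0 (_ : w - c != 0); rewrite subr_eq0 in nw.
  have wcn : w - c != 0 by rewrite subr_eq0.
  rewrite -(ler_pM2r (nw wc)) -nrmM mulrBl divfK//.
  by rewrite -[X in _ <= X]mulrA [X in _ <= _ * X]mulrC; exact: key.
- by rewrite mulr_ge0.
exists a => e e0; pose L := 2 * (48 * B).
have L0 : 0 < L + 1 by rewrite /L; lra.
exists (Num.min (1 / 2) (e / (L + 1))); first by rewrite lt_min r0 divr_gt0.
move=> w; rewrite lt_min => /andP[wr]; rewrite ltr_pdivlMr// => we.
have [->|wc] := eqVneq w c; first by rewrite !subrr mulr0 subrr nrm0 mulr0.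
have wcn : w - c != 0 by rewrite subr_eq0.
have -> : g w - g c - a * (w - c) = ((g w - g c) / (w - c) - a) * (w - c).
  by rewrite mulrBl divfK.
rewrite nrmM ler_wpM2r ?nrm_ge0//; apply: le_trans (Ha w wc (ltW wr)) _.
by rewrite -/L; have := nrm_ge0 (w - c); lra.
Qed.

Lemma ent_taylor2 f : ent f -> exists2 g, ent g &
  (forall z, diff f z (g z)) /\ forall z, exists b, taylor2 f z (g z) b.
Proof.
move=> F; have [g G] := choice F; have Gent := ent_derivative F G.
exists g => //; split => // z; have [b B] := Gent z.
by exists (b / 2%:R); apply: (diff_taylor2 ltr01) => // w _.
Qed.

End Entire.

(** * A Harnack inequality *)

Section Harnack.
Variable R : realType.
Implicit Types (z w a b c : R[i]) (F G : R[i] -> R[i]).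

(** Clamping both coordinates to [[-K, K]] extends [F] from the closed square to a continuous
    function on the plane, as [box_primitive] asks. *)
Lemma box_primitive_on F (K : R) : 0 < K ->
  (forall z, `|Re z| <= K -> `|Im z| <= K -> exists a, diff F z a) ->
  exists Phi, forall z, `|Re z| < K -> `|Im z| < K -> diff Phi z (F z).
Proof.
move=> K0 FD; pose cl (x : R) := Num.max (- K) (Num.min K x).
have clK x : `|cl x| <= K.
  by rewrite ler_norml le_max ge_max lexx /= ge_min lexx /= andbT; lra.
have clid x : `|x| <= K -> cl x = x.
  by rewrite ler_norml => /andP[h1 h2]; rewrite /cl min_r// max_r.
have clL x y : `|cl x - cl y| <= `|x - y|.
  rewrite /cl; have := ler_norm (x - y); have := ler_norm (- (x - y)); rewrite normrN ler_norml.
  by case: (leP K x) => ?; case: (leP K y) => ?;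
    [case: (leP (- K) K)|case: (leP (- K) K); case: (leP (- K) y)
    |case: (leP (- K) K); case: (leP (- K) x)|case: (leP (- K) x); case: (leP (- K) y)] => *; lra.
pose CL z : R[i] := cl (Re z) +i* cl (Im z).
have CLc z : cont CL z.
  move=> e e0; exists (e / 2); first by rewrite divr_gt0.
  move=> w wz; apply: le_lt_trans (nrm_ReIm _) _; rewrite !(ReD, ReN, ImD, ImN) /=.
  have := clL (Re w) (Re z); have := clL (Im w) (Im z).
  by have := Re_nrm (w - z); have := Im_nrm (w - z); rewrite !(ReD, ReN, ImD, ImN); lra.
have [z|z zx zy|Phi H] := box_primitive (f := fun w => F (CL w)) K0.
- have [a D] := FD (CL z) (clK _) (clK _).
  exact: (cont_comp (CLc z) (diff_cont D)).
- have [a D] := FD z (ltW zx) (ltW zy); exists a; apply: diff_ext D.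
  exists (Num.min (K - `|Re z|) (K - `|Im z|)); first by rewrite lt_min !subr_gt0 zx.
  move=> w; rewrite lt_min => /andP[wx wy]; congr F.
  have := ler_normD (Re (w - z)) (Re z); have := ler_normD (Im (w - z)) (Im z).
  rewrite -ReD -ImD subrK; have := Re_nrm (w - z); have := Im_nrm (w - z) => *.
  by rewrite /CL !clid; [case: (w)|lra|lra].
- exists Phi => z zx zy; have := H z zx zy.
  by rewrite /CL !clid ?(ltW zx) ?(ltW zy)//; case: (z).
Qed.

Lemma mul_conjc z : conjc z * z = (sqn z)%:C.
Proof. by apply: eqC; rewrite /sqn !(ReM, ImM) Re_conjc Im_conjc /=; ring. Qed.

Lemma sec_Re c z : sec (fun w => Re (c * w)) z c 0.
Proof.
exists 0; apply: (@small2_ext _ (fun=> 0)); last first.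
  by move=> e e0; exists 1 => // w _; rewrite normr0 mulr_ge0 ?exprn_ge0 ?nrm_ge0 ?ltW.
by move=> w /=; rewrite mulrBr ReD ReN !mul0r /=; ring.
Qed.

(** [ln |F|^2] and [2 Re L] have the same gradient, since [L] is a primitive of the logarithmic
    derivative; their difference is constant along rays from [0]. *)
Lemma log_modulus F G L (r : R) : 0 < r ->
  (forall w, nrm w < r -> diff F w (G w)) ->
  (forall w, nrm w < r -> exists b, diff G w b) ->
  (forall w, nrm w < r -> F w != 0) ->
  (forall w, nrm w < r -> diff L w (G w / F w)) ->
  forall w, nrm w < r -> ln (sqn (F w)) - ln (sqn (F 0)) = Re (2%:R * (L w - L 0)).
Proof.
move=> r0 DF DG F0 DL w wr.
have inr z : nrm z < r -> exists2 d : R, 0 < d & forall y, nrm (y - z) < d -> nrm y < r.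
  move=> zr; exists (r - nrm z); first by rewrite subr_gt0.
  by move=> y yz; have := nrm_lbB y z; lra.
pose v z := ln (sqn (F z - 0)) + -1 * Re (2%:R * L z).
have vS z : nrm z < r -> sec v z 0 0.
  move=> zr; have [d d0 Hd] := inr z zr.
  have [b Db] := DG z zr.
  have TF := diff_taylor2 d0 (fun y yd => DF y (Hd y yd)) Db.
  have Dk := diffM Db (diffV (F0 z zr) (DF z zr)).
  have TL := diff_taylor2 d0 (fun y yd => DL y (Hd y yd)) Dk.
  have s0 : 0 < sqn (F z - 0) by rewrite subr0 sqn_gt0// F0.
  have S1 := sec_holo TF (@sec_ln _ (fun y => sqn (y - 0)) (F z) _ _ s0 (sec_sqn 0 (F z))).
  have S2 := secZ (-1) (sec_holo TL (sec_Re 2%:R (L z))).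
  have := secD S1 S2; rewrite nrm2conj !mul0r mulr0 addr0 mulr1.
  have -> : (sqn (F z - 0))^-1 - 4 * sqn (F z - 0) / (4 * sqn (F z - 0) ^+ 2) = 0.
    by field; rewrite gt_eqF.
  rewrite mul0r.
  suff -> : (sqn (F z - 0))^-1%:C * (2 * conjc (F z - 0)) * G z +
      (-1)%:C * (2 * (G z / F z)) = 0 by [].
  have Fz := F0 z zr; rewrite subr0.
  have -> : conjc (F z) = (sqn (F z))%:C / F z by rewrite -mul_conjc mulfK.
  have sC : (sqn (F z))%:C != 0 :> R[i].
    by rewrite -mul_conjc mulf_neq0//; apply: nrm_gt0_neq; rewrite nrm_conjc nrm_gt0.
  by rewrite fmorphV rmorphN1; field; rewrite Fz sC.
have rd (t : R) : 0 <= t <= 1 -> rdiff (fun s => v (s%:C * w)) t 0.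
  move=> /andP[t0 t1]; have tr : nrm (t%:C * w) < r.
    by rewrite nrmM nrm_real ger0_norm//; apply: le_lt_trans wr; rewrite ler_piMl ?nrm_ge0.
  have [K K0 [d d0 H]] := sec_lip (vS _ tr).
  move=> e e0; have n0 := nrm_ge0 w.
  have p0 : 0 < 1 + nrm w by lra.
  have q0 : 0 < 1 + K * nrm w ^+ 2 by rewrite ltr_pwDl// mulr_ge0 ?exprn_ge0.
  exists (Num.min (d / (1 + nrm w)) (e / (1 + K * nrm w ^+ 2))).
    by rewrite lt_min !divr_gt0.
  move=> s; rewrite lt_min !ltr_pdivlMr// => /andP[sd se].
  have E : s%:C * w - t%:C * w = (s - t)%:C * w by rewrite rmorphB /=; ring.
  have := H (s%:C * w); rewrite E nrmM nrm_real => -[|_].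
    by have := normr_ge0 (s - t); nra.
  rewrite !mul0r !subr0 exprMn => h; apply: le_trans h _.
  have -> : K * (`|s - t| ^+ 2 * nrm w ^+ 2) = (`|s - t| * (K * nrm w ^+ 2)) * `|s - t| by ring.
  by rewrite ler_wpM2r//; have := normr_ge0 (s - t); lra.
have [t _] := rdiff_MVT ler01 rd.
rewrite !mul0r rmorph1 mul1r /v !subr0 mulrBr ReD ReN => /eqP.
by rewrite subr_eq0 => /eqP; lra.
Qed.

(* The Schwarz lemma for [(L - h0) / (L + h0)]: the maximum principle is applied to
   [m^(k+1) / w^k] on an annulus, which avoids dividing by [w] at [0]. *)
Lemma half_plane_schwarz L K (rho h0 : R) : 0 < rho -> 0 < h0 ->
  (forall w, nrm w < 4 / 3 * rho -> diff L w (K w)) ->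
  (forall w, nrm w < 4 / 3 * rho -> exists b, diff K w b) ->
  (forall w, nrm w < 4 / 3 * rho -> 0 < Re (L w)) -> L 0 = h0%:C ->
  forall w, nrm w < rho -> w != 0 ->
  sqn (L w - h0%:C) / sqn (L w - - h0%:C) * (rho ^+ 2 / sqn w) <= 1.
Proof.
move=> rho0 h00 DL DK Lp L0 w1 w1r w10.
pose A w := sqn (L w - h0%:C); pose B w := sqn (L w - - h0%:C).
have AB w : nrm w < 4 / 3 * rho -> A w <= B w.
  move=> /Lp Lw; rewrite /A /B /sqn !(ReD, ImD, ReN, ImN) /=.
  by have : 0 < h0 * Re (L w) by [exact: mulr_gt0]; nra.
have B0 w : nrm w < 4 / 3 * rho -> h0 ^+ 2 <= B w.
  move=> /Lp Lw; rewrite /B /sqn !(ReD, ImD, ReN, ImN) /= opprK.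
  by have : 0 < h0 * Re (L w) by [exact: mulr_gt0]; nra.
have Bp w : nrm w < 4 / 3 * rho -> 0 < B w.
  by move=> /B0; apply: lt_le_trans; rewrite exprn_gt0.
have sw1 := sqn_gt0 w10; have n1 := nrm_gt0 w10.
have r43 : rho < 4 / 3 * rho by lra.
have q0 : 0 <= A w1 / B w1 by rewrite divr_ge0 ?sqn_ge0.
have := q0; rewrite le_eqVlt => /predU1P[<-|qp]; first by rewrite mul0r ler01.
apply: (pow_le (A := A w1 / B w1) (B := 1)) => // [|k].
  by rewrite mulr_ge0 ?divr_ge0 ?exprn_ge0 ?sqn_ge0// ltW.
rewrite expr1n mulr1.
have [e1 e10 lip] := diff_lip (DL 0 ltac:(by rewrite nrm0; lra)).
(* [C |w|^2] bounds [A w / B w] near [0]. The inner radius [dl <= M^-1] is then small enough to give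
   [v <= 1] on the inner circle. *)
pose C := ((1 + nrm (K 0)) / h0) ^+ 2.
have C0 : 0 <= C by exact: sqr_ge0.
pose M := 1 + C * (C * rho ^+ 2) ^+ k.
have M0 : 0 < M by rewrite ltr_pwDl// mulr_ge0// exprn_ge0// mulr_ge0// sqr_ge0.
pose dl := Num.min (nrm w1) (Num.min e1 (Num.min 1 M^-1)) / 2.
have m0 : 0 < Num.min (nrm w1) (Num.min e1 (Num.min 1 M^-1)).
  by rewrite !lt_min n1 e10 ltr01 invr_gt0.
have [m1 m2] : Num.min (nrm w1) (Num.min e1 (Num.min 1 M^-1)) <= nrm w1 /\
   Num.min (nrm w1) (Num.min e1 (Num.min 1 M^-1)) <= e1 by rewrite !ge_min !lexx /= !orbT.
have [m3 m4] : Num.min (nrm w1) (Num.min e1 (Num.min 1 M^-1)) <= 1 /\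
   Num.min (nrm w1) (Num.min e1 (Num.min 1 M^-1)) <= M^-1 by rewrite !ge_min !lexx /= !orbT.
have dl0 : 0 < dl by rewrite divr_gt0.
have [dl1 dl2] : dl < nrm w1 /\ dl < e1 by rewrite /dl; split; lra.
have [dl3 dl4] : dl <= 1 /\ dl <= M^-1 by rewrite /dl; split; lra.
pose v w := A w / B w * (A w / B w * (rho ^+ 2 / sqn w)) ^+ k.
change (v w1 <= 1).
pose Ann : set (Cplx R) := [set w : Cplx R | dl <= nrm w <= rho].
have Annr w : Ann w -> nrm w < 4 / 3 * rho by move=> /andP[_ h]; lra.
have Ann0 w : Ann w -> 0 < sqn w.
  by move=> /andP[h _]; rewrite sqnE exprn_gt0//; lra.
have cL w : Ann w -> cont L w by move=> /Annr/DL; exact: diff_cont.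
apply: (@max_principle R Ann v) => //.
- split; last by exists rho => w /andP[].
  move=> w Aw; apply/andP; split; rewrite leNgt; apply/negP => h.
    have [y /andP[y1 y2] yw] := Aw (dl - nrm w) ltac:(lra).
    by have := nrm_lbB y w; lra.
  have [y /andP[y1 y2] yw] := Aw (nrm w - rho) ltac:(lra).
  by have := nrm_lbB w y; rewrite nrm_distC; lra.
- move=> w Aw; have cA : rcont Ann (fun w => A w / B w) w.
    apply: rcontM; first by apply: rcont_sqn; apply: contB; [exact: cL|exact: cont_cst].
    apply: rcontV; first by rewrite gt_eqF// Bp// Annr.
    by apply: rcont_sqn; apply: contB; [exact: cL|exact: cont_cst].
  apply: rcontM => //; apply: rcontX; apply: rcontM => //.
  apply: rcontM; first exact: rcont_cst.
  apply: rcontV; first by rewrite gt_eqF// Ann0.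
  by apply: rcont_sqn; exact: cont_id.
- move=> w Aw; have [|big] := leP (v w) 1; first by left.
  right; have wr := Annr w Aw; have Bw := Bp w wr; have sw := Ann0 w Aw.
  have Ap : 0 < A w.
    rewrite lt_neqAle sqn_ge0 andbT; apply: contraTneq big => E.
    by rewrite /v -E !mul0r ltNge ler01.
  have AwB : A w / B w <= 1 by rewrite ler_pdivrMr// mul1r AB.
  have /andP[w1' w2'] := Aw.
  have wr' : nrm w < rho.
    rewrite lt_neqAle w2' andbT; apply: contraTneq big => E; rewrite -leNgt /v sqnE E divff.
      by rewrite mulr1 -exprS exprn_ile1 ?divr_ge0 ?sqn_ge0.
    by rewrite expf_neq0// gt_eqF.
  have wd : dl < nrm w.
    rewrite lt_neqAle w1' andbT; apply: contraTneq big => E; rewrite -leNgt.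
    have AC : A w / B w <= C * dl ^+ 2.
      have := lip w; rewrite subr0 -E => /(_ dl2); rewrite L0 => lw.
      apply: (@le_trans _ _ (A w / h0 ^+ 2)).
        by rewrite ler_wpM2l ?sqn_ge0// lef_pV2 ?posrE ?exprn_gt0// B0.
      have -> : C * dl ^+ 2 = ((1 + nrm (K 0)) * dl) ^+ 2 / h0 ^+ 2.
        by rewrite /C; field; rewrite gt_eqF.
      rewrite ler_pM2r ?invr_gt0 ?exprn_gt0// /A sqnE ler_pXn2r ?nnegrE ?nrm_ge0//.
      by rewrite mulr_ge0 ?(ltW dl0)//; have := nrm_ge0 (K 0); lra.
    have q1 : A w / B w * (rho ^+ 2 / sqn w) <= C * rho ^+ 2.
      have -> : C * rho ^+ 2 = C * dl ^+ 2 * (rho ^+ 2 / sqn w).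
        by rewrite sqnE -E; field; rewrite gt_eqF.
      by rewrite ler_wpM2r// divr_ge0 ?sqr_ge0 ?sqn_ge0.
    rewrite /v; apply: (@le_trans _ _ (C * dl ^+ 2 * (C * rho ^+ 2) ^+ k)).
      have q2 : 0 <= A w / B w * (rho ^+ 2 / sqn w).
        by apply: mulr_ge0; apply: divr_ge0; rewrite ?sqr_ge0 ?sqn_ge0.
      apply: ler_pM => //; first by apply: divr_ge0; exact: sqn_ge0.
      - exact: exprn_ge0.
      - by apply: lerXn2r; rewrite ?nnegrE// mulr_ge0 ?sqr_ge0.
    have -> : C * dl ^+ 2 * (C * rho ^+ 2) ^+ k = dl ^+ 2 * (C * (C * rho ^+ 2) ^+ k) by ring.
    apply: (@le_trans _ _ (M^-1 * M)); last by rewrite mulVf// gt_eqF.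
    apply: ler_pM; rewrite ?sqr_ge0//.
    - by rewrite mulr_ge0// exprn_ge0// mulr_ge0// sqr_ge0.
    - by rewrite expr2; apply: le_trans dl4; rewrite ler_piMl// ltW.
    - by rewrite /M; lra.
  split.
  + exists (Num.min (rho - nrm w) (nrm w - dl)); first by rewrite lt_min !subr_gt0 wr'.
    move=> y; rewrite lt_min => /andP[h1 h2]; apply/andP; split.
      by have := nrm_lbB w y; rewrite nrm_distC; lra.
    by have := nrm_lbB y w; lra.
  + by apply: lt_trans big; exact: ltr01.
  + have d40 : 0 < 4 / 3 * rho - nrm w by lra.
    have Hd y : nrm (y - w) < 4 / 3 * rho - nrm w -> nrm y < 4 / 3 * rho.
      by have := nrm_lbB y w; lra.
    have [b Db] := DK w wr.
    have T := diff_taylor2 d40 (fun y yd => DL y (Hd y yd)) Db.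
    have Lh : L w != h0%:C.
      by apply: contraTneq Ap => E; rewrite /A E subrr sqnE nrm0 expr0n /= ltxx.
    have Lh' : L w != - h0%:C.
      by apply: contraTneq Bw => E; rewrite /B E subrr sqnE nrm0 expr0n /= ltxx.
    have w0 : w != 0 by apply: nrm_gt0_neq; lra.
    have [a1 S1] := sec_ln_sqn Lh; have [a2 S2] := sec_ln_sqn Lh'.
    have [a3 S3] := sec_ln_sqn w0.
    have SA := sec_holo T S1; have SB := secZ (-1) (sec_holo T S2).
    have SAB := secD SA SB.
    have S' := secD SAB (secZ k%:R (secD SAB (secD (sec_cst (ln (rho ^+ 2)) w) (secZ (-1) S3)))).
    move: S'; set l := (X in sec _ _ _ X); have -> : l = 0 by rewrite /l; ring.
    move=> S'; eexists; apply: sec_ext S'.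
    have [e2 e20 E2] : exists2 e2 : R, 0 < e2 & forall y, nrm (y - w) < e2 -> 0 < A y.
      have cA : cont (fun y => L y - h0%:C) w by apply: contB; [exact: cL|exact: cont_cst].
      have [e2 e20 E2] := @rcont_sqn R setT _ w cA _ Ap.
      by exists e2 => // y /(E2 y I); rewrite -/(A y) -/(A w) ltr_norml => /andP[]; lra.
    exists (Num.min e2 (Num.min (4 / 3 * rho - nrm w) (nrm w))).
      by rewrite !lt_min e20 d40; lra.
    move=> y; rewrite !lt_min => /and3P[/E2 Ay /Hd/Bp By yw].
    have y0 : 0 < sqn y.
      by rewrite sqnE exprn_gt0//; have := nrm_lbB w y; rewrite nrm_distC; lra.
    have r2 : 0 < rho ^+ 2 by rewrite exprn_gt0.
    rewrite /v !subr0 lnM ?posrE ?exprn_gt0 ?mulr_gt0 ?invr_gt0//.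
    rewrite [ln (_ ^+ k)]lnXn ?mulr_gt0 ?invr_gt0// !lnM ?posrE ?mulr_gt0 ?invr_gt0//.
    rewrite !lnV ?posrE// -/(A y) -/(B y) -[_ *+ k]mulr_natl; ring.
- by apply/andP; split; exact/ltW.
Qed.

(** [L] is holomorphic with real part [h = ln (|F|^2 / (r / 2)^2)], strictly positive because the
    level is [r / 2] and not [r]. The Schwarz lemma at radius [rho / 4] gives
    [|L w - h 0| <= |L w + h 0| / 2] for [|w| <= rho / 8], so [h w <= 3 h 0]; exponentiating
    produces the cube. *)
Lemma harnack0 F (r rho : R) : ent F -> 0 < r -> 0 < rho ->
  (forall w, nrm w < rho -> r <= nrm (F w)) ->
  forall w, nrm w <= rho / 8 -> 2 / r * nrm (F w) <= (2 / r * nrm (F 0)) ^+ 3.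
Proof.
move=> eF r0 rho0 Fr w wr.
have [G eG [DF _]] := ent_taylor2 eF.
have F0 z : nrm z < rho -> F z != 0 by move=> /Fr h; apply: nrm_gt0_neq; lra.
have Dk z : nrm z < rho -> exists b, diff (fun y => G y / F y) z b.
  by move=> zr; have [b Db] := eG z; eexists; exact: diffM Db (diffV (F0 z zr) (DF z)).
(* The square of half-side [rho / 3] lies in the disc of radius [rho], and [rho / 3] is [4 / 3] of
   the Schwarz radius [rho / 4]. *)
have K0 : 0 < rho / 3 by rewrite divr_gt0.
have [z zx zy|L0 DL0] := box_primitive_on (F := fun y => G y / F y) K0.
  by apply: Dk; have := nrm_ReIm z; lra.
have DL0' z : nrm z < rho / 3 -> diff L0 z (G z / F z).
  by move=> zr; apply: DL0; [have := Re_nrm z|have := Im_nrm z]; lra.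
have lgm := log_modulus K0 (fun z _ => DF z) (fun z _ => eG z)
   (fun z (zr : nrm z < rho / 3) => F0 z ltac:(lra)) DL0'.
pose c := ln (r ^+ 2 / 4).
pose h z := ln (sqn (F z)) - c.
have c0 : 0 < r ^+ 2 / 4 by rewrite divr_gt0// exprn_gt0.
have hp z : nrm z < rho -> 0 < h z.
  move=> zr; have := Fr z zr => fr; rewrite subr_gt0 ltr_ln ?posrE ?sqn_gt0 ?F0//.
  rewrite sqnE; apply: (@lt_le_trans _ _ (r ^+ 2)); last first.
    by rewrite ler_pXn2r ?nnegrE ?nrm_ge0// ltW.
  by have : 0 < r ^+ 2 by [rewrite exprn_gt0]; lra.
have nr0 : nrm (0 : R[i]) < rho by rewrite nrm0.
pose L z := 2%:R * (L0 z - L0 0) + (h 0)%:C.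
have LE z : nrm z < rho / 3 -> Re (L z) = h z.
  by move=> /lgm; rewrite ReD /= -/(h 0) => <-; rewrite /h; ring.
have LD z : nrm z < rho / 3 -> diff L z (2%:R * (G z / F z)).
  move=> zr; have := diffD (diffM (diff_cst 2%:R z) (diffB (DL0' z zr) (diff_cst (L0 0) z)))
    (diff_cst (h 0)%:C z).
  by rewrite mul0r add0r subr0 addr0.
have r43 : 4 / 3 * (rho / 4) = rho / 3 by field.
have [->|w0] := eqVneq w 0.
  have x1 : 1 <= 2 / r * nrm (F 0).
    by rewrite mulrAC ler_pdivlMr// mul1r; have := Fr 0 nr0; lra.
  by rewrite exprS ler_peMr ?(le_trans ler01)// exprn_ege1.
have rho40 : 0 < rho / 4 by rewrite divr_gt0.
have := @half_plane_schwarz L (fun z => 2%:R * (G z / F z)) (rho / 4) (h 0) rho40 (hp 0 nr0).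
rewrite r43 => /(_ LD _ _ _ w _ w0) S.
have {}S : sqn (L w - (h 0)%:C) / sqn (L w - - (h 0)%:C) * ((rho / 4) ^+ 2 / sqn w) <= 1.
  apply: S.
  - move=> z zr; have [b Db] := Dk z ltac:(lra).
    by eexists; exact: diffM (diff_cst 2%:R z) Db.
  - by move=> z zr; rewrite LE//; apply: hp; lra.
  - by rewrite /L subrr mulr0 add0r.
  - by lra.
have wr3 : nrm w < rho / 3 by lra.
have hw := hp w ltac:(lra); have h00 := hp 0 nr0.
have Bp : 0 < sqn (L w - - (h 0)%:C).
  rewrite sqn_gt0// opprK; apply: nrm_gt0_neq; apply: lt_le_trans (Re_nrm _).
  by rewrite ReD LE//= normr_gt0 gt_eqF// addr_gt0.
have sw := sqn_gt0 w0.
have {}S : nrm (L w - (h 0)%:C) <= nrm (L w - - (h 0)%:C) / 2.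
  rewrite -(ler_pXn2r (n:=2)) ?nnegrE ?divr_ge0 ?nrm_ge0//= expr_div_n -!sqnE.
  move: S; rewrite mulrAC ler_pdivrMr// mul1r mulrA ler_pdivrMr// => S.
  have sqw : sqn w <= (rho / 4) ^+ 2 / 2 ^+ 2.
    by rewrite sqnE -expr_div_n ler_pXn2r ?nnegrE ?nrm_ge0//; lra.
  have p0 : 0 < (rho / 4) ^+ 2 by rewrite exprn_gt0.
  rewrite -(ler_pM2r p0); apply: le_trans S _.
  apply: le_trans (ler_wpM2l (ltW Bp) sqw) _.
  by rewrite mulrA mulrAC.
have S2 : nrm (L w - - (h 0)%:C) <= nrm (L w - (h 0)%:C) + 2 * h 0.
  have -> : L w - - (h 0)%:C = (L w - (h 0)%:C) + (2 * h 0)%:C.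
    by rewrite rmorphM /= rmorph_nat; ring.
  by apply: le_trans (nrmD _ _) _; rewrite nrm_real ger0_norm// mulr_ge0// ltW.
have h3 : h w <= 3 * h 0.
  have := Re_nrm (L w - (h 0)%:C); rewrite ReD ReN LE//= => H.
  by have := ler_norm (h w - h 0); lra.
have sF z : nrm z < rho -> 0 < sqn (F z) by move=> /F0; exact: sqn_gt0.
have hE z : nrm z < rho -> h z = ln ((2 / r * nrm (F z)) ^+ 2).
  move=> zr; rewrite /h /c -ln_div ?posrE ?sF//; congr ln.
  by rewrite exprMn -sqnE; field; rewrite gt_eqF.
have wr' : nrm w < rho by lra.
have pz z : nrm z < rho -> 0 < 2 / r * nrm (F z).
  by move=> zr; rewrite mulr_gt0 ?divr_gt0// nrm_gt0// F0.
move: h3; rewrite !hE// [3 * _]mulr_natl -lnXn ?exprn_gt0 ?pz//.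
rewrite ler_ln ?posrE ?exprn_gt0 ?pz// -exprM mulnC exprM ler_pXn2r ?nnegrE//.
- exact/ltW/pz.
- exact/exprn_ge0/ltW/pz.
Qed.

Lemma harnack F a z (r rho : R) : ent F -> 0 < r -> 0 < rho ->
  (forall w, nrm (w - z) < rho -> r <= nrm (F w - a)) ->
  forall w, nrm (w - z) <= rho / 8 ->
    2 / r * nrm (F w - a) <= (2 / r * nrm (F z - a)) ^+ 3.
Proof.
move=> eF r0 rho0 H w wz.
have e1 : ent (fun y => F (y + z) - a).
  by apply: entB; [apply: ent_comp => //; exact: ent_addc|exact: ent_cst].
have := harnack0 e1 r0 rho0 _ wz; rewrite subrK add0r; apply => y yr.
by apply: H; rewrite addrK.
Qed.

End Harnack.

(** * Potentials and the boundary of wandering components *)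

Section Potential.
Variable R : realType.
Implicit Types (z w c : R[i]).

Lemma sec_sum (I : Type) (s : seq I) (u : I -> R[i] -> R) z (l : I -> R) :
  (forall i, exists al, sec (u i) z al (l i)) ->
  exists al, sec (fun w => \sum_(i <- s) u i w) z al (\sum_(i <- s) l i).
Proof.
move=> H; elim: s => [|i s [al ih]].
  exists 0; rewrite big_nil.
  by under [X in sec X]eq_fun do rewrite big_nil; exact: sec_cst.
have [be S] := H i; exists (be + al); rewrite big_cons.
by under [X in sec X]eq_fun do rewrite big_cons; exact: secD.
Qed.

Lemma sqn_le2 z w : sqn (z + w) <= 2 * sqn z + 2 * sqn w.
Proof.
rewrite /sqn ReD ImD.
have := sqr_ge0 (Re z - Re w); have := sqr_ge0 (Im z - Im w); nra.
Qed.

(* The Green-type potential of the masses placed at the points [a i] makes the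
   fourth power of the distance to [w0] superharmonic near those points. *)
Definition pot (dl h A2 : R) w0 (I : finType) (a : I -> R[i]) (b : I -> bool) w : R :=
  dl ^- 4 * sqn (w - w0) ^+ 2 +
  \sum_(i : I) (b i)%:R * (144 / dl ^+ 4 * h ^+ 2 * (sqn (a i - w0) + h ^+ 2)) *
     (ln A2 - ln (sqn (w - a i) + h ^+ 2)).

Section Pot.
Variables (dl h A2 : R) (w0 : R[i]) (I : finType) (a : I -> R[i]) (b : I -> bool).
Hypotheses (dl0 : 0 < dl) (h0 : 0 < h) (A0 : 0 < A2).
Let P := pot dl h A2 w0 a b.

Let h2 : 0 < h ^+ 2. Proof. by rewrite exprn_gt0. Qed.

Let sp w : 0 < sqn w + h ^+ 2. Proof. by rewrite ltr_wpDl ?sqn_ge0. Qed.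

Let k0 i : 0 <= (b i)%:R * (144 / dl ^+ 4 * h ^+ 2 * (sqn (a i - w0) + h ^+ 2)).
Proof. by rewrite !mulr_ge0 ?invr_ge0 ?exprn_ge0 ?(ltW (sp _)) ?(ltW dl0) ?(ltW h0). Qed.

Lemma pot_lb w : (forall i, sqn (w - a i) + h ^+ 2 <= A2) ->
  dl ^- 4 * sqn (w - w0) ^+ 2 <= P w.
Proof.
move=> H; rewrite lerDl sumr_ge0// => i _; rewrite mulr_ge0 ?k0// subr_ge0.
by rewrite ler_ln ?posrE ?sp ?H.
Qed.

(** Seen from [w0], the weight [t] of a mass absorbs its own logarithm: [t ln (A2 / t) <= A2], by
    [ln x <= x - 1]. *)
Lemma pot_center : P w0 <= 144 * A2 / dl ^+ 4 * (h ^+ 2 * (\sum_(i : I) b i)%:R).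
Proof.
rewrite /P /pot subrr sqnE nrm0 !expr0n /= mulr0 add0r natr_sum !mulr_sumr.
apply: ler_sum => i _; set t := sqn (a i - w0) + h ^+ 2.
have -> : sqn (w0 - a i) + h ^+ 2 = t by rewrite /t !sqnE nrm_distC.
have t0 : 0 < t by exact: sp.
have tl : t * (ln A2 - ln t) <= A2.
  rewrite -ln_div ?posrE// mulrC -ler_pdivlMr//.
  have x0 : 0 < A2 / t by rewrite divr_gt0.
  have := @le_ln1Dx R (A2 / t - 1).
  have -> : 1 + (A2 / t - 1) = A2 / t by ring.
  move=> H.
  by apply: le_trans (H _) _; lra.
have -> : (b i)%:R * (144 / dl ^+ 4 * h ^+ 2 * t) * (ln A2 - ln t) =
  (144 / dl ^+ 4 * (h ^+ 2 * (b i)%:R)) * (t * (ln A2 - ln t)) by ring.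
have -> : 144 * A2 / dl ^+ 4 * (h ^+ 2 * (b i)%:R) =
  (144 / dl ^+ 4 * (h ^+ 2 * (b i)%:R)) * A2 by ring.
by rewrite ler_wpM2l// !mulr_ge0 ?invr_ge0 ?exprn_ge0 ?(ltW dl0) ?(ltW h0).
Qed.

(** One mass near [w] outweighs the quartic term. That term contributes [4 |w - w0|^2 <= 16 t]; the
    mass contributes at least [144 t / 9], because [|w - a i0|^2 + h^2 <= 3 h^2]. This fixes the
    constant [144]. *)
Lemma pot_sec w i0 : b i0 -> sqn (w - a i0) <= 2 * h ^+ 2 ->
  exists al l, l <= 0 /\ sec P w al l.
Proof.
move=> bi0 near.
pose k i := (b i)%:R * (144 / dl ^+ 4 * h ^+ 2 * (sqn (a i - w0) + h ^+ 2)).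
pose l i := k i * (0 + -1 * (h ^+ 2 / (sqn (w - a i) + h ^+ 2) ^+ 2)).
have Si i : exists al, sec (fun y => k i * (ln A2 + -1 * ln (sqn (y - a i) + h ^+ 2))) w al (l i).
  have [al S] := sec_ln_sqnD (sp (w - a i)).
  by eexists; exact: secZ (k i) (secD (sec_cst (ln A2) w) (secZ (-1) S)).
have [al S] := sec_sum (index_enum I) Si.
have S1 := secZ (dl ^- 4) (@sec_comp _ _ (fun y => sqn (y - w0)) w _ _ _ _
  (rtaylor2_sq (sqn (w - w0))) (sec_sqn w0 w)).
have SS := secD S1 S.
move: SS; set l1 := (X in sec _ _ _ X) => SS.
eexists; exists l1; split; last first.
  apply: sec_ext SS; exists 1 => // y _; rewrite /P /pot; congr (_ + _).
  by apply: eq_bigr => i _; rewrite mulN1r.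
rewrite /l1 nrm2conj (bigD1 i0)//=.
have lneg : \sum_(i | i != i0) l i <= 0.
  apply: sumr_le0 => i _; rewrite /l add0r mulN1r mulrN oppr_le0.
  by rewrite mulr_ge0 ?k0// divr_ge0 ?exprn_ge0 ?(ltW h0)// ltW.
have d4 : 0 < dl ^+ 4 by rewrite exprn_gt0.
suff : dl ^- 4 * (4 * sqn (w - w0)) + l i0 <= 0 by lra.
rewrite /l /k bi0 mul1r add0r mulN1r mulrN subr_le0.
set t := sqn (a i0 - w0) + h ^+ 2; set u := sqn (w - a i0) in near *.
have t0 : 0 < t by exact: sp.
have st : sqn (w - w0) <= 4 * t.
  have -> : w - w0 = (w - a i0) + (a i0 - w0) by ring.
  by apply: le_trans (sqn_le2 _ _) _; rewrite -/u /t; have := sqn_ge0 (a i0 - w0); lra.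
have -> : 144 / dl ^+ 4 * h ^+ 2 * t * (h ^+ 2 / (u + h ^+ 2) ^+ 2) =
   dl ^- 4 * (144 * t * (h ^+ 4 / (u + h ^+ 2) ^+ 2)) by ring.
rewrite ler_pM2l ?invr_gt0//.
have uh : 0 < u + h ^+ 2 by exact: sp.
have q9 : 9^-1 <= h ^+ 4 / (u + h ^+ 2) ^+ 2.
  rewrite ler_pdivlMr ?exprn_gt0// -[h ^+ 4]/(h ^+ (2 * 2)) exprM.
  have : (u + h ^+ 2) ^+ 2 <= (3 * h ^+ 2) ^+ 2.
    have t1 : u + h ^+ 2 <= 3 * h ^+ 2 by lra.
    have t2 : 0 <= 3 * h ^+ 2 by have := h2; lra.
    by rewrite ler_pXn2r ?nnegrE// ltW.
  by rewrite exprMn; lra.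
have : 144 * t * 9^-1 <= 144 * t * (h ^+ 4 / (u + h ^+ 2) ^+ 2).
  by rewrite ler_wpM2l// mulr_ge0// ltW.
by lra.
Qed.

Lemma pot_cont K F z : cont F z -> rcont K (fun w => P (F w)) z.
Proof.
move=> FC; have sC y : rcont K (fun w => sqn (F w - y)) z.
  by apply: rcont_sqn; apply: contB => //; exact: cont_cst.
apply: rcontD.
  by apply: rcontM; [exact: rcont_cst|apply: rcontX].
apply: rcont_sum => i _; apply: rcontM; first exact: rcont_cst.
apply: rcontD; first exact: rcont_cst.
under [X in rcont _ X]eq_fun do rewrite -mulN1r.
apply: rcontM; first exact: rcont_cst.
apply: rcont_ln; first exact: sp.
by apply: rcontD => //; exact: rcont_cst.
Qed.

End Pot.

(** Nodes of the centred square grid of mesh [M0 / L] over [[-M0, M0]^2], for [L > 0]. *)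
Definition gpt (M0 : R) (L : nat) (pq : 'I_(2 * L).+1 * 'I_(2 * L).+1) : R[i] :=
  ((pq.1%:R - L%:R) * (M0 / L%:R)) +i* ((pq.2%:R - L%:R) * (M0 / L%:R)).

Lemma gpt_coord (M0 x : R) L : 0 < M0 -> (0 < L)%N -> `|x| <= M0 ->
  exists p : 'I_(2 * L).+1, `|x - (p%:R - L%:R) * (M0 / L%:R)| <= M0 / L%:R.
Proof.
move=> M00 L0 xM; have L0' : 0 < L%:R :> R by rewrite ltr0n.
have h0 : 0 < M0 / L%:R by rewrite divr_gt0.
set h := M0 / L%:R in h0 *; have hL : L%:R * h = M0 by rewrite /h mulrC divfK// gt_eqF.
move: xM; rewrite ler_norml => /andP[x1 x2].
have y0 : 0 <= (x + M0) / h by rewrite divr_ge0 ?(ltW h0)//; lra.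
have /andP[t1 t2] := truncn_itv y0.
have tL : (Num.truncn ((x + M0) / h) < (2 * L).+1)%N.
  rewrite ltnS -(ler_nat R); apply: le_trans t1 _.
  by rewrite ler_pdivrMr// natrM -mulrA hL; lra.
exists (Ordinal tL) => /=; set n := Num.truncn _ in t1 t2 *.
rewrite ler_pdivlMr// in t1; rewrite ltr_pdivrMr// -natr1 in t2.
by rewrite mulrBl hL ler_norml; apply/andP; split; lra.
Qed.

Lemma gpt_near (M0 : R) L w : 0 < M0 -> (0 < L)%N -> nrm w <= M0 ->
  exists pq : 'I_(2 * L).+1 * 'I_(2 * L).+1,
    sqn (w - gpt M0 pq) <= 2 * (M0 / L%:R) ^+ 2.
Proof.
move=> M00 L0 wM.
have [p Hp] := gpt_coord M00 L0 (le_trans (Re_nrm w) wM).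
have [q Hq] := gpt_coord M00 L0 (le_trans (Im_nrm w) wM).
have h0 : 0 <= M0 / L%:R by rewrite divr_ge0// ltW.
exists (p, q); rewrite /sqn !(ReD, ImD, ReN, ImN) /=.
rewrite -!(real_normK (num_real (_ - _))).
have : `|Re w - (p%:R - L%:R) * (M0 / L%:R)| ^+ 2 <= (M0 / L%:R) ^+ 2.
  by rewrite ler_pXn2r ?nnegrE.
have : `|Im w - (q%:R - L%:R) * (M0 / L%:R)| ^+ 2 <= (M0 / L%:R) ^+ 2.
  by rewrite ler_pXn2r ?nnegrE.
lra.
Qed.

Lemma gpt_bound (M0 : R) L (pq : 'I_(2 * L).+1 * 'I_(2 * L).+1) : 0 < M0 -> (0 < L)%N ->
  nrm (gpt M0 pq) <= 2 * M0.
Proof.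
move=> M00 L0; have L0' : 0 < L%:R :> R by rewrite ltr0n.
have cb (p : 'I_(2 * L).+1) : `|(p%:R - L%:R) * (M0 / L%:R)| <= M0.
  rewrite normrM [`|M0 / _|]ger0_norm ?divr_ge0 ?(ltW M00)// mulrCA ger_pMr// ler_pdivrMr// mul1r.
  have := ltn_ord p; rewrite ltnS -(ler_nat R) natrM => pL.
  by have : 0 <= p%:R :> R by []; rewrite ler_norml => ?; apply/andP; split; lra.
by apply: le_trans (nrm_ReIm _) _ => /=; have := cb pq.1; have := cb pq.2; lra.
Qed.

(** * Boundary points that follow an interior orbit *)

Section Walk.
Variables (V : set (Cplx R)) (z0 : R[i]) (H : nat -> R[i] -> R[i]) (M0 : R).
Hypotheses (oV : opn V) (bV : bdd V) (Vz0 : V z0) (M00 : 0 < M0).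
Hypothesis HC : forall n z, adh V z -> cont (H n) z.
Hypothesis HT : forall n z, V z -> exists a b, taylor2 (H n) z a b.
Hypothesis HM : forall n z, V z -> nrm (H n z) <= M0.
Hypothesis Hop : forall n z, V z -> exists2 d : R, 0 < d &
  forall c, nrm (c - H n z) < d -> exists2 y, V y & H n y = c.
Hypothesis Hdisj : forall m n z y, V z -> V y -> H m z = H n y -> m = n.

Definition hit (n : nat) (c : R[i]) : bool := `[< exists2 y, V y & H n y = c >].

(* [area L n] is the area of [H n @` V], measured with a square grid of mesh [M0 / L]. *)
Definition cnt (L n : nat) : nat :=
  \sum_(pq : 'I_(2 * L).+1 * 'I_(2 * L).+1) hit n (gpt M0 pq).

Definition area (L n : nat) : R := (M0 / L%:R) ^+ 2 * (cnt L n)%:R.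

(** The images are disjoint, so each grid point is hit at most once. *)
Lemma cnt_total L N : (\sum_(0 <= n < N) cnt L n <= (2 * L).+1 ^ 2)%N.
Proof.
rewrite /cnt exchange_big /=.
apply: (@leq_trans (\sum_(pq : 'I_(2 * L).+1 * 'I_(2 * L).+1) 1)); last first.
  by rewrite sum1_card card_prod card_ord.
apply: leq_sum => pq _; set c := gpt M0 pq.
elim: N => [|N ih]; first by rewrite big_geq.
rewrite big_nat_recr//=; case: (boolP (hit N c)) => [/asboolP[y Vy yc]|_]; last by rewrite addn0.
rewrite big_nat big1 ?add0n// => n /= nN; apply/eqP; rewrite eqb0.
apply/asboolP => -[x Vx xc].
have E : n = N by apply: (Hdisj Vx Vy); rewrite xc yc.
by rewrite E ltnn in nN.
Qed.

Lemma area_total L N : (0 < L)%N -> \sum_(0 <= n < N) area L n <= 9 * M0 ^+ 2.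
Proof.
move=> L0; rewrite -mulr_sumr -natr_sum.
apply: (@le_trans _ _ ((M0 / L%:R) ^+ 2 * ((2 * L).+1 ^ 2)%:R)).
  by rewrite ler_wpM2l ?sqr_ge0// ler_nat cnt_total.
have L0' : 0 < L%:R :> R by rewrite ltr0n.
rewrite natrX -exprMn -[9]/((3 * 3)%:R) natrM -expr2 -exprMn.
rewrite ler_pXn2r ?nnegrE ?mulr_ge0 ?divr_ge0 ?(ltW M00)//.
rewrite mulrAC ler_pdivrMr// mulrC -mulrA [M0 * _]mulrC mulrA ler_pM2r//.
by rewrite -natrM ler_nat -addn1 mulSn addnC leq_add2r.
Qed.

Lemma area_ge0 L n : 0 <= area L n.
Proof. by rewrite mulr_ge0 ?sqr_ge0. Qed.

(* The ultrafilter plays the role of a limit of the grid areas as the mesh tends to [0]. *)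
Lemma area_tail : exists2 U : set_system nat, UltraFilter U /\ \oo `<=` U &
  forall eta : R, 0 < eta -> exists N, forall M,
    U [set L | \sum_(N <= n < M) area L n < eta].
Proof.
have [U [ultU ooU]] := ultraFilterLemma (_ : ProperFilter \oo).
exists U => // eta eta0; apply: contrapT => H0.
(* An ultrafilter turns the failure of a bound into its negation on a large set of meshes. Finitely
   many blocks of area at least [eta] are then seen at one common mesh, and exceed the total
   [9 M0^2]. *)
have block N : exists M, (N <= M)%N /\ U [set L | eta <= \sum_(N <= n < M) area L n].
  apply: contrapT => H1; apply: H0; exists N => M.
  have [//|nU] := in_ultra_setVsetC [set L | \sum_(N <= n < M) area L n < eta] ultU.
  have [NM|MN] := leqP N M.
    exfalso; apply: H1; exists M; split => //; apply: filterS nU => L /=.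
    by rewrite leNgt => /negP.
  by apply: filterS (@filterT _ U _) => L _ /=; rewrite big_geq// ltnW.
have blocks k : exists M, U [set L | k%:R * eta <= \sum_(0 <= n < M) area L n].
  elim: k => [|k [M UM]].
    by exists 0%N; apply: filterS (@filterT _ U _) => L _ /=; rewrite mul0r big_geq.
  have [M' [MM UM']] := block M; exists M'.
  apply: filterS2 UM UM' => L /= h1 h2.
  by rewrite (big_cat_nat _ MM)//= -natr1 mulrDl mul1r lerD.
have [M UM] := blocks (Num.truncn (9 * M0 ^+ 2 / eta)).+1.
have UL : U [set L | (0 < L)%N] by apply: ooU; exists 1%N.
have PU : ProperFilter U := ultra_proper.
have [L /= [h1 h2]] := filter_ex (filterI UM UL).
have := area_total M h2; have := truncnS_gt (9 * M0 ^+ 2 / eta).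
by rewrite ltr_pdivrMr//; lra.
Qed.

(** Guarantees that at a fine mesh the grid points near [H (e j) z], for [z] in [X], are hit and
    hence carry a mass. *)
Lemma uniform_hit (X : set (Cplx R)) (e : nat -> nat) J : cpt X -> X `<=` V ->
  exists n, forall j, (j < J)%N -> forall z, X z -> forall c,
    nrm (c - H (e j) z) < n.+1%:R^-1 -> exists2 y, V y & H (e j) y = c.
Proof.
move=> cX XV; elim: J => [|J [n ih]]; first by exists 0%N.
have [z Xz|m m' z mm Hm c cz|n' Hn'] := @cpt_unif R X (fun n z => forall c,
    nrm (c - H (e J) z) < n.+1%:R^-1 -> exists2 y, V y & H (e J) y = c) cX.
- have [d d0 D] := Hop (e J) (XV _ Xz).
  have d20 : 0 < d / 2 by rewrite divr_gt0.
  have [n' Hn'] := inv_small d20; exists n'.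
  have [d' d'0 D'] := HC (e J) (adh_sub (XV _ Xz)) d20; exists d' => // w Xw /D' wd c cw.
  have {}cw := lt_le_trans cw Hn'.
  by apply: D; have := nrm_tri (H (e J) w) c (H (e J) z); lra.
- apply: Hm; apply: lt_le_trans cz _.
  by rewrite lef_pV2 ?posrE// ler_nat ltnS.
- exists (maxn n n') => j; rewrite ltnS leq_eqVlt => /predU1P[->|jJ] z Xz c cz.
    apply: (Hn' z Xz); apply: lt_le_trans cz _.
    by rewrite lef_pV2 ?posrE// ler_nat ltnS leq_maxr.
  apply: (ih j jJ z Xz); apply: lt_le_trans cz _.
  by rewrite lef_pV2 ?posrE// ler_nat ltnS leq_maxl.
Qed.

(* If every boundary point is moved far away by one of the maps, the sum of the
   potentials is at least 1 on the boundary, hence at [z0] by the minimum principle. *)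
Lemma escape_count (e : nat -> nat) (dl : nat -> R) J : (forall j, 0 < dl j) ->
  (forall z, bd V z -> exists2 j, (j < J)%N & dl j < nrm (H (e j) z - H (e j) z0)) ->
  \forall L \near \oo,
    1 <= \sum_(j < J) 144 * (16 * M0 ^+ 2) / dl j ^+ 4 * area L (e j).
Proof.
move=> dl0 bad.
(* On [X] no map has moved the point beyond its tolerance; [bad] excludes boundary points, so [X] is
   a compact subset of [V]. *)
pose X : set (Cplx R) := [set z : Cplx R | adh V z /\
  forall j, (j < J)%N -> nrm (H (e j) z - H (e j) z0) <= dl j].
have XV : X `<=` V.
  move=> z [Az Hz]; apply: contrapT => nVz.
  have [j jJ] := bad z (conj Az nVz); have := Hz j jJ; lra.
have cX : cpt X.
  have [cA [B HB]] := adh_cpt bV; split; last by exists B => z [/HB].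
  move=> z Xz; have Az : adh V z by apply: cA => e' /Xz[w [Aw _] we]; exists w.
  split => // j jJ; rewrite leNgt; apply/negP => big.
  have g0 : 0 < nrm (H (e j) z - H (e j) z0) - dl j by lra.
  have [d d0 D] := HC (e j) Az g0.
  have [w [_ Hw] wz] := Xz d d0.
  have := Hw j jJ; have := D w wz; rewrite nrm_distC.
  by have := nrm_tri (H (e j) w) (H (e j) z) (H (e j) z0); lra.
have Xz0 : X z0.
  by split; [exact: adh_sub|move=> j _; rewrite subrr nrm0 ltW].
have [n Hn] := uniform_hit e J cX XV.
exists (Num.truncn (2 * M0 * n.+1%:R)).+1 => // L /= LL.
have L0 : (0 < L)%N by exact: leq_trans LL.
have L0' : 0 < L%:R :> R by rewrite ltr0n.
set h := M0 / L%:R.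
have h0 : 0 < h by rewrite divr_gt0.
have h1 : h <= M0 by rewrite ler_pdivrMr// ler_peMr ?(ltW M00)// ler1n.
have n0 : 0 < n.+1%:R :> R by [].
have h2 : 2 * h < n.+1%:R^-1.
  rewrite -[ltRHS]mul1r ltr_pdivlMr//.
  have -> : 2 * h * n.+1%:R = 2 * M0 * n.+1%:R / L%:R by rewrite /h; ring.
  rewrite ltr_pdivrMr// mul1r.
  by apply: lt_le_trans (truncnS_gt _) _; rewrite ler_nat.
(* Values and nodes are at most [3 M0] apart and [h <= M0], so [16 M0^2] exceeds the arguments of
   all logarithms and the potentials are nonnegative. *)
have A0 : 0 < 16 * M0 ^+ 2 by rewrite mulr_gt0// exprn_gt0.
pose S j := pot (dl j) h (16 * M0 ^+ 2) (H (e j) z0)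
   (fun pq : 'I_(2 * L).+1 * 'I_(2 * L).+1 => gpt M0 pq) (fun pq => hit (e j) (gpt M0 pq)).
have Slb j z : V z -> dl j ^- 4 * sqn (H (e j) z - H (e j) z0) ^+ 2 <= S j (H (e j) z).
  move=> Vz; apply: pot_lb => // pq.
  have : nrm (H (e j) z - gpt M0 pq) <= 3 * M0.
    by apply: le_trans (nrm_sub _ _) _; have := HM (e j) Vz; have := gpt_bound pq M00 L0; lra.
  rewrite -(ler_pXn2r (n:=2)) ?nnegrE ?nrm_ge0 ?mulr_ge0 ?(ltW M00)//= sqnE => H1.
  have : h ^+ 2 <= M0 ^+ 2 by rewrite ler_pXn2r ?nnegrE ?(ltW h0) ?(ltW M00).
  by move: H1; rewrite exprMn; lra.
have Sge0 j z : V z -> 0 <= S j (H (e j) z).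
  move=> Vz; apply: le_trans (Slb j z Vz).
  by rewrite mulr_ge0 ?sqr_ge0// invr_ge0 exprn_ge0// ltW.
have main : 1 <= \sum_(j < J) S j (H (e j) z0).
  apply: (@min_principle R X (fun z => \sum_(j < J) S j (H (e j) z))) => //.
    by move=> z [Az _]; apply: rcont_sum => j _; apply: pot_cont => //; exact: HC.
  move=> z Xz; have Vz := XV z Xz; have [Az Hz] := Xz.
  (* If a distance reaches [dl j], one quartic term is already at least [1]. Otherwise [z] is
     interior to [X], and every potential has a mass close by. *)
  have [[j0 jd]|nj] := pselect (exists j : 'I_J, dl j <= nrm (H (e j) z - H (e j) z0)).
    left; rewrite (bigD1 j0)//=.
    have s0 : 0 <= \sum_(j < J | j != j0) S j (H (e j) z).
      by apply: sumr_ge0 => j _; exact: Sge0.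
    have d4 : 0 < dl j0 ^+ 4 by rewrite exprn_gt0.
    have := Slb j0 z Vz; rewrite sqnE -exprM.
    have : 1 <= dl j0 ^- 4 * nrm (H (e j0) z - H (e j0) z0) ^+ (2 * 2).
      rewrite ler_pdivlMl// mulr1 ler_pXn2r ?nnegrE ?nrm_ge0// ltW//; exact: dl0.
    by lra.
  right; have strict (j : 'I_J) : nrm (H (e j) z - H (e j) z0) < dl j.
    by rewrite ltNge; apply/negP => hj; apply: nj; exists j.
  split.
    have step k : (k <= J)%N -> exists2 d : R, 0 < d & forall w, nrm (w - z) < d ->
        V w /\ forall j, (j < k)%N -> nrm (H (e j) w - H (e j) z0) <= dl j.
      elim: k => [_|k ih kJ].
        by have [d d0 D] := oV Vz; exists d => // w /D.
      have [d d0 D] := ih (ltnW kJ).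
      have g0 : 0 < dl k - nrm (H (e k) z - H (e k) z0) by rewrite subr_gt0 (strict (Ordinal kJ)).
      have [d' d'0 D'] := HC (e k) Az g0; exists (Num.min d d'); first by rewrite lt_min d0.
      move=> w; rewrite lt_min => /andP[/D[Vw Hw] /D' wd]; split => // j.
      rewrite ltnS leq_eqVlt => /predU1P[->|]; last exact: Hw.
      by have := nrm_tri (H (e k) z) (H (e k) w) (H (e k) z0); lra.
    have [d d0 D] := step J (leqnn J); exists d => // w /D[Vw Hw].
    by split => //; exact: adh_sub.
  have Sj (j : 'I_J) : exists l, l <= 0 /\ exists al, sec (fun w => S j (H (e j) w)) z al l.
    have [pq near] := gpt_near M00 L0 (HM (e j) Vz).
    have hpq : hit (e j) (gpt M0 pq).
      apply/asboolP; apply: (Hn j (ltn_ord j) z Xz); apply: le_lt_trans h2.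
      have h20 : 0 <= 2 * h by lra.
      rewrite nrm_distC -(ler_pXn2r (n:=2)) ?nnegrE ?nrm_ge0//= -sqnE.
      apply: le_trans near _; rewrite -/h [(2 * h) ^+ 2]exprMn.
      by have hh : 0 < h ^+ 2 by [rewrite exprn_gt0]; lra.
    have [al [l [l0 Sl]]] : exists al l, l <= 0 /\ sec (S j) (H (e j) z) al l.
      exact: pot_sec near.
    have [a [b T]] := HT (e j) Vz.
    exists (l * nrm a ^+ 2); split; last by eexists; exact: sec_holo T Sl.
    by rewrite mulr_le0_ge0// sqr_ge0.
  have [l Hl] := choice Sj.
  have [al Sal] := sec_sum (index_enum 'I_J) (fun j => (Hl j).2).
  by exists al, (\sum_(j < J) l j); split => //; apply: sumr_le0 => j _; exact: (Hl j).1.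
apply: le_trans main _; apply: ler_sum => j _; rewrite /area /cnt -/h.
exact: pot_center.
Qed.

(** If every boundary point failed some condition, compactness would bound the index of the failure
    by one [J], and [escape_count] would contradict the smallness of the sum at a mesh chosen by
    [U]. *)
Lemma boundary_point (U : set_system nat) (e : nat -> nat) (dl : nat -> R) :
  UltraFilter U -> \oo `<=` U -> (forall j, 0 < dl j) ->
  (forall J, U [set L | \sum_(j < J) 144 * (16 * M0 ^+ 2) / dl j ^+ 4 * area L (e j) < 1]) ->
  exists2 z, bd V z & forall j, nrm (H (e j) z - H (e j) z0) <= dl j.
Proof.
move=> ultU ooU dl0 HU; apply: contrapT => none.
have bad z : bd V z -> exists j, dl j < nrm (H (e j) z - H (e j) z0).
  move=> Bz; apply: contrapT => nj; apply: none; exists z => // j.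
  by rewrite leNgt; apply/negP => jb; apply: nj; exists j.
have [z Bz|m n w mn [j jm jb]|J HJ] := @cpt_unif R (bd V)
    (fun J z => exists2 j, (j < J)%N & dl j < nrm (H (e j) z - H (e j) z0)) (bd_cpt oV bV).
- have [j jb] := bad z Bz; exists j.+1.
  have g0 : 0 < nrm (H (e j) z - H (e j) z0) - dl j by lra.
  have [d d0 D] := HC (e j) Bz.1 g0; exists d => // w _ /D wd; exists j => //.
  by have := nrm_tri (H (e j) w) (H (e j) z) (H (e j) z0);
     rewrite (nrm_distC (H (e j) z) (H (e j) w)); lra.
- by exists j => //; exact: leq_trans mn.
- have E := ooU _ (escape_count dl0 HJ).
  have PU : ProperFilter U := ultra_proper.
  have [L /= [h1 h2]] := filter_ex (filterI E (HU J)).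
  by move: h2; rewrite ltNge h1.
Qed.

End Walk.

End Potential.

(** * Bounded orbits and the bungee set *)

Section Islands.
Variable R : realType.
Implicit Types (z w a c : R[i]) (A V G : set (Cplx R)).

Lemma ent_inv_taylor2 F c z : ent F -> F z != c ->
  exists a b, taylor2 (fun w => (F w - c)^-1) z a b.
Proof.
move=> eF Fc; have [g eg [DF _]] := ent_taylor2 eF.
have dist y : diff (fun w => F w - c) y (g y).
  by have := diffB (DF y) (diff_cst c y); rewrite subr0.
have n0 : F z - c != 0 by rewrite subr_eq0.
have [d d0 D] := ent_cont eF z (nrm_gt0 n0).
have near w : nrm (w - z) < d -> F w - c != 0.
  move=> /D wd; rewrite subr_eq0; apply: contraTneq wd => ->.
  by rewrite nrm_distC ltxx.
have [b Db] := eg z.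
have [a2 D2] := diffX 2 (dist z).
have D3 := diffM (diffN Db) (@diffV _ (fun w => (F w - c) ^+ 2) z _ (expf_neq0 2 n0) D2).
have D4 w (wd : nrm (w - z) < d) := @diffV _ (fun w => F w - c) w _ (near w wd) (dist w).
by do 2 eexists; exact: (diff_taylor2 (g := fun w => - g w / (F w - c) ^+ 2) d0 D4 D3).
Qed.

Lemma bd_nonempty V z : opn V -> bdd V -> V z -> exists w, bd V w.
Proof.
move=> oV [M HM] Vz; apply: contrapT => nb.
have M0 : 0 <= M := le_trans (nrm_ge0 _) (HM z Vz).
pose w := z + (2 * M + 1)%:C.
have E : w - z = (2 * M + 1)%:C by rewrite /w; ring.
have wz : nrm (w - z) = 2 * M + 1 by rewrite E nrm_real ger0_norm//; lra.
have Vw : V w.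
  apply: (@connected_const R (disk z (2 * M + 2)) V) Vz.
  - exact: disk_connected.
  - move=> y _; have [Vy|nVy] := pselect (V y).
      by have [d d0 D] := oV y Vy; exists d => // x _ /D.
    have : ~ adh V y by move=> Ay; apply: nb; exists y.
    move=> /existsNP[e /not_implyP[e0 ne]]; exists e => // x _ xy.
    by split => // Vx; exfalso; apply: ne; exists x.
  - by rewrite /disk /= subrr nrm0; lra.
  - by rewrite /disk /= wz; lra.
by have := HM w Vw; have := HM z Vz; have := nrm_sub w z; lra.
Qed.

(** * Iterates and complete invariance *)

Section Dyn.
Variable f : R[i] -> R[i].
Hypothesis ef : ent f.
Local Notation fn := (@fiter R f).

Definition BO z := exists K : R, forall n, nrm (fn n z) < K.
Definition ES z := forall M : R, exists N, forall n, (N <= n)%N -> M < nrm (fn n z).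

Lemma ent_iter n : ent (fn n).
Proof.
elim: n => [|n ih]; first exact: ent_id.
exact: (ent_comp ef ih).
Qed.

Lemma fiterD m n z : fn (m + n) z = fn m (fn n z).
Proof. exact: iterD. Qed.

Lemma BO_iter n z : BO (fn n z) <-> BO z.
Proof.
split=> [[K HK]|[K HK]]; last by exists K => m; rewrite -fiterD.
have [B HB] : exists B : R, forall m, (m < n)%N -> nrm (fn m z) < B.
  elim: n {HK} => [|n [B HB]]; first by exists 0.
  exists (Num.max B (nrm (fn n z) + 1)) => m; rewrite ltnS leq_eqVlt lt_max.
  by move=> /predU1P[->|/HB ->//]; rewrite ltrDl ltr01 orbT.
exists (Num.max B K) => m; rewrite lt_max; have [mn|nm] := ltnP m n; first by rewrite HB.
by rewrite -(subnK nm) fiterD HK orbT.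
Qed.

Lemma ES_iter n z : ES (fn n z) <-> ES z.
Proof.
split=> H M; have [N HN] := H M.
  exists (N + n)%N => m mN; have nm : (n <= m)%N := leq_trans (leq_addl N n) mN.
  by rewrite -(subnK nm) fiterD; apply: HN; rewrite leq_subRL// addnC.
by exists N => m mN; rewrite -fiterD; apply: HN; exact: leq_trans (leq_addr _ _).
Qed.

(** * Iterates omitting a disc *)

Section Omit.
Variables (G : set (Cplx R)) (a : R[i]) (r : R).
Hypotheses (oG : opn G) (r0 : 0 < r).
Hypothesis om : forall n z, G z -> r <= nrm (fn n z - a).

Lemma harnack_iter z : G z -> exists2 d : R, 0 < d & forall w, nrm (w - z) < d ->
  forall n, 2 / r * nrm (fn n w - a) <= (2 / r * nrm (fn n z - a)) ^+ 3 /\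
            2 / r * nrm (fn n z - a) <= (2 / r * nrm (fn n w - a)) ^+ 3.
Proof.
(* [rho / 16] is [(rho / 2) / 8], so the Harnack inequality can also be centred at [w]; its
   constants do not depend on [n]. *)
move=> Gz; have [rho rho0 D] := oG Gz; exists (rho / 16); first by rewrite divr_gt0.
move=> w wz n; split.
  apply: (@harnack R (fn n) a z r rho (ent_iter n) r0 rho0); last by lra.
  by move=> y /D; exact: om.
have r20 : 0 < rho / 2 by rewrite divr_gt0.
apply: (@harnack R (fn n) a w r (rho / 2) (ent_iter n) r0 r20); last by rewrite nrm_distC; lra.
by move=> y yw; apply/om/D; have := nrm_tri w y z; lra.
Qed.

Let cube_bound (x y K : R) : 0 <= x -> 2 / r * x <= K -> 2 / r * y <= (2 / r * x) ^+ 3 ->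
  y <= r / 2 * K ^+ 3.
Proof.
move=> x0 xK yx; have q0 : 0 <= 2 / r by rewrite divr_ge0// ltW.
have K0 : 0 <= K by apply: le_trans xK; rewrite mulr_ge0.
have : 2 / r * y <= K ^+ 3.
  have rx0 : 0 <= 2 / r * x := mulr_ge0 q0 x0.
  by apply: le_trans yx _; apply: lerXn2r.
move=> h; have E : y = r / 2 * (2 / r * y) by field; rewrite gt_eqF.
by rewrite E ler_pM2l ?divr_gt0.
Qed.

Let tr c (K : R) : nrm c <= K -> 2 / r * nrm (c - a) <= 2 / r * (K + nrm a).
Proof.
move=> cK; rewrite ler_pM2l ?divr_gt0//.
by apply: le_trans (nrm_sub _ _) _; rewrite lerD2r.
Qed.

Lemma BO_local z : G z -> exists2 d : R, 0 < d & forall w, nrm (w - z) < d -> (BO w <-> BO z).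
Proof.
move=> /harnack_iter[d d0 D]; exists d => // w /D H.
have key x y : (forall n, 2 / r * nrm (fn n y - a) <= (2 / r * nrm (fn n x - a)) ^+ 3) ->
    BO x -> BO y.
  move=> xy [K HK]; exists (r / 2 * (2 / r * (K + nrm a)) ^+ 3 + nrm a + 1) => n.
  have := cube_bound (nrm_ge0 _) (tr (ltW (HK n))) (xy n).
  by have := nrm_lbB (fn n y) a; lra.
by split; apply: key => n; have [] := H n.
Qed.

Lemma ES_local z : G z -> exists2 d : R, 0 < d & forall w, nrm (w - z) < d -> (ES w <-> ES z).
Proof.
move=> /harnack_iter[d d0 D]; exists d => // w /D H.
have key x y : (forall n, 2 / r * nrm (fn n x - a) <= (2 / r * nrm (fn n y - a)) ^+ 3) ->
    ES x -> ES y.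
  move=> xy Ex M; have [N HN] := Ex (r / 2 * (2 / r * (M + nrm a)) ^+ 3 + nrm a).
  exists N => n /HN big; rewrite ltNge; apply/negP => small.
  have := cube_bound (nrm_ge0 _) (tr small) (xy n).
  by have := nrm_lbB (fn n x) a; lra.
by split; apply: key => n; have [] := H n.
Qed.

End Omit.

(** * Orbits on the boundary of a component with disjoint images *)

Section Component.
Variables (V : set (Cplx R)) (E : set (Cplx R)) (a z0 : R[i]) (r : R).
Hypotheses (oV : opn V) (bV : bdd V) (cV : connected V) (Vz0 : V z0) (r0 : 0 < r).
Hypothesis om : forall n z, adh V z -> r <= nrm (fn n z - a).
Hypothesis Einv : forall n z, E (fn n z) <-> E z.
Hypotheses (VE : V `<=` E) (bE : forall z, bd V z -> ~ E z).
Hypothesis nBO : ~ (forall z, adh V z -> BO z).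

Let fC n z : cont (fn n) z. Proof. exact: ent_cont (ent_iter n) z. Qed.

Let fT n z : exists a b, taylor2 (fn n) z a b.
Proof.
have [g _ [_ T]] := ent_taylor2 (ent_iter n); have [b B] := T z.
by exists (g z), b.
Qed.

(** The connected set [fn m @] V[lies in]E[and so avoids the image under]fn
    n[of the boundary, which misses]E[; once it meets]fn n @[V] it is contained in it. *)
Lemma image_subset m n z y : V z -> V y -> fn m z = fn n y ->
  forall x, V x -> exists2 x', V x' & fn n x' = fn m x.
Proof.
move=> Vz Vy zy x Vx.
have cI : connected ((fn m : Cplx R -> Cplx R) @` V).
  apply: connected_continuous_connected => //; apply: continuous_subspaceT => t.
  exact/cont_continuous/fC.
apply: (connected_image oV bV _ _ cI).
- by move=> t _; exact: fC.
- by move=> t _; exact: fT.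
- move=> t Bt [s Vs st]; apply: (bE Bt); apply/(Einv n); rewrite -st.
  by apply/(Einv m)/VE.
- by exists y => //; exists z.
- by exists x.
Qed.

(** Since the later image lies in the earlier one, a time [k >= m] can be replaced by [k - m + n] at
    another point of [V]. The first [m] iterates thus bound all orbits in [V], and by continuity
    those on its closure, against [nBO]. *)
Lemma images_disjoint_lt m n z y : (n < m)%N -> V z -> V y -> fn m z = fn n y -> False.
Proof.
move=> nm Vz Vy zy; apply: nBO => t At.
have sub := image_subset Vz Vy zy.
have [B HB] : exists B : R, forall k, (k < m)%N -> forall x, V x -> nrm (fn k x) <= B.
  elim: (m) => [|k [B HB]]; first by exists 0.
  have [M HM] := bV; have [B' HB'] := ent_bounded 0 M (ent_iter k).
  exists (Num.max B B') => j; rewrite ltnS leq_eqVlt => /predU1P[->|jk] x Vx.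
    by rewrite le_max HB' ?orbT// subr0 HM.
  by rewrite le_max (HB j jk x Vx).
have all k x : V x -> nrm (fn k x) <= B.
  elim/ltn_ind: k x => k ih x Vx; have [km|mk] := ltnP k m; first exact: HB.
  have [x' Vx' E'] := sub x Vx.
  rewrite -(subnK mk) fiterD -E' -fiterD; apply: ih => //.
  by rewrite -[X in (_ < X)%N](subnK mk) ltn_add2l.
exists (B + 1) => k; rewrite ltNge; apply/negP => big.
have [d d0 D] := fC k t ltr01; have [w Vw wt] := At d d0.
have := all k w Vw; have := D w wt; have := nrm_lbB (fn k t) (fn k w).
by rewrite nrm_distC; lra.
Qed.

Lemma images_disjoint m n z y : V z -> V y -> fn m z = fn n y -> m = n.
Proof.
move=> Vz Vy zy; case: (ltngtP m n) => // h; exfalso.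
- exact: (images_disjoint_lt h Vy Vz (esym zy)).
- exact: images_disjoint_lt h Vz Vy zy.
Qed.

Let H n z : R[i] := (fn n z - a)^-1.

Let fna n z : adh V z -> fn n z != a.
Proof.
move=> Az; rewrite -subr_eq0; apply: nrm_gt0_neq; exact: lt_le_trans r0 (om n Az).
Qed.

Let HC n z : adh V z -> cont (H n) z.
Proof.
move=> Az; apply: contV; first by rewrite subr_eq0 fna.
by apply: contB; [exact: fC|exact: cont_cst].
Qed.

Let HT n z : V z -> exists a b, taylor2 (H n) z a b.
Proof. by move=> Vz; apply: ent_inv_taylor2; [exact: ent_iter|exact/fna/adh_sub]. Qed.

Let nH n z : nrm (H n z) = (nrm (fn n z - a))^-1.
Proof. exact: nrmV. Qed.

Let HM n z : V z -> nrm (H n z) <= r^-1.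
Proof.
move=> Vz; have h := om n (adh_sub Vz).
by rewrite nH lef_pV2 ?posrE//; exact: lt_le_trans r0 h.
Qed.

Let Hinj m n z y : H m z = H n y -> fn m z = fn n y.
Proof. by move=> /invr_inj /eqP; rewrite -subr_eq opprK subrK => /eqP. Qed.

(** Openness comes from invariance: boundary values cannot equal [H n z], since [fn n z] is in [E].
    They keep a distance [d], and [connected_image] fills the disc of that radius. *)
Let Hop n z : V z -> exists2 d : R, 0 < d &
  forall c, nrm (c - H n z) < d -> exists2 y, V y & H n y = c.
Proof.
move=> Vz; have [y [Ay _]|y By|d d0 D] := @cpt_dist R (bd V) (H n) (H n z) (bd_cpt oV bV).
- exact: HC.
- apply/eqP => /Hinj E'; apply: (bE By); apply/(Einv n); rewrite E'; exact/(Einv n)/VE.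
- exists d => // c cd.
  apply: (@connected_image R V (H n) (disk (H n z) d)) => //.
  + by move=> y; exact: HC.
  + by move=> y; exact: HT.
  + exact: disk_connected.
  + by move=> y /D h; rewrite /disk /=; lra.
  + by exists z => //; rewrite /disk /= subrr nrm0.
Qed.

Let Hdisj m n z y : V z -> V y -> H m z = H n y -> m = n.
Proof. by move=> Vz Vy /Hinj; exact: images_disjoint. Qed.

Let r0' : 0 < r^-1. Proof. by rewrite invr_gt0. Qed.

Let bp := boundary_point oV bV Vz0 r0' HC HT HM Hop.

Let big_small n z (c : R) : adh V z -> 0 < c -> c <= nrm (H n z) ->
  nrm (fn n z) <= c^-1 + nrm a.
Proof.
move=> Az c0; have h := lt_le_trans r0 (om n Az); rewrite nH => hc.
have : nrm (fn n z - a) <= c^-1 by rewrite -[leLHS]invrK lef_pV2 ?posrE ?invr_gt0.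
by have := nrm_lbB (fn n z) a; lra.
Qed.

Let small_big n z (c : R) : adh V z -> 0 < c -> nrm (H n z) <= c ->
  c^-1 - nrm a <= nrm (fn n z).
Proof.
move=> Az c0; have h := lt_le_trans r0 (om n Az); rewrite nH => hc.
have : c^-1 <= nrm (fn n z - a) by rewrite -[leRHS]invrK lef_pV2 ?posrE ?invr_gt0.
by have := nrm_sub (fn n z) a; lra.
Qed.

Let K0 := 144 * (16 * (r^-1) ^+ 2).
Let K00 : 0 < K0. Proof. by rewrite !mulr_gt0 ?exprn_gt0. Qed.

(** A bounded orbit keeps [|H n z0| >= c]. With the constant tolerance [c / 2] at all times from [N]
    on, the boundary point keeps [|H n z| >= c / 2], so its orbit is bounded too. *)
Lemma boundary_BO : BO z0 -> exists2 z, bd V z & BO z.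
Proof.
move=> [K HK].
have Kp : 0 < K + nrm a + 1.
  by have := HK 0%N; have := nrm_ge0 (fn 0 z0); have := nrm_ge0 a; lra.
pose c := (K + nrm a + 1)^-1.
have c0 : 0 < c by rewrite invr_gt0.
have Hz n : c <= nrm (H n z0).
  have h := lt_le_trans r0 (om n (adh_sub Vz0)).
  rewrite nH lef_pV2 ?posrE//.
  by have := nrm_sub (fn n z0) a; have := HK n; lra.
have [U [ultU ooU] tail] := area_tail r0' Hdisj.
have c20 : 0 < c / 2 by rewrite divr_gt0.
have c40 : 0 < (c / 2) ^+ 4 by rewrite exprn_gt0.
have [N HN] := tail ((c / 2) ^+ 4 / K0) (divr_gt0 c40 K00).
have [J|z Bz Hg] := @bp U (fun j => (N + j)%N) (fun=> c / 2) ultU ooU (fun=> c20).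
  have PU : ProperFilter U := ultra_proper.
  apply: filterS (HN (N + J)%N) => L /=; rewrite ltr_pdivlMr// => HL.
  rewrite -mulr_sumr mulrAC ltr_pdivrMr// mul1r mulrC.
  move: HL; rewrite -{1}[N]add0n big_addn addKn big_mkord.
  by under eq_bigr do rewrite addnC.
exists z => //; apply/(BO_iter N).
exists ((c / 2)^-1 + nrm a + 1) => j; rewrite -fiterD addnC.
have : c / 2 <= nrm (H (N + j) z).
  have := Hg j; have := Hz (N + j)%N; have := nrm_lbB (H (N + j) z0) (H (N + j) z).
  by rewrite nrm_distC; lra.
by move=> /(big_small Bz.1 c20); lra.
Qed.

(** It suffices to follow [z0] along two interlaced sequences of times, one of returns to a bounded
    region and one of excursions to infinity. *)
Lemma boundary_bungee : ~ ES z0 -> ~ BO z0 -> exists2 z, bd V z & ~ ES z /\ ~ BO z.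
Proof.
move=> nES nBOz0.
have [U [ultU ooU] tail] := area_tail r0' Hdisj.
have PU : ProperFilter U := ultra_proper.
have [c c0 Hc] : exists2 c : R, 0 < c & forall N, exists2 n, (N <= n)%N & c <= nrm (H n z0).
  apply: contrapT => nc; apply: nES => M; apply: contrapT => nN; apply: nc.
  pose q := Num.max M 0 + nrm a + 1.
  have q0 : 0 < q.
    have : 0 <= Num.max M 0 by rewrite le_max lexx orbT.
    by rewrite /q; have := nrm_ge0 a; lra.
  exists q^-1; first by rewrite invr_gt0.
  move=> N; apply: contrapT => nn; apply: nN; exists N => n Nn.
  rewrite ltNge; apply/negP => small; apply: nn; exists n => //.
  have h := lt_le_trans r0 (om n (adh_sub Vz0)); rewrite nH lef_pV2 ?posrE//.
  have : M <= Num.max M 0 by rewrite le_max lexx.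
  by rewrite /q; have := nrm_sub (fn n z0) a; lra.
have Hs (e : R) : 0 < e -> forall N, exists2 n, (N <= n)%N & nrm (H n z0) <= e.
  move=> e0 N; apply: contrapT => nn; apply: nBOz0; apply/(BO_iter N).
  exists (e^-1 + nrm a + 1) => m; rewrite -fiterD addnC.
  have Az := adh_sub Vz0.
  suff : e <= nrm (H (N + m) z0) by move=> /(big_small Az e0); lra.
  rewrite leNgt; apply/negP => h; apply: nn; exists (N + m)%N; first exact: leq_addr.
  exact: ltW.
have c20 : 0 < c / 2 by rewrite divr_gt0.
(* Even indices are returns with [c <= |H|]; odd ones are excursions, where the tolerance must tend
   to [0] so that the boundary point also gets far away. *)
pose dl (j : nat) : R := if odd j then j.+1%:R^-1 else c / 2.
have dl0 j : 0 < dl j by rewrite /dl; case: ifP => _ //; rewrite invr_gt0.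
(* The times may repeat or decrease: only [j <= e j] matters, together with a budget of [2^-(j+1)]
   for each index, which keeps every finite sum below [1]. *)
have ev j : exists n, [/\ (j <= n)%N,
    if odd j then nrm (H n z0) <= j.+1%:R^-1 else c <= nrm (H n z0) &
    U [set L | K0 / dl j ^+ 4 * area V H r^-1 L n <= (2^-1) ^+ j.+1]].
  have d40 : 0 < dl j ^+ 4 by rewrite exprn_gt0.
  have eta0 : 0 < dl j ^+ 4 * (2^-1) ^+ j.+1 / K0.
    by rewrite divr_gt0// mulr_gt0// exprn_gt0.
  have [N HN] := tail _ eta0.
  have [n Nn Pn] : exists2 n, (maxn N j <= n)%N &
     if odd j then nrm (H n z0) <= j.+1%:R^-1 else c <= nrm (H n z0).
    by case: (odd j); [apply: Hs; rewrite invr_gt0|exact: Hc].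
  move: Nn; rewrite geq_max => /andP[Nn jn].
  exists n; split => //; apply: filterS (HN n.+1) => L /= HL.
  have aL : area V H r^-1 L n <= dl j ^+ 4 * (2^-1) ^+ j.+1 / K0.
    apply: le_trans (ltW HL); rewrite big_nat_recr//= lerDr.
    by apply: sumr_ge0 => i _; exact: area_ge0.
  rewrite mulrAC ler_pdivrMr//; rewrite ler_pdivlMr// in aL.
  by rewrite mulrC [leRHS]mulrC.
have [e He] := choice ev.
have [J|z Bz Hg] := @bp U e dl ultU ooU dl0.
  suff : U [set L | \sum_(j < J) K0 / dl j ^+ 4 * area V H r^-1 L (e j) <= 1 - (2^-1) ^+ J].
    apply: filterS => L /= h; apply: le_lt_trans h _.
    by rewrite ltrBlDr ltrDl exprn_gt0// invr_gt0.
  elim: J => [|J ih].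
    by apply: filterS (@filterT _ U _) => L _ /=; rewrite big_ord0 expr0 subrr.
  have [_ _ UJ] := He J; apply: filterS2 ih UJ => L /= h1 h2.
  rewrite big_ord_recr /=.
  have : (2^-1 : R) ^+ J.+1 = 2^-1 * 2^-1 ^+ J by rewrite exprS.
  by lra.
exists z => //; split.
- move=> /(_ ((c / 2)^-1 + nrm a))[N HN].
  have [jN hz _] := He (2 * N)%N; have := Hg (2 * N)%N.
  rewrite /dl mul2n odd_double in hz *; rewrite -mul2n in hz *.
  have : c / 2 <= nrm (H (e (2 * N)%N) z) -> False.
    move=> /(big_small Bz.1 c20) h; have := HN (e (2 * N)%N).
    move=> /(_ (leq_trans _ jN)); rewrite -{1}[N]mul1n leq_mul2r orbT => /(_ isT); lra.
  move=> F h; apply: F; have := nrm_lbB (H (e (2 * N)%N) z0) (H (e (2 * N)%N) z).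
  by rewrite nrm_distC; lra.
- move=> [K HK]; pose j := (2 * (Num.truncn (`|K| + nrm a)).+1).+1.
  have oj : odd j by rewrite /j mul2n /= odd_double.
  have [_ hz _] := He j; have := Hg j; rewrite /dl oj in hz *.
  move=> h; have {}h : nrm (H (e j) z) <= 2 / j.+1%:R.
    have := nrm_lbB (H (e j) z) (H (e j) z0).
    rewrite (_ : 2 / j.+1%:R = j.+1%:R^-1 + j.+1%:R^-1); last first.
      by rewrite mulrDl mul1r.
    by move: h hz; set q := j.+1%:R^-1; lra.
  have j0 : 0 < 2 / j.+1%:R :> R by rewrite divr_gt0.
  have := small_big Bz.1 j0 h; rewrite invf_div.
  have := HK (e j); have := truncnS_gt (`|K| + nrm a).
  have : (Num.truncn (`|K| + nrm a)).+1%:R <= j.+1%:R / 2 :> R.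
    by rewrite ler_pdivlMr// -natrM ler_nat /j mulnC ltnW.
  by have := ler_norm K; lra.
Qed.

End Component.

Lemma no_island (E : set (Cplx R)) G U z0 a (r : R) :
  (E = BO \/ E = [set z : Cplx R | ~ ES z /\ ~ BO z]) ->
  opn G -> bdd G -> (forall z, bd G z -> ~ E z) -> G z0 -> E z0 ->
  connected U -> ~ bdd U -> U `<=` E -> 0 < r -> disk a r `<=` U -> False.
Proof.
move=> EE oG bG GE Gz0 Ez0 cU uU UE r0 aU.
have Einv n z : E (fn n z) <-> E z.
  case: EE => ->; first exact: BO_iter.
  by split=> -[h1 h2]; split=> h; [apply: h1|apply: h2|apply: h1|apply: h2];
    (apply/(ES_iter n) || apply/(BO_iter n)).
have fT n z : exists a b, taylor2 (fn n) z a b.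
  have [g _ [_ T]] := ent_taylor2 (ent_iter n); have [b B] := T z.
  by exists (g z), b.
have omU n z : adh G z -> ~ U (fn n z).
  move=> Az Ufz; have [Gz|nGz] := pselect (G z); last first.
    by apply: (GE z (conj Az nGz)); apply/(Einv n)/UE.
  have sub : forall c, U c -> exists2 z, G z & fn n z = c.
    apply: (connected_image oG bG _ _ cU).
    - by move=> y _; exact: ent_cont (ent_iter n) y.
    - by move=> y _; exact: fT.
    - by move=> y By Uy; apply: (GE y By); apply/(Einv n)/UE.
    - by exists z.
  apply: uU; have [M HM] := bG; have [B HB] := ent_bounded 0 M (ent_iter n).
  by exists B => c /sub[y Gy <-]; apply: HB; rewrite subr0 HM.
have om n z : adh G z -> r <= nrm (fn n z - a).
  by move=> Az; rewrite leNgt; apply/negP => h; apply: (omU n z Az); exact: aU.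
have om' n z : G z -> r <= nrm (fn n z - a) by move=> /adh_sub; exact: om.
have Eloc z : G z -> exists2 d : R, 0 < d & forall w, nrm (w - z) < d -> (E w <-> E z).
  move=> Gz; have [d d0 D] := BO_local oG r0 om' Gz; have [d' d'0 D'] := ES_local oG r0 om' Gz.
  exists (Num.min d d'); first by rewrite lt_min d0.
  move=> w; rewrite lt_min => /andP[/D h1 /D' h2]; case: EE => -> //=.
  by rewrite h1 h2.
pose O := G `&` E.
have oO : opn O.
  move=> z [Gz Ez]; have [d d0 D] := oG z Gz; have [d' d'0 D'] := Eloc z Gz.
  exists (Num.min d d'); first by rewrite lt_min d0.
  by move=> w; rewrite lt_min => /andP[/D Gw /D' Ew]; split => //; apply/Ew.
pose V := connected_component O z0.
have VO : V `<=` O by exact: connected_component_sub.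
have oV : opn V by exact: component_opn.
have Vz0 : V z0 by exact: connected_component_refl.
have bV : bdd V by have [M HM] := bG; exists M => z /VO[/HM].
have cV : connected V by exact: component_connected.
have AVG z : adh V z -> adh G z.
  by move=> Az e e0; have [w /VO[Gw _] wz] := Az e e0; exists w.
have VE : V `<=` E by move=> z /VO[].
have bVE z : bd V z -> ~ E z.
  move=> [Az nVz] Ez; have [Gz|nGz] := pselect (G z).
    by apply: nVz; apply: component_adh.
  by apply: (GE z) => //; split => //; exact: AVG.
have omV n z : adh V z -> r <= nrm (fn n z - a) by move=> /AVG; exact: om.
(* If all orbits on the closure were bounded, a boundary point would lie in [E = BO]; when [E] is
   the bungee set, [z0] itself would leave [E]. *)
have nBO : ~ (forall z, adh V z -> BO z).
  move=> all; case: EE => EE.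
    by have [w Bw] := bd_nonempty oV bV Vz0; apply: (bVE w Bw); rewrite EE; exact: all Bw.1.
  by move: Ez0; rewrite EE => -[_]; apply; apply: all; exact: adh_sub.
case: EE => EE; move: (Ez0); rewrite {1}EE => E0.
  have [z Bz Oz] := boundary_BO oV bV cV Vz0 r0 omV Einv VE bVE nBO E0.
  by apply: (bVE z Bz); rewrite EE.
have [z Bz Oz] := boundary_bungee oV bV cV Vz0 r0 omV Einv VE bVE nBO E0.1 E0.2.
by apply: (bVE z Bz); rewrite EE.
Qed.

End Dyn.

End Islands.

(** * The Riemann sphere *)

Section Separation.
Variable R : realType.

(** The part [A] of a separation that misses infinity is bounded, because infinity is not in its
    closure. Discs around its points, of radius half a lower bound for the distance to [B], form
    [G]. *)
Lemma separation_island (E : set (Cplx R)) : ~ connected (with_infty E) ->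
  exists G, exists z0, [/\ opn G, bdd G, G z0, E z0 & forall z, bd G z -> ~ E z].
Proof.
move=> /connectedPn[S [Sne SE Ssep]].
have [A [B [A0 BN AB sAB sBA]]] : exists A B : set (RiemannSphere R),
  [/\ A !=set0, B None, with_infty E = A `|` B,
      forall x, closure A x -> ~ B x & forall x, closure B x -> ~ A x].
  have : with_infty E None by right.
  have [s1 s2] := Ssep; rewrite SE => -[SN|SN].
    exists (S true), (S false); split => //; first by rewrite setUC.
      by move=> x cx Bx; have : (S false `&` closure (S true)) x by []; rewrite s2.
    by move=> x cx Ax; have : (closure (S false) `&` S true) x by []; rewrite s1.
  exists (S false), (S true); split => //.
    by move=> x cx Bx; have : (closure (S false) `&` S true) x by []; rewrite s1.
  by move=> x cx Ax; have : (S false `&` closure (S true)) x by []; rewrite s2.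
have EAB z : E z <-> A (Some z) \/ B (Some z).
  have : with_infty E (Some z) <-> (A `|` B) (Some z) by rewrite AB.
  move=> [h1 h2]; split=> [Ez|h]; first by apply: h1; left; exists z.
  by have [[y Ey [<-]]|] := h2 h.
have NA : ~ A None by move=> AN; apply: (sAB None) => //; exact: subset_closure.
have [K [cK _] AK] : exists2 K, (compact `&` closed) K & forall z, A (Some z) -> K z.
  have : ~ closure A None by move=> /sAB.
  move=> /existsNP[W /not_implyP[[K HK KW] nAW]]; exists K => // z Az.
  apply: contrapT => nKz; apply: nAW; exists (Some z); split => //.
  by apply: KW; left; exists z.
have [a0 Aa0] : exists z, A (Some z) by case: A0 => -[z Az|//]; exists z.
have [M HM] : exists M : R, forall z, A (Some z) -> nrm z <= M.
  have [||m _ Hm] := @compact_EVT_max (Cplx R) R (@nrm R) K _ cK.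
  - by exists a0; exact: AK.
  - apply/subspace_continuousP => z Kz.
    by apply/rcontP; apply: (@rcont_nrm R K id); exact: cont_id.
  by exists (nrm m) => z /AK Kz; apply: Hm; rewrite inE.
have sep (P Q : set (RiemannSphere R)) z : (forall x, closure Q x -> ~ P x) -> P (Some z) ->
   exists2 r : R, 0 < r & forall y, Q (Some y) -> r <= nrm (y - z).
  move=> PQ Pz; have : ~ closure Q (Some z) by move=> /PQ.
  move=> /existsNP[W /not_implyP[/nbhs_nrmP[r r0 Wr] nQW]]; exists r => // y Qy.
  rewrite leNgt; apply/negP => yz; apply: nQW; exists (Some y); split => //.
  exact: (Wr y yz).
(* The cap [r <= 1] keeps [G] bounded. Halving keeps [B] off its boundary: such a point would be
   closer to some point of [A] than half the sum of two lower bounds for their distance. *)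
pose G : set (Cplx R) := [set w : Cplx R | exists z, A (Some z) /\ exists r : R,
  [/\ 0 < r, r <= 1, forall y, B (Some y) -> r <= nrm (y - z) & nrm (w - z) < r / 2]].
have AG z : A (Some z) -> G z.
  move=> Az; exists z; split => //; have [r r0 Hr] := sep A B z sBA Az.
  exists (Num.min r 1); rewrite lt_min r0 ltr01 ge_min lexx orbT; split => //.
    by move=> y /Hr h; rewrite ge_min h.
  by rewrite subrr nrm0 divr_gt0// lt_min r0 ltr01.
exists G, a0; split.
- move=> w [z [Az [r [r0 r1 Hr wr]]]]; exists (r / 2 - nrm (w - z)); first by rewrite subr_gt0.
  move=> y yw; exists z; split => //; exists r; split => //.
  by have := nrm_tri w y z; lra.
- exists (M + 1) => w [z [Az [r [r0 r1 Hr wr]]]].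
  by have := HM z Az; have := nrm_lbB w z; lra.
- exact: AG.
- by apply/EAB; left.
- move=> z [aGz nGz] /EAB[/AG//|Bz].
  have [r r0 Hr] := sep B A z sAB Bz.
  have r20 : 0 < r / 2 by rewrite divr_gt0.
  have [w [x [Ax [s [s0 s1 Hs ws]]]] wz] := aGz _ r20.
  have := Hr x Ax; have := Hs z Bz; have := nrm_tri w z x.
  by rewrite (nrm_distC z w) (nrm_distC z x); lra.
Qed.

Lemma normal_subset f (A B : set (Cplx R)) : B `<=` A ->
  iterates_normal_on f A -> iterates_normal_on f B.
Proof.
move=> BA N s; have [phi [mono H]] := N s; exists phi; split => //.
case: H => [[g [Dg Cg]]|C]; [left|right].
  exists g; split; first by move=> w /BA; exact: Dg.
  move=> z /BA/Cg[r r0 H]; exists r => // e /H; apply: filterS => k Hk w /BA; exact: Hk.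
by move=> z /BA/C[r r0 H]; exists r => // M; apply: filterS (H M) => k Hk w /BA; exact: Hk.
Qed.

(** Normality passes to smaller discs, so a disc witnessing it consists of Fatou points; being
    connected, it lies in one component. *)
Lemma component_disk f U : fatou_component f U ->
  connected U /\ exists a, exists2 r : R, 0 < r & disk a r `<=` U.
Proof.
move=> [z Fz ->]; split; first exact: component_connected.
have [r r0 N] := Fz; exists z, r => //.
apply: connected_component_max; last exact: disk_connected.
  by rewrite /disk /= subrr nrm0.
move=> w wr; rewrite /disk /= in wr.
exists (r - nrm (w - z)); first by rewrite subr_gt0.
apply: normal_subset N => y; rewrite /disc /= !normE !ltc_real => yw.
by have := nrm_tri w y z; lra.
Qed.

Lemma bounded_orbit_setE (f : Cplx R -> Cplx R) : bounded_orbit_set f = BO f.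
Proof.
apply/seteqP; split=> z [K HK]; exists K => n; have := HK n; by rewrite normE ltc_real.
Qed.

Lemma escaping_setE (f : Cplx R -> Cplx R) z : escaping_set f z <-> ES f z.
Proof.
split=> [H M|H M].
  by have [N _ HN] := H M; exists N => n /HN /=; rewrite normE ltc_real.
by have [N HN] := H M; exists N => // n /HN /=; rewrite normE ltc_real.
Qed.

Lemma bungee_setE (f : Cplx R -> Cplx R) : bungee_set f = [set z : Cplx R | ~ ES f z /\ ~ BO f z].
Proof.
rewrite /bungee_set bounded_orbit_setE; apply/seteqP; split=> z.
  by move=> h; split=> h'; apply: h; [left; apply/escaping_setE|right].
by move=> [h1 h2] [/escaping_setE|].
Qed.

Lemma connected_with_infty (f : Cplx R -> Cplx R) (E : set (Cplx R)) : entire f ->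
  (E = BO f \/ E = [set z : Cplx R | ~ ES f z /\ ~ BO f z]) ->
  (exists U, fatou_component f U /\ unbounded U /\ U `<=` E) ->
  connected (with_infty E).
Proof.
move=> ef EE [U [FU [uU UE]]]; apply: contrapT => /separation_island[G [z0 [oG bG Gz0 Ez0 bE]]].
have entf : ent f by move=> z; exact: derivable_diff (ef z).
have [cU [a [r r0 aU]]] := component_disk FU.
apply: (no_island entf EE oG bG bE Gz0 Ez0 cU _ UE r0 aU) => -[M HM].
have [z Uz] := uU M; rewrite normE ltc_real => Mz.
by have := HM z Uz; lra.
Qed.

End Separation.

Theorem theorem1p2 (R : realType) (f : Cplx R -> Cplx R) :
  transcendental_entire f ->
  ((exists U, fatou_component f U /\ unbounded U /\ U `<=` bounded_orbit_set f) ->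
     connected (with_infty (bounded_orbit_set f))) /\
  ((exists U, fatou_component f U /\ unbounded U /\ U `<=` bungee_set f) ->
     connected (with_infty (bungee_set f))).
Proof.
move=> [ef _]; rewrite bungee_setE bounded_orbit_setE; split.
- by apply: connected_with_infty => //; left.
- by apply: connected_with_infty => //; right.
Qed.
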